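(* Let $\mathcal{S}$ and $\mathcal{T}$ be $\Delta$-equivalent operator systems. Let $(\tau',\tau)$ be a pair of functorial operator system tensor products with $\tau'\le\tau$ such that one of the following holds: (i) $\tau'$ and $\tau$ are associative tensor products; or (ii) $\tau'$ is associative and $\tau=\mathrm{el}$; or (iii) $\tau'$ is associative and $\tau=\mathrm{er}$; or (iv) $\tau'=\mathrm{el}$ and $\tau$ is associative; or (v) $\tau'=\mathrm{er}$ and $\tau$ is associative; or (vi) $(\tau',\tau)=(\mathrm{el},\mathrm{c})$. Then $\mathcal{S}$ is $(\tau',\tau)$-nuclear if and only if $\mathcal{T}$ is $(\tau',\tau)$-nuclear.
   Context: An operator system is a (not necessarily closed) selfadjoint subspace of some $\mathcal{B}(H)$ containing $I_H$. $[\,\cdot\,]$ is norm-closed linear span. A TRO is a linear subspace $\mathcal{M}\subseteq\mathcal{B}(H,K)$ with $\mathcal{M}\mathcal{M}^*\mathcal{M}\subseteq\mathcal{M}$; it is non-degenerate if $I_H\in[\mathcal{M}^*\mathcal{M}]$ and $I_K\in[\mathcal{M}\mathcal{M}^*]$. Concrete operator systems $\mathcal{S}\subseteq\mathcal{B}(H)$, $\mathcal{T}\subseteq\mathcal{B}(K)$ are TRO-equivalent if there is a non-degenerate TRO $\mathcal{M}\subseteq\mathcal{B}(H,K)$ with $\mathcal{M}^*\mathcal{T}\mathcal{M}\subseteq\overline{\mathcal{S}}$ and $\mathcal{M}\mathcal{S}\mathcal{M}^*\subseteq\overline{\mathcal{T}}$. Operator systems are $\Delta$-equivalent if they have unital complete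 order embeddings with TRO-equivalent images. An operator system tensor product $\tau$ assigns to each pair of operator systems $\mathcal{S},\mathcal{R}$ an operator system structure on the algebraic tensor product $\mathcal{S}\odot\mathcal{R}$ with unit $1\otimes1$, such that $P\otimes Q$ is positive for $P\in M_n(\mathcal{S})^+$, $Q\in M_m(\mathcal{R})^+$, and $\phi\otimes\psi$ is unital completely positive for all unital completely positive $\phi:\mathcal{S}\to M_n$, $\psi:\mathcal{R}\to M_m$; $\mathcal{S}\otimes_\tau\mathcal{R}$ denotes the completion of $\mathcal{S}\odot\mathcal{R}$ in the $\tau$-norm. $\tau$ is functorial if any pair of unital completely positive maps $\phi_i:\mathcal{S}_i\to\mathcal{T}_i$, $i=1,2$, induces a unital completely positive map $\phi_1\otimes\phi_2:\mathcal{S}_1\otimes_\tau\mathcal{S}_2\to\mathcal{T}_1\otimes_\tau\mathcal{T}_2$. $\tau$ is associative if canonically $(\mathcal{S}_1\otimes_\tau\mathcal{S}_2)\otimes_\tau\mathcal{S}_3\simeq\mathcal{S}_1\otimes_\tau(\mathcal{S}_2\otimes_\tau\mathcal{S}_3)$ for all operator systems. $\tau'\le\tau$ means that the identity on $\mathcal{S}\odot\mathcal{R}$ lifts to a completely positive map $\mathcal{S}\otimes_\tau\mathcal{R}\to\mathcal{S}\otimes_{\tau'}\mathcal{R}$ for all $\mathcal{S},\mathcal{R}$. For $\tau'\le\tau$, $\mathcal{S}$ is $(\tau',\tau)$-nuclear if for every operator system $\mathcal{R}$ the identity map on $\mathcal{S}\odot\mathcal{R}$ lifts to a complete order isomorphism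 $\mathcal{S}\otimes_\tau\mathcal{R}\to\mathcal{S}\otimes_{\tau'}\mathcal{R}$. The maximal tensor product $\max$ is characterised by linearising every jointly completely positive bilinear map from $\mathcal{S}\times\mathcal{R}$ into an operator system to a completely positive map. Commuting tensor product $\mathrm{c}$: $u\in M_n(\mathcal{S}\odot\mathcal{R})$ is positive if $(\phi\cdot\psi)^{(n)}(u)\ge0$, where $(\phi\cdot\psi)(x\otimes y)=\phi(x)\psi(y)$, for all unital completely positive $\phi$ on $\mathcal{S}$ and $\psi$ on $\mathcal{R}$ with commuting ranges. With $\mathcal{I}(\cdot)$ the injective envelope, the essential left tensor product $\mathrm{el}$ is defined by requiring that $\mathcal{S}\odot\mathcal{R}\subseteq\mathcal{I}(\mathcal{S})\otimes_{\max}\mathcal{R}$ lifts to a complete order embedding of $\mathcal{S}\otimes_{\rm el}\mathcal{R}$, and the essential right tensor product $\mathrm{er}$ by requiring that $\mathcal{S}\odot\mathcal{R}\subseteq\mathcal{S}\otimes_{\max}\mathcal{I}(\mathcal{R})$ lifts to a complete order embedding of $\mathcal{S}\otimes_{\rm er}\mathcal{R}$. *)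

(* Defs.v *)
From HB Require Import structures.
From mathcomp Require Import all_boot all_order all_algebra.
From mathcomp Require Import all_classical all_reals interval_inference topology
  normedtype.
From mathcomp Require Import sequences.
From mathcomp Require Import complex mxtens ring.
Import Order.TTheory GRing.Theory Num.Theory numFieldNormedType.Exports.

Set Implicit Arguments.
Unset Strict Implicit.
Unset Printing Implicit Defensive.

Local Open Scope ring_scope.
Local Open Scope classical_set_scope.
Local Open Scope quotient_scope.

(* Formal sums of pairs, modulo having the same value under every bilinear
   map; [tlift] below is the resulting universal property. *)
Section AlgebraicTensor.
Variables (K : comNzRingType) (U V : lmodType K).

Definition fsum (W : lmodType K) (b : {bilinear U -> V -> W})
  (s : seq (U * V)) : W := \sum_(p <- s) b p.1 p.2.

Definition teq (s t : seq (U * V)) : bool :=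
  `[< forall (W : lmodType K) (b : {bilinear U -> V -> W}),
        fsum b s = fsum b t >].

Lemma teq_refl : reflexive teq. Proof. by move=> s; apply/asboolP. Qed.

Lemma teq_sym : symmetric teq.
Proof.
by move=> s t; apply/asboolP/asboolP => st W b; rewrite st.
Qed.

Lemma teq_trans : transitive teq.
Proof.
by move=> t s u /asboolP st /asboolP tu; apply/asboolP => W b; rewrite st.
Qed.

Canonical teq_equiv := EquivRel teq teq_refl teq_sym teq_trans.

Definition tensor := {eq_quot teq_equiv}.

HB.instance Definition _ := Choice.on tensor.
HB.instance Definition _ := EqQuotient.on tensor.

Lemma tensor_eqP (s t : seq (U * V)) :
  reflect (forall (W : lmodType K) (b : {bilinear U -> V -> W}),
             fsum b s = fsum b t)
          (s == t %[mod tensor]).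
Proof. by rewrite eqmodE; apply: asboolP. Qed.

Lemma fsum_repr (W : lmodType K) (b : {bilinear U -> V -> W}) s :
  fsum b (repr (\pi_tensor s)) = fsum b s.
Proof. by apply: (tensor_eqP _ _ _); rewrite reprK. Qed.

Let oppt (u : tensor) : tensor :=
  \pi_tensor [seq (- p.1, p.2) | p <- repr u].
Let addt (u v : tensor) : tensor := \pi_tensor (repr u ++ repr v).
Let zerot : tensor := \pi_tensor [::].
Let scalet (a : K) (u : tensor) : tensor :=
  \pi_tensor [seq (a *: p.1, p.2) | p <- repr u].

Let fsum_opp (W : lmodType K) (b : {bilinear U -> V -> W}) s :
  fsum b [seq (- p.1, p.2) | p <- s] = - fsum b s.
Proof.
by rewrite /fsum big_map -sumrN; apply: eq_bigr => p _; rewrite linearNl.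
Qed.

Let fsum_scale (W : lmodType K) (b : {bilinear U -> V -> W}) a s :
  fsum b [seq (a *: p.1, p.2) | p <- s] = a *: fsum b s.
Proof.
by rewrite /fsum big_map scaler_sumr; apply: eq_bigr => p _;
  rewrite linearZl_LR.
Qed.

Let fsum_cat (W : lmodType K) (b : {bilinear U -> V -> W}) s t :
  fsum b (s ++ t) = fsum b s + fsum b t.
Proof. by rewrite /fsum big_cat. Qed.

Let fsum_nil (W : lmodType K) (b : {bilinear U -> V -> W}) : fsum b [::] = 0.
Proof. by rewrite /fsum big_nil. Qed.

Let fsumE := (fsum_repr, fsum_opp, fsum_scale, fsum_cat, fsum_nil).

Let tensor_ext (u v : tensor) :
  (forall (W : lmodType K) (b : {bilinear U -> V -> W}),
     fsum b (repr u) = fsum b (repr v)) -> u = v.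
Proof.
by move=> uv; rewrite -[u]reprK -[v]reprK; apply/eqP/tensor_eqP.
Qed.

Let addtA : associative addt.
Proof. by move=> u v w; apply: tensor_ext => W b; rewrite !fsumE addrA. Qed.
Let addtC : commutative addt.
Proof. by move=> u v; apply: tensor_ext => W b; rewrite !fsumE addrC. Qed.
Let add0t : left_id zerot addt.
Proof. by move=> u; apply: tensor_ext => W b; rewrite !fsumE add0r. Qed.
Let addNt : left_inverse zerot oppt addt.
Proof. by move=> u; apply: tensor_ext => W b; rewrite !fsumE addNr. Qed.

HB.instance Definition _ :=
  GRing.isZmodule.Build tensor addtA addtC add0t addNt.

Let scaletA a b u : scalet a (scalet b u) = scalet (a * b) u.
Proof. by apply: tensor_ext => W f; rewrite !fsumE scalerA. Qed.
Let scale1t : left_id 1 scalet.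
Proof. by move=> u; apply: tensor_ext => W b; rewrite !fsumE scale1r. Qed.
Let scaletDr : right_distributive scalet +%R.
Proof.
by move=> a u v; apply: tensor_ext => W b; rewrite !fsumE scalerDr.
Qed.
Let scaletDl u : {morph scalet^~ u : a b / a + b}.
Proof. by move=> a b; apply: tensor_ext => W f; rewrite !fsumE scalerDl. Qed.

HB.instance Definition _ := GRing.Zmodule_isLmodule.Build K tensor
  scaletA scale1t scaletDr scaletDl.

Definition tpure (x : U) (y : V) : tensor := \pi_tensor [:: (x, y)].

Let fsum1 (W : lmodType K) (b : {bilinear U -> V -> W}) x y :
  fsum b [:: (x, y)] = b x y.
Proof. by rewrite /fsum big_seq1. Qed.

Lemma tpure_is_bilinear : bilinear_for
  (GRing.Scale.Law.clone K tensor *:%R _) (GRing.Scale.Law.clone K tensor *:%R _)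
  tpure.
Proof.
split=> [y|x] a u v /=; apply: tensor_ext => W b; rewrite !fsumE ?fsum1.
- by rewrite linearPl.
- by rewrite linearPr.
Qed.

HB.instance Definition _ := bilinear_isBilinear.Build K U V tensor _ _ tpure
  tpure_is_bilinear.

Section Lift.
Variables (W : lmodType K) (b : {bilinear U -> V -> W}).

Definition tlift (u : tensor) : W := fsum b (repr u).

Lemma tlift_is_linear : linear tlift.
Proof. by move=> a u v; rewrite /tlift !fsumE. Qed.

HB.instance Definition _ :=
  GRing.isLinear.Build K tensor W *:%R tlift tlift_is_linear.

Lemma tlift_pure x y : tlift (tpure x y) = b x y.
Proof. by rewrite /tlift fsum_repr fsum1. Qed.

End Lift.

Lemma tensorP (u : tensor) : exists s : seq (U * V),
  u = \sum_(p <- s) tpure p.1 p.2.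
Proof.
exists (repr u); apply: tensor_ext => W b.
rewrite -[RHS]/(tlift b _) linear_sum /=; apply: eq_bigr => p _.
by rewrite tlift_pure.
Qed.

End AlgebraicTensor.

Notation "U ⊙ V" := (tensor U V) (at level 40, left associativity) : type_scope.
Notation "x ⊗ y" := (tpure x y) (at level 40, left associativity) : ring_scope.

Section TensorMap.
Variables (K : comNzRingType) (U V U' V' : lmodType K).
Variables (f : {linear U -> U'}) (g : {linear V -> V'}).

Definition tmap_bilinear (x : U) (y : V) : U' ⊙ V' := f x ⊗ g y.

Lemma tmap_is_bilinear : bilinear_for
  (GRing.Scale.Law.clone K (U' ⊙ V') *:%R _)
  (GRing.Scale.Law.clone K (U' ⊙ V') *:%R _) tmap_bilinear.
Proof.
split=> [y|x] a u v; rewrite /tmap_bilinear linearP ?linearPl ?linearPr //.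
Qed.

HB.instance Definition _ := bilinear_isBilinear.Build K U V (U' ⊙ V') _ _
  tmap_bilinear tmap_is_bilinear.

Definition tmap : {linear U ⊙ V -> U' ⊙ V'} := tlift tmap_bilinear.

End TensorMap.

(* Rows and columns of the (n * m)-square matrix are indexed as for the
   Kronecker product [*t]. *)
Definition bilin_mx (U V W : Type) (b : U -> V -> W) n m
    (P : 'M[U]_n) (Q : 'M[V]_m) : 'M[W]_(n * m) :=
  \matrix_(i, j) b (P (mxtens_unindex i).1 (mxtens_unindex j).1)
                   (Q (mxtens_unindex i).2 (mxtens_unindex j).2).

Record hilbert (R : realType) := Hilbert {
  hspace :> completeNormedModType R[i];
  inner : {dot hspace for Num.conj};
  inner_norm : forall x : hspace, inner x x = `|x| ^+ 2
}.

Section CauchySchwarz.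
Variables (R : realType) (H : hilbert R).

Lemma norm_inner (x y : H) : `|inner H x y| <= `|x| * `|y|.
Proof.
have [->|y0] := eqVneq y 0; first by rewrite linear0r !normr0 mulr0.
have yn0 : `|y| ^+ 2 != 0 by rewrite expf_eq0 /= normr_eq0.
pose a := inner H x y / `|y| ^+ 2.
have := dnorm_ge0 (inner H) (x - a *: y).
rewrite dnormB dnormZ !inner_norm.
set d := inner H x (a *: y).
have {d}-> : d = `|inner H x y| ^+ 2 / `|y| ^+ 2.
  rewrite /d linearZr_LR /=.
  transitivity (Num.conj a * inner H x y); first by [].
  have yc : Num.conj (`|y| ^+ 2) = `|y| ^+ 2.
    by apply/CrealP; rewrite rpredX ?normr_real.
  rewrite /a rmorphM /= fmorphV /= yc.
  by rewrite normCK mulrAC; congr (_ / _); exact: mulrC.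
have q : Num.conj (`|inner H x y| ^+ 2 / `|y| ^+ 2) = `|inner H x y| ^+ 2 / `|y| ^+ 2.
  by apply/CrealP; rewrite rpredM ?rpredV ?rpredX ?normr_real.
rewrite q.
have -> : `|a| ^+ 2 * `|y| ^+ 2 = `|inner H x y| ^+ 2 / `|y| ^+ 2.
  rewrite /a normrM exprMn normfV normrX normr_id.
  by rewrite exprVn -mulrA [X in _ * X](_ : _ = (`|y| ^+ 2)^-1) // expr2 invfM
             -mulrA mulVf // mulr1.
rewrite opprD addrA addrK subr_ge0 ler_pdivrMr ?exprn_gt0 ?normr_gt0//.
by rewrite -exprMn ler_sqr ?nnegrE ?mulr_ge0.
Qed.

Lemma inner_inj (x y : H) : (forall z, inner H z x = inner H z y) -> x = y.
Proof.
move=> xy; apply/eqP; rewrite -subr_eq0 -(dnorm_eq0 (inner H)).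
by have := linearBr (inner H) (x - y) x y; rewrite /= xy subrr => ->.
Qed.

End CauchySchwarz.

Section BoundedOperators.
Variables (R : realType) (H K : hilbert R).

Definition bounded_linear : {pred H -> K} := fun f =>
  `[< linear f /\ exists2 M : R[i], 0 <= M & forall x, `|f x| <= M * `|x| >].

Lemma bounded_linear_submod : submod_closed bounded_linear.
Proof.
split=> [|a f g].
- apply/asboolP; split; first by move=> b x y; rewrite /= scaler0 addr0.
  by exists 0 => // x; rewrite normr0 mul0r.
- move=> /asboolP[fl [M M0 fM]] /asboolP[gl [N N0 gN]]; apply/asboolP; split.
    move=> b x y; rewrite !fctE fl gl !scalerDr addrACA !scalerA.
    by rewrite [(a * b)%R]mulrC.
  exists (`|a| * M + N) => [|x]; first by rewrite addr_ge0// mulr_ge0.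
  rewrite !fctE (le_trans (ler_normD _ _))//.
  by rewrite mulrDl lerD// normrZ -mulrA ler_wpM2l.
Qed.

HB.instance Definition _ := GRing.isSubmodClosed.Build R[i] (H -> K)
  bounded_linear bounded_linear_submod.

Record bop := Bop { bop_fun :> H -> K; _ : bop_fun \in bounded_linear }.

HB.instance Definition _ := [isSub for bop_fun].
HB.instance Definition _ := [Choice of bop by <:].
HB.instance Definition _ := [SubChoice_isSubLmodule of bop by <:].

Lemma bop_linear (f : bop) : linear f.
Proof. by have /asboolP[] := valP f. Qed.

HB.instance Definition _ (f : bop) :=
  GRing.isLinear.Build R[i] H K *:%R f (@bop_linear f).

Lemma bop_bounded (f : bop) : exists2 M : R[i], 0 <= M & forall x, `|f x| <= M * `|x|.
Proof. by have /asboolP[] := valP f. Qed.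

Lemma bopP (f g : bop) : f =1 g -> f = g.
Proof. by move=> fg; apply/val_inj/funext. Qed.

(* closure for the operator norm *)
Definition nclosure (A : set bop) : set bop :=
  [set x | forall e : R[i], 0 < e ->
     exists2 a, A a & forall h, `|x h - a h| <= e * `|h|].

Definition cspan (A : set bop) : set bop :=
  nclosure [set x | exists n (c : 'I_n -> R[i]) (a : 'I_n -> bop),
                      (forall i, A (a i)) /\ x = \sum_i c i *: a i].

End BoundedOperators.

Arguments bounded_linear {R} H K.

Section OperatorAlgebra.
Variable (R : realType).
Implicit Types H K L : hilbert R.

Lemma bop_id_subproof H : (@idfun H) \in bounded_linear H H.
Proof. by apply/asboolP; split=> //; exists 1 => // x; rewrite mul1r. Qed.

Definition bop_id H : bop H H := Bop (bop_id_subproof H).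

Lemma bop_comp_subproof H K L (g : bop K L) (f : bop H K) :
  (g \o f) \in bounded_linear H L.
Proof.
apply/asboolP; split; first by move=> a x y; rewrite /= !linearP.
have [M M0 fM] := bop_bounded f; have [N N0 gN] := bop_bounded g.
exists (N * M) => [|x]; first exact: mulr_ge0.
by rewrite /= (le_trans (gN _))// -mulrA ler_wpM2l.
Qed.

Definition bop_comp H K L (g : bop K L) (f : bop H K) : bop H L :=
  Bop (bop_comp_subproof g f).

Definition is_adjoint H K (a : bop H K) (a' : bop K H) : Prop :=
  forall h k, inner K (a h) k = inner H h (a' k).

Definition adjset H K (A : set (bop H K)) : set (bop K H) :=
  [set a' | exists2 a, A a & is_adjoint a a'].

Definition mulset H K L (B : set (bop K L)) (A : set (bop H K)) :
  set (bop H L) := [set bop_comp b a | b in B & a in A].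

Definition selfadjoint H (A : set (bop H H)) : Prop :=
  forall a, A a -> exists2 a', A a' & is_adjoint a a'.

Lemma adjoint_bound H K (a : bop H K) (a' : bop K H) c : 0 <= c ->
  is_adjoint a a' -> (forall h, `|a h| <= c * `|h|) ->
  forall k, `|a' k| <= c * `|k|.
Proof.
move=> c0 aa' ac k; have [->|ak0] := eqVneq (a' k) 0.
  by rewrite normr0 mulr_ge0.
have : `|a' k| ^+ 2 <= c * `|a' k| * `|k|.
  rewrite -inner_norm -aa' -(ger0_norm (_ : 0 <= inner K (a (a' k)) k)).
    by rewrite (le_trans (norm_inner _ _))// ler_wpM2r.
  by rewrite aa' inner_norm exprn_ge0.
by rewrite expr2 mulrAC ler_pM2r ?normr_gt0.
Qed.

Lemma nclosure_selfadjoint H (A : set (bop H H)) :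
  (forall a b, A a -> A b -> A (a - b)) ->
  selfadjoint A -> selfadjoint (nclosure A).
Proof.
move=> AB As x clx.
pose ee (n : nat) : R[i] := (n.+1%:R^-1)%:C%C.
have ee0 n : 0 < ee n by rewrite ltcR invr_gt0.
have /choice[s sP] n : exists p : bop H H * bop H H,
  [/\ A p.1, A p.2, is_adjoint p.1 p.2 & forall h, `|x h - p.1 h| <= ee n * `|h|].
  have [a Aa xa] := clx _ (ee0 n); have [a' Aa' aa'] := As _ Aa.
  by exists (a, a').
have sA n : A (s n).2 by case: (sP n).
have ee_small e : 0 < e -> exists N, forall n, (N <= n)%N -> ee n <= e.
  move=> e0; have [e1 e10 ee1] : exists2 e1 : R, 0 < e1 & e1%:C%C = e.
    move: e0; case: e => er ei; rewrite ltcE /= => /andP[/eqP -> e0].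
    by exists er.
  move: e10 ee1 => /posnumP[{}e1] ee1.
  have [N _ NP] := near_infty_natSinv_lt e1.
  by exists N => n Nn; rewrite /ee -ee1 lecR ltW// NP.
have ee_mono m n : (m <= n)%N -> ee n <= ee m.
  by move=> mn; rewrite lecR lef_pV2 ?posrE// ler_nat ltnS.
have sC n m k : `|(s n).2 k - (s m).2 k| <= (ee n + ee m) * `|k|.
  have [_ _ an xn] := sP n; have [_ _ am xm] := sP m.
  have := @adjoint_bound _ _ ((s n).1 - (s m).1) ((s n).2 - (s m).2) (ee n + ee m).
  apply.
  - by rewrite addr_ge0// ltW.
  - move=> h g.
    have e1 := linearBl (inner H) g ((s n).1 h) ((s m).1 h); rewrite /= in e1.
    have e2 := linearBr (inner H) h ((s n).2 g) ((s m).2 g); rewrite /= in e2.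
    by rewrite /= e1 e2 an am.
  - move=> h; rewrite (_ : _ h = (x h - (s m).1 h) - (x h - (s n).1 h)); last first.
      by rewrite opprB [RHS]addrC addrA subrK.
    by rewrite (le_trans (ler_normB _ _))// addrC mulrDl lerD.
have small z c : 0 <= c -> (forall n, z <= ee n * c) -> z <= 0.
  move=> c0 zc; apply/ler_addgt0Pr => e e0; rewrite add0r.
  have c10 : 0 < c + 1 by rewrite ltr_wpDl.
  have [N /(_ N (leqnn N)) Ne] := ee_small _ (divr_gt0 e0 c10).
  rewrite (le_trans (zc N))// (le_trans (ler_wpM2r c0 Ne))//.
  by rewrite -mulrA ler_piMr ?(ltW e0)// ler_pdivrMl// mulr1 lerDl.
have /choice[y yP] k : exists yk : H,
    forall n, `|yk - (s n).2 k| <= 2 * ee n * `|k|.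
  pose u n := (s n).2 k.
  have uC m n : (n <= m)%N -> `|u m - u n| <= 2 * ee n * `|k|.
    move=> nm; rewrite (le_trans (sC m n k))// ler_wpM2r//.
    by rewrite mulrDl mul1r lerD2r ee_mono.
  have uc : cauchy (u @ \oo).
    apply/cauchyP => e e0.
    have c0 : 0 < `|k| + 1 by rewrite ltr_wpDl.
    have [N NP] := ee_small _ (divr_gt0 (divr_gt0 e0 c0) (ltr0n _ 2)); exists (u N).
    exists N => // n /= Nn; rewrite -ball_normE /= distrC (le_lt_trans (uC _ _ Nn))//.
    rewrite (@le_lt_trans _ _ (2 * (e / (`|k| + 1) / 2) * `|k|))//.
      by rewrite ler_wpM2r// ler_wpM2l// NP.
    rewrite [2 * _]mulrC divfK ?pnatr_eq0// mulrAC ltr_pdivrMr//.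
    by rewrite ltr_pM2l// ltrDl.
  have /cvg_ex[l /cvgrPdist_lt ul] : cvg (u @ \oo) by apply/cauchy_cvgP.
  exists l => n; apply/ler_addgt0Pr => e e0.
  have [N _ NP] := ul _ e0.
  pose m := maxn n N.
  rewrite (_ : l - _ = (l - u m) + (u m - u n)); last by rewrite addrA subrK.
  rewrite (le_trans (ler_normD _ _))// addrC lerD ?uC ?leq_maxl//.
  by rewrite ltW// NP//= leq_maxr.
have xy h k : inner H (x h) k = inner H h (y k).
  apply/eqP; rewrite -subr_eq0 -normr_le0.
  apply: (small _ (3 * (`|h| * `|k|))) => [|n]; first by rewrite !mulr_ge0.
  have [_ _ an xn] := sP n.
  rewrite (_ : _ - _ = inner H (x h - (s n).1 h) k
                       - inner H h (y k - (s n).2 k)); last first.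
    have e1 := linearBl (inner H) k (x h) ((s n).1 h); rewrite /= in e1.
    have e2 := linearBr (inner H) h (y k) ((s n).2 k); rewrite /= in e2.
    by rewrite e1 e2 an opprB addrA subrK.
  rewrite (le_trans (ler_normB _ _))//.
  rewrite (le_trans (lerD (norm_inner _ _) (norm_inner _ _)))//.
  rewrite (le_trans (lerD (ler_wpM2r (normr_ge0 _) (xn h))
                          (ler_wpM2l (normr_ge0 _) (yP k n))))//.
  by rewrite le_eqVlt; apply/orP; left; apply/eqP; ring.
have yb : y \in bounded_linear H H.
  apply/asboolP; split.
    move=> a k k'; apply: (@inner_inj _ H) => z; rewrite -xy.
    have e1 := linearPr (inner H) (x z) a k k'; rewrite /= in e1.
    have e2 := linearPr (inner H) z a (y k) (y k'); rewrite /= in e2.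
    by rewrite e1 e2 !xy.
  have [M M0 sM] := bop_bounded (s 0%N).2; exists (2 * ee 0%N + M) => [|k].
    by rewrite addr_ge0// mulr_ge0// ltW.
  rewrite mulrDl -{1}[y k](subrK ((s 0%N).2 k)) (le_trans (ler_normD _ _))//.
  by rewrite lerD.
exists (Bop yb) => // e e0.
have [N /(_ N (leqnn N)) NP] := ee_small _ (divr_gt0 e0 (ltr0n _ 2)).
exists (s N).2 => // k; rewrite (le_trans (yP k N))// ler_wpM2r//.
by rewrite mulrC -ler_pdivlMr.
Qed.

End OperatorAlgebra.

(* A complex vector space with a distinguished element and a family of
   matricial "positive" sets; no axioms are imposed at this level. *)
Record matord (R : realType) := MatOrd {
  mcarrier :> lmodType R[i];
  munit : mcarrier;
  mpos : forall n, set 'M[mcarrier]_n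
}.
Arguments munit {R} m.
Arguments mpos {R} m n _.

Section MatrixOrders.
Variable R : realType.
Implicit Types V W : matord R.

(* B(H), where M_n(B(H)) acts on the direct sum of n copies of H *)
Definition BH (H : hilbert R) : matord R := MatOrd (bop_id H)
  (fun n => [set u : 'M[bop H H]_n | forall h : 'I_n -> H,
     0 <= \sum_i \sum_j inner H (u i j (h j)) (h i)]).

(* The matrix algebra M_k, where M_n(M_k) acts on n copies of C^k *)
Definition Mk (k : nat) : matord R := MatOrd (1%:M : 'M[R[i]]_k)
  (fun n => [set u : 'M['M[R[i]]_k]_n | forall v : 'I_n -> 'cV[R[i]]_k,
     0 <= \sum_i \sum_j (map_mx Num.conj (v i)^T *m u i j *m v j) 0 0]).

Definition cp V W (f : {linear V -> W}) : Prop :=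
  forall n (u : 'M[V]_n), mpos V n u -> mpos W n (map_mx f u).

Definition unital V W (f : {linear V -> W}) : Prop := f (munit V) = munit W.

Definition ucp V W (f : {linear V -> W}) : Prop := unital f /\ cp f.

Definition complete_order_embedding V W (f : {linear V -> W}) : Prop :=
  injective f /\
  forall n (u : 'M[V]_n), mpos V n u <-> mpos W n (map_mx f u).

Definition complete_order_iso V W (f : {linear V -> W}) : Prop :=
  complete_order_embedding f /\ forall w, exists v, f v = w.

(* [V] is, up to a unital complete order isomorphism, a selfadjoint subspace
   of some B(H) containing the identity, with the inherited matrix order.  The
   involution of [V] is not recorded: it is transported from B(H), and it is
   determined by the matrix order since the selfadjoint elements are the
   differences of positive ones. *)
Definition represents V (H : hilbert R) (f : {linear V -> BH H}) : Prop :=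
  [/\ unital f, complete_order_embedding f & selfadjoint (range f)].

Definition is_opsys V : Prop :=
  exists (H : hilbert R) (f : {linear V -> BH H}), represents f.

Record opsys := OpSys { os_matord :> matord R; opsysP : is_opsys os_matord }.

End MatrixOrders.

Section ClosedRange.
Variables (R : realType) (V : lmodType R[i]) (H : hilbert R).
Variable f : {linear V -> bop H H}.

Definition closed_range : {pred bop H H} :=
  fun x => `[< nclosure (range f) x >].

Lemma closed_range_submod : submod_closed closed_range.
Proof.
split=> [|a x y /asboolP cx /asboolP cy]; apply/asboolP.
  move=> e e0; exists 0; first by exists 0; rewrite ?linear0.
  by move=> h; rewrite subrr normr0 mulr_ge0// ltW.
move=> e e0.
have e20 : 0 < e / 2 by rewrite divr_gt0.
have a0 : 0 < `|a| + 1 by rewrite ltr_wpDl.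
have [_ [v _ <-] xv] := cx _ (divr_gt0 e20 a0).
have [_ [w _ <-] yw] := cy _ e20.
exists (f (a *: v + w)); first by exists (a *: v + w).
move=> h; rewrite linearP.
rewrite (_ : _ - _ = a *: (x h - f v h) + (y h - f w h)); last first.
  by rewrite scalerBr addrACA -opprD.
rewrite (le_trans (ler_normD _ _))// [e in _ <= e * _]splitr mulrDl lerD//.
rewrite normrZ (le_trans (ler_wpM2l (normr_ge0 _) (xv h)))// mulrA.
by rewrite ler_wpM2r// mulrCA ler_piMr ?(ltW e20)// ler_pdivrMr// mul1r lerDl.
Qed.

HB.instance Definition _ := GRing.isSubmodClosed.Build R[i] (bop H H)
  closed_range closed_range_submod.

Record clos := Clos { clos_val : bop H H; _ : clos_val \in closed_range }.

HB.instance Definition _ := [isSub for clos_val].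
HB.instance Definition _ := [Choice of clos by <:].
HB.instance Definition _ := [SubChoice_isSubLmodule of clos by <:].

Lemma clos_in_subproof v : f v \in closed_range.
Proof.
apply/asboolP => e e0; exists (f v); first by exists v.
by move=> h; rewrite subrr normr0 mulr_ge0// ltW.
Qed.

Lemma clos_val_is_linear : linear clos_val.
Proof. by []. Qed.

HB.instance Definition _ := GRing.isLinear.Build R[i] clos (bop H H) *:%R
  clos_val clos_val_is_linear.

Definition clos_in (v : V) : clos := Clos (clos_in_subproof v).

Lemma clos_in_is_linear : linear clos_in.
Proof. by move=> a u v; apply/val_inj; rewrite /= linearP. Qed.

HB.instance Definition _ :=
  GRing.isLinear.Build R[i] V clos *:%R clos_in clos_in_is_linear.

End ClosedRange.

Section Completion.
Variables (R : realType) (S : opsys R).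

Definition rep_space : hilbert R := projT1 (cid (opsysP S)).
Definition rep : {linear S -> BH rep_space} :=
  projT1 (cid (projT2 (cid (opsysP S)))).

Lemma repP : represents rep.
Proof. exact: (projT2 (cid (projT2 (cid (opsysP S))))). Qed.

(* The completion is the norm closure in B(H) of a concrete realization of [S].
   Unital complete order embeddings of operator systems are isometric, so the
   choice of realization does not matter. *)
Definition compl_matord : matord R :=
  MatOrd (clos_in rep (munit S))
    (fun n => [set u : 'M[clos rep]_n |
                mpos (BH rep_space) n (map_mx (@clos_val _ _ _ rep) u)]).

Lemma compl_is_opsys : is_opsys compl_matord.
Proof.
have [r1 _ rsa] := repP.
exists rep_space, (@clos_val _ _ _ rep : {linear compl_matord -> BH _}).
split; [exact: r1|by split=> //; exact: val_inj|].
have rB a b : range rep a -> range rep b -> range rep (a - b).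
  by move=> [v _ <-] [w _ <-]; exists (v - w); rewrite ?linearB.
move=> _ [x _ <-]; have /asboolP xcl := valP x.
have [y ycl xy] := nclosure_selfadjoint rB rsa xcl.
have yP : y \in closed_range rep by apply/asboolP.
by exists y => //; exists (Clos yP).
Qed.

Definition compl : opsys R := OpSys compl_is_opsys.

Definition compl_in : {linear S -> compl} := clos_in rep.

End Completion.

Section DeltaEquivalence.
Variable R : realType.

Definition is_TRO (H K : hilbert R) (M : set (bop H K)) : Prop :=
  [/\ M 0, (forall (a : R[i]) x y, M x -> M y -> M (a *: x + y))
    & mulset (mulset M (adjset M)) M `<=` M].

Definition nondegenerate (H K : hilbert R) (M : set (bop H K)) : Prop :=
  cspan (mulset (adjset M) M) (bop_id H) /\
  cspan (mulset M (adjset M)) (bop_id K).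

Definition TRO_equiv (H K : hilbert R) (A : set (bop H H)) (B : set (bop K K)) :
    Prop :=
  exists M : set (bop H K),
    [/\ is_TRO M, nondegenerate M,
        mulset (mulset (adjset M) B) M `<=` nclosure A
      & mulset (mulset M A) (adjset M) `<=` nclosure B].

Definition Delta_equiv (S T : opsys R) : Prop :=
  exists (H K : hilbert R) (f : {linear S -> BH H}) (g : {linear T -> BH K}),
    [/\ unital f /\ complete_order_embedding f,
        unital g /\ complete_order_embedding g
      & TRO_equiv (range f) (range g)].

End DeltaEquivalence.

Section Kronecker.
Variables (R : realType) (S T : matord R) (n m : nat).
Variables (f : {linear S -> Mk R n}) (g : {linear T -> Mk R m}).

(* M_n ⊗ M_m is identified with M_nm through the Kronecker product *)
Definition kron (x : S) (y : T) : Mk R (n * m) :=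
  tensmx (f x : 'M[R[i]]_n) (g y : 'M[R[i]]_m).

Lemma kron_is_bilinear : bilinear_for
  (GRing.Scale.Law.clone R[i] (Mk R (n * m)) *:%R _)
  (GRing.Scale.Law.clone R[i] (Mk R (n * m)) *:%R _) kron.
Proof.
split=> [y|x] a u v; apply/matrixP => i j; rewrite /kron linearP !mxE.
- by rewrite mulrDl mulrA.
- by rewrite mulrDr mulrCA.
Qed.

HB.instance Definition _ := bilinear_isBilinear.Build R[i] S T (Mk R (n * m))
  _ _ kron kron_is_bilinear.

End Kronecker.

Section ProductMap.
Variables (R : realType) (S T : matord R) (H : hilbert R).
Variables (f : {linear S -> BH H}) (g : {linear T -> BH H}).

Definition opprod (x : S) (y : T) : BH H :=
  bop_comp (f x : bop H H) (g y : bop H H).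

Lemma opprod_is_bilinear : bilinear_for
  (GRing.Scale.Law.clone R[i] (BH H) *:%R _)
  (GRing.Scale.Law.clone R[i] (BH H) *:%R _) opprod.
Proof.
split=> [y|x] a u v; apply: bopP => h; rewrite /opprod linearP //=.
by rewrite linearP.
Qed.

HB.instance Definition _ := bilinear_isBilinear.Build R[i] S T (BH H)
  _ _ opprod opprod_is_bilinear.

End ProductMap.

Section TensorProducts.
Variable R : realType.
Implicit Types S T W : opsys R.

Definition tensor_matord S T (p : forall n, set 'M[S ⊙ T]_n) : matord R :=
  MatOrd (munit S ⊗ munit T) p.

Record os_tensor_product := OSTensorProduct {
  tpos : forall S T n, set 'M[S ⊙ T]_n;
  tpos_opsys : forall S T, is_opsys (tensor_matord (@tpos S T));
  tpos_pure : forall S T n m (P : 'M[S]_n) (Q : 'M[T]_m),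
    mpos S n P -> mpos T m Q ->
    tpos (bilin_mx (@tpure _ S T) P Q);
  tpos_kron : forall S T n m
      (f : {linear S -> Mk R n}) (g : {linear T -> Mk R m}),
    ucp f -> ucp g ->
    @ucp _ (tensor_matord (@tpos S T)) (Mk R (n * m)) (tlift (kron f g))
}.

Definition alg_tensor (t : os_tensor_product) S T : opsys R :=
  OpSys (tpos_opsys t S T).

Definition compl_tensor (t : os_tensor_product) S T : opsys R :=
  compl (alg_tensor t S T).

Definition compl_pure (t : os_tensor_product) S T (x : S) (y : T) :
    compl_tensor t S T :=
  compl_in (alg_tensor t S T) (x ⊗ y).

Definition lifts (P : forall V W : matord R, {linear V -> W} -> Prop)
    S T (f : {linear S -> T}) : Prop :=
  exists F : {linear compl S -> compl T},
    (forall x, F (compl_in S x) = compl_in T (f x)) /\ P (compl S) (compl T) F.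

Definition alg_tensor_map (t t' : os_tensor_product) S1 T1 S2 T2
    (f : {linear S1 -> S2}) (g : {linear T1 -> T2}) :
    {linear alg_tensor t S1 T1 -> alg_tensor t' S2 T2} := tmap f g.

Definition alg_tensor_id (t t' : os_tensor_product) S T :
    {linear alg_tensor t S T -> alg_tensor t' S T} :=
  (idfun : {linear S ⊙ T -> S ⊙ T}).

Definition functorial (t : os_tensor_product) : Prop :=
  forall S1 T1 S2 T2 (f : {linear S1 -> T1}) (g : {linear S2 -> T2}),
    ucp f -> ucp g -> lifts (@ucp R) (alg_tensor_map t t f g).

Definition associative_tensor (t : os_tensor_product) : Prop :=
  forall S1 S2 S3, exists F :
      {linear compl_tensor t (compl_tensor t S1 S2) S3 ->
              compl_tensor t S1 (compl_tensor t S2 S3)},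
    [/\ unital F, complete_order_iso F
      & forall x y z, F (compl_pure t (compl_pure t x y) z) =
                      compl_pure t x (compl_pure t y z)].

Definition tensor_le (t' t : os_tensor_product) : Prop :=
  forall S T, lifts (@cp R) (alg_tensor_id t t' S T).

Definition nuclear (t' t : os_tensor_product) S : Prop :=
  forall T, lifts (@complete_order_iso R) (alg_tensor_id t t' S T).

Definition jointly_cp S T W (b : {bilinear S -> T -> W}) : Prop :=
  forall n m (P : 'M[S]_n) (Q : 'M[T]_m),
    mpos S n P -> mpos T m Q -> mpos W (n * m) (bilin_mx b P Q).

(* [t] is the maximal tensor product, which this property determines since the
   map (x, y) |-> x ⊗ y is itself jointly completely positive. *)
Definition is_max (t : os_tensor_product) : Prop :=
  forall S T W (b : {bilinear S -> T -> W}),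
    jointly_cp b -> @cp _ (alg_tensor t S T) W (tlift b).

Definition is_commuting (t : os_tensor_product) : Prop :=
  forall S T n (u : 'M[S ⊙ T]_n),
    mpos (alg_tensor t S T) n u <->
    forall (H : hilbert R) (f : {linear S -> BH H}) (g : {linear T -> BH H}),
      ucp f -> ucp g ->
      (forall x y, bop_comp (f x) (g y) = bop_comp (g y) (f x)) ->
      mpos (BH H) n (map_mx (tlift (opprod f g)) u).

Definition injective_opsys W : Prop :=
  forall S T (j : {linear S -> T}) (f : {linear S -> W}),
    unital j -> complete_order_embedding j -> cp f ->
    exists F : {linear T -> W}, cp F /\ forall x, F (j x) = f x.

Definition injective_envelope S (I : opsys R) (k : {linear S -> I}) : Prop :=
  [/\ injective_opsys I, unital k, complete_order_embedding k
    & forall W (l : {linear W -> I}), unital l -> complete_order_embedding l ->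
        injective_opsys W -> range k `<=` range l -> range l = setT].

Definition is_el (t : os_tensor_product) : Prop :=
  exists2 m : os_tensor_product, is_max m &
    forall S, exists (I : opsys R) (k : {linear S -> I}),
      injective_envelope k /\
      forall T, lifts (@complete_order_embedding R)
        (alg_tensor_map t m k (idfun : {linear T -> T})).

Definition is_er (t : os_tensor_product) : Prop :=
  exists2 m : os_tensor_product, is_max m &
    forall T, exists (I : opsys R) (k : {linear T -> I}),
      injective_envelope k /\
      forall S, lifts (@complete_order_embedding R)
        (alg_tensor_map t m (idfun : {linear S -> S}) k).

End TensorProducts.

(* Main.v *)
(** By functoriality and positivity of pure tensors, (tau', tau)-nuclearity of S
    says that tau'-positive matrices over S ⊙ R are tau-positive for every R.

    Let the non-degenerate TRO M link the norm closures A and B of the images of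
    S and T.  For every eta > 0 there are m_1, ..., m_k in M with
    (1 - eta) |h|^2 <= sum_p |m_p h|^2 <= |h|^2: non-degeneracy gives this for
    some eta < 1, and composing the m_p with 1 + e/2, e = 1 - sum_p m_p^* m_p,
    stays inside M and replaces eta by eta^2.  Hence the completely positive
    column x |-> (m_p x m_q^* )_{p,q} into M_k(B) and row
    (y_{p,q}) |-> sum_{p,q} m_p^* y_{p,q} m_q into A compose to a map that is
    close to the identity of A.  Both become unital after adding a state times
    the respective defect.  If the column can be amplified by R for tau' and the
    row for tau, then, up to a small multiple of the unit, a tau'-positive
    matrix over A ⊙ R factors through tau'-positive, hence tau-positive, matrices
    over M_k(B) ⊙ R.

    Amplification, and positivity being detected on A instead of S, follow
    - for an associative tensor product from M_k(B ⊗ R) = M_k ⊗ B ⊗ R;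
    - for el and er from their definition through max, where the amplified maps
      linearise jointly completely positive ones, and from injectivity;
    - for c by testing against commuting pairs of maps, where a non-unital F is
      replaced by F(1)^{-1/2} F F(1)^{-1/2}, approximated as above. *)

From HB Require Import structures.
Require Import Defs.
From mathcomp Require Import reals.
From mathcomp Require Import all_boot all_order all_algebra.
From mathcomp Require Import all_classical interval_inference topology normedtype sequences.
From mathcomp Require Import complex mxtens ring lra.
Import Order.TTheory GRing.Theory Num.Theory numFieldNormedType.Exports.

Set Implicit Arguments.
Unset Strict Implicit.
Unset Printing Implicit Defensive.

Local Open Scope ring_scope.
Local Open Scope classical_set_scope.

(** * Operators on Hilbert spaces *)

(** Functoriality speaks of unital completely positive maps only; this is why the column and the row
    are corrected by states. The defect of the column is not small by itself, but the row sends it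
    to e(1 - e), so on a positive element of norm at most X both corrections cost a multiple of eta
    X.

    No norm on a tensor product is ever estimated. A positive matrix over S ⊙ R is Hermitian, hence
    a real combination of rank-one scalar matrices times a ⊗ b with a and b positive ([comb]). A
    norm error e in a is an order error: a - a' + e 1 is positive, and so is its tensor with b, for
    every tensor product. The Archimedean property ([fpos_arch]) then lets e tend to 0. Therefore
    [approx_factor] controls the error on positive elements only.

    M is not assumed closed, so dividing by the square root of the sum of the m_p^* m_p could leave
    it; a polynomial does not. The same polynomial serves for F(1) in the commuting case, and no
    functional calculus of operators is developed.

    The TRO links norm closures of chosen realisations, so nuclearity has to travel between an
    operator system, its completion and these closures. *)

Section InnerProduct.
Variables (R : realType) (H : hilbert R).
Implicit Types (x y z : H) (a : R[i]).
Local Notation "'<<' x , y '>>'" := (inner H x y).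

Lemma ipDl x y z : <<x + y, z>> = <<x, z>> + <<y, z>>.
Proof. exact: (linearDl (inner H) z x y). Qed.
Lemma ipDr x y z : <<x, y + z>> = <<x, y>> + <<x, z>>.
Proof. exact: (linearDr (inner H) x y z). Qed.
Lemma ipZl a x y : <<a *: x, y>> = a * <<x, y>>.
Proof. exact: (linearZl_LR (inner H) y a x). Qed.
Lemma ipZr a x y : <<x, a *: y>> = Num.conj a * <<x, y>>.
Proof. exact: (linearZr_LR (inner H) x a y). Qed.
Lemma ip0l x : <<0, x>> = 0. Proof. exact: linear0l. Qed.
Lemma ip0r x : <<x, 0>> = 0. Proof. exact: linear0r. Qed.
Lemma ipNl x y : <<- x, y>> = - <<x, y>>.
Proof. by rewrite -scaleN1r ipZl mulN1r. Qed.
Lemma ipNr x y : <<x, - y>> = - <<x, y>>.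
Proof. by rewrite -scaleN1r ipZr rmorphN1 mulN1r. Qed.
Lemma ipBl x y z : <<x - y, z>> = <<x, z>> - <<y, z>>.
Proof. by rewrite ipDl ipNl. Qed.
Lemma ipBr x y z : <<x, y - z>> = <<x, y>> - <<x, z>>.
Proof. by rewrite ipDr ipNr. Qed.
Lemma ipC x y : <<y, x>> = Num.conj <<x, y>>.
Proof. by rewrite (hermC (inner H) y x) expr0 mul1r. Qed.
Lemma ip_suml I (r : seq I) (P : pred I) (F : I -> H) y :
  <<\sum_(i <- r | P i) F i, y>> = \sum_(i <- r | P i) <<F i, y>>.
Proof. by elim/big_rec2: _ => [|i a b _ <-]; rewrite ?ip0l ?ipDl. Qed.
Lemma ip_sumr I (r : seq I) (P : pred I) (F : I -> H) y :
  <<y, \sum_(i <- r | P i) F i>> = \sum_(i <- r | P i) <<y, F i>>.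
Proof. by elim/big_rec2: _ => [|i a b _ <-]; rewrite ?ip0r ?ipDr. Qed.
Lemma ip_ge0 x : 0 <= <<x, x>>.
Proof. by rewrite inner_norm exprn_ge0. Qed.

End InnerProduct.
Notation ipE := (ipDl, ipDr, ipBl, ipBr, ipNl, ipNr, ipZl, ipZr, ip0l, ip0r)
  (only parsing).

Section RealNorm.
Variable R : realType.

(** The norm takes values in [R[i]]; this real copy brings estimates into the ordered field [R],
    where [lra] and [nra] apply. *)
Definition nr (V : normedModType R[i]) (x : V) : R := complex.Re `|x|.

Lemma ge0_real (z : R[i]) : 0 <= z -> z = (complex.Re z)%:C%C.
Proof. by case: z => a b; rewrite lecE /= => /andP[/eqP -> _]. Qed.

Lemma nrE (V : normedModType R[i]) (x : V) : `|x| = (nr x)%:C%C.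
Proof. by apply: ge0_real. Qed.

Lemma nr_ge0 (V : normedModType R[i]) (x : V) : 0 <= nr x.
Proof. by have := normr_ge0 x; rewrite nrE lecR. Qed.

Lemma Re_ip (H : hilbert R) (x : H) : complex.Re (inner H x x) = nr x ^+ 2.
Proof. by rewrite inner_norm nrE -rmorphXn. Qed.

Lemma nr_ler (V : normedModType R[i]) (x : V) (c : R) : (`|x| <= c%:C%C) = (nr x <= c).
Proof. by rewrite nrE lecR. Qed.

Lemma nrD (V : normedModType R[i]) (x y : V) : nr (x + y) <= nr x + nr y.
Proof. by rewrite -lecR rmorphD /= -!nrE ler_normD. Qed.

(** The limit inherits the rate [d] itself; in [bop_lim] this makes a pointwise limit of operators
    uniform. *)
Lemma hilbert_lim (V : completeNormedModType R[i]) (u : nat -> V) (d : nat -> R) :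
  (forall e, 0 < e -> exists N, forall n, (N <= n)%N -> d n <= e) ->
  (forall n m, (n <= m)%N -> nr (u m - u n) <= d n) ->
  exists l, forall n, nr (l - u n) <= d n.
Proof.
move=> d0 ud; have uc : cauchy (u @ \oo).
  apply/cauchyP => e e0; have eR := ge0_real (ltW e0).
  have e1 : 0 < complex.Re e / 2 by rewrite divr_gt0// -ltcR -eR.
  have [N NP] := d0 _ e1; exists (u N); exists N => // n /= Nn.
  rewrite -ball_normE /= distrC eR nrE ltcR (le_lt_trans (ud _ _ Nn))//.
  by rewrite (le_lt_trans (NP _ (leqnn _)))// gtr_pMr ?invf_lt1 ?ltr1n// -ltcR -eR.
have /cvg_ex[l /cvgrPdist_lt ul] : cvg (u @ \oo) by apply/cauchy_cvgP.
exists l => n; rewrite -nr_ler; apply/ler_addgt0Pr => e e0.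
have [N _ NP] := ul _ e0; pose m := maxn n N.
rewrite (_ : l - _ = (l - u m) + (u m - u n)); last by rewrite addrA subrK.
rewrite (le_trans (ler_normD _ _))// addrC lerD ?nr_ler ?ud ?leq_maxl//.
by rewrite ltW// NP//= leq_maxr.
Qed.

Lemma le0_of_small (z c : R) : (forall e, 0 < e -> z <= e * c) -> z <= 0.
Proof.
move=> h; have [c0|c0] := lerP c 0.
  by rewrite (le_trans (h 1 ltr01))// mul1r.
apply/ler_addgt0Pr => e e0; rewrite add0r (le_trans (h (e / c) _)) ?divr_gt0//.
by rewrite divfK ?gt_eqF.
Qed.

Lemma invS_small (e : R) : 0 < e -> exists N, forall n, (N <= n)%N -> n.+1%:R^-1 <= e.
Proof.
move=> /posnumP[{}e]; have [N _ NP] := near_infty_natSinv_lt e.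
by exists N => n Nn; rewrite ltW// NP.
Qed.

End RealNorm.

Section OperatorLinearity.
Variables (R : realType) (H K : hilbert R) (f : bop H K).
Implicit Types (x y : H) (a : R[i]).

Lemma bopD x y : f (x + y) = f x + f y. Proof. exact: linearD. Qed.
Lemma bopB x y : f (x - y) = f x - f y. Proof. exact: linearB. Qed.
Lemma bopZ a x : f (a *: x) = a *: f x. Proof. exact: linearZ. Qed.
Lemma bop0 : f 0 = 0. Proof. exact: linear0. Qed.
Lemma bop_sum I (r : seq I) (P : pred I) (F : I -> H) :
  f (\sum_(i <- r | P i) F i) = \sum_(i <- r | P i) f (F i).
Proof. exact: linear_sum. Qed.

Lemma bop_bnd : exists2 M : R, 0 <= M & forall x, nr (f x) <= M * nr x.
Proof.
have [M M0 fM] := bop_bounded f; have MR := ge0_real M0.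
exists (complex.Re M) => [|x]; first by rewrite -lecR -MR.
by rewrite -lecR rmorphM /= -!nrE -MR.
Qed.

End OperatorLinearity.

Lemma bop_sumE (R : realType) (H K : hilbert R) I (r : seq I) (P : pred I)
    (F : I -> bop H K) x :
  (\sum_(i <- r | P i) F i) x = \sum_(i <- r | P i) F i x.
Proof. by elim/big_rec2: _ => // i a b _ <-. Qed.

Section ComplexParts.
Variable R : realType.
Implicit Types z w : R[i].

Lemma ReD z w : complex.Re (z + w) = complex.Re z + complex.Re w.
Proof. by case: z w => a b []. Qed.
Lemma ReN z : complex.Re (- z) = - complex.Re z.
Proof. by case: z. Qed.
Lemma ReB z w : complex.Re (z - w) = complex.Re z - complex.Re w.
Proof. by rewrite ReD ReN. Qed.
Lemma ReZ (s : R) z : complex.Re (s%:C%C * z) = s * complex.Re z.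
Proof. by case: z => a b /=; rewrite mul0r subr0. Qed.
Lemma Re_conj z : complex.Re (Num.conj z) = complex.Re z.
Proof. by case: z. Qed.
Lemma conjRC (s : R) : Num.conj (s%:C%C : R[i]) = s%:C%C.
Proof. exact: conjc_real. Qed.
Lemma Re_le_norm z (c : R) : `|z| <= c%:C%C -> complex.Re z <= c.
Proof.
move=> h; rewrite -lecR (le_trans _ h)// (le_trans _ (normc_ge_Re z))//.
by rewrite lecR ler_norm.
Qed.

(** Polarisation: [a = 1] kills the imaginary part of [z + w], and [a = 'i] the real part of
    [z - w]. *)
Lemma conj_of_real z w : (forall a : R[i], a * z + Num.conj a * w \is Num.real) ->
  w = Num.conj z.
Proof.
move=> h; have /CrealP h1 := h 1; have /CrealP := h 'i.
rewrite rmorph1 !mul1r rmorphD in h1.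
rewrite rmorphD !rmorphM /= conjCK conjCi !mulNr addrC -!mulrBr.
move=> /(mulfI (neq0Ci _)) h2.
have e : 2 * w = 2 * Num.conj z.
  transitivity ((z + w) - (z - w)); first by ring.
  by rewrite -h1 -h2; ring.
by apply: (mulfI _ e); rewrite pnatr_eq0.
Qed.

End ComplexParts.

Lemma le_sqrt (R : rcfType) (a c : R) : a ^+ 2 <= c -> a <= Num.sqrt c.
Proof.
by move=> h; rewrite (le_trans (ler_norm a))// -sqrtr_sqr ler_wsqrtr.
Qed.

Lemma sqrt_le (R : rcfType) (a c : R) : 0 <= c -> a <= c ^+ 2 -> Num.sqrt a <= c.
Proof.
by move=> c0 h; rewrite -[leRHS](ger0_norm c0) -sqrtr_sqr ler_wsqrtr.
Qed.

Section LaxMilgram.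
Variables (R : realType) (H : hilbert R) (Y : bop H H).
Hypothesis Ysym : is_adjoint Y Y.
Hypothesis Y1 : forall x, `|x| ^+ 2 <= inner H (Y x) x.
Variable l : H -> R[i].
Hypothesis l_lin : forall a x y, l (a *: x + y) = a * l x + l y.
Hypothesis l_bd : exists M : R, forall x, `|l x| <= M%:C%C * `|x|.

Let q x := complex.Re (inner H (Y x) x).
Let J x := q x - 2 * complex.Re (l x).

Let lD x y : l (x + y) = l x + l y.
Proof. by rewrite -{1}[x]scale1r l_lin mul1r. Qed.
Let l0 : l 0 = 0. Proof. by apply: (addrI (l 0)); rewrite -lD !addr0. Qed.
Let lZ a x : l (a *: x) = a * l x.
Proof. by rewrite -[a *: x]addr0 l_lin l0 addr0. Qed.

Let qD x y : q (x + y) = q x + q y + 2 * complex.Re (inner H (Y x) y).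
Proof.
have e : complex.Re (inner H (Y y) x) = complex.Re (inner H (Y x) y).
  by rewrite Ysym ipC Re_conj.
by rewrite /q bopD !ipE !ReD e; ring.
Qed.

Let qZ (s : R) x : q (s%:C%C *: x) = s ^+ 2 * q x.
Proof. by rewrite /q bopZ ipZl ipZr conjRC !ReZ; ring. Qed.

Let q_ge x : nr x ^+ 2 <= q x.
Proof. by move: (Y1 x); rewrite nrE -rmorphXn lecE => /andP[_]. Qed.

Let Jdiff x y : nr (x - y) ^+ 2 <= 2 * (J x + J y - 2 * J ((2^-1)%:C%C *: (x + y))).
Proof.
apply: (le_trans (q_ge _)).
have -> : x - y = x + (- 1 : R)%:C%C *: y by rewrite rmorphN1 scaleN1r.
rewrite /J qZ lZ ReZ lD ReD !qD qZ ipZr conjRC ReZ.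
by rewrite le_eqVlt; apply/orP; left; apply/eqP; field.
Qed.

Let Jbd : exists B : R, forall x, B <= J x.
Proof.
have [M Mb] := l_bd; exists (- M ^+ 2) => x.
have h1 := q_ge x; have := Mb x; rewrite nrE -rmorphM => /Re_le_norm /= h2.
have : 0 <= (nr x - M) ^+ 2 by exact: sqr_ge0.
by rewrite /J; nra.
Qed.

(** Minimises [J]: by coercivity of [Y] and the parallelogram identity [Jdiff] a minimising sequence
    is Cauchy, and the vanishing first variation at its limit is the equation. With [Y] the identity
    this is the Riesz representation, hence adjoints; with [Y] equal to [newton] it gives
    [newton_surj]. *)
Lemma lax_milgram : exists x, forall h, l h = inner H h (Y x).
Proof.
have [B BJ] := Jbd.
have hasinf : has_inf (range J).
  by split; [exists (J 0), 0|exists B => _ [x _ <-]].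
pose m := inf (range J).
have mJ x : m <= J x by apply: ge_inf; [case: hasinf|exists x].
have near_m n : exists x, J x < m + n.+1%:R^-1.
  have /inf_adherent : 0 < n.+1%:R^-1 :> R by rewrite invr_gt0.
  by move=> /(_ _ hasinf)[_ [x _ <-] xm]; exists x.
have [u uP] := choice near_m.
pose d (n : nat) : R := n.+1%:R^-1.
have d0 n : 0 < d n by rewrite invr_gt0.
have dm i j : (i <= j)%N -> d j <= d i by move=> ij; rewrite lef_pV2 ?posrE// ler_nat ltnS.
(* The midpoint has [J] at least [m], so [Jdiff] bounds the square by 2 (d i + d j), and
   [d j <= d i]. *)
have uC i j : (i <= j)%N -> nr (u j - u i) <= Num.sqrt (4 * d i).
  move=> ij; apply: le_sqrt; apply: (le_trans (Jdiff _ _)); have := uP i; have := uP j.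
  rewrite -/(d i) -/(d j); have := mJ ((2^-1)%:C%C *: (u j + u i)); have := dm _ _ ij.
  lra.
have sd e : 0 < e -> exists N, forall n, (N <= n)%N -> Num.sqrt (4 * d n) <= e.
  move=> e0; have e2 : 0 < e ^+ 2 / 4 by rewrite divr_gt0// exprn_gt0.
  have [N NP] := invS_small e2; exists N => n /NP dn.
  by apply: sqrt_le; [exact: ltW|move: dn; rewrite -/(d n); lra].
have [x xP] := hilbert_lim sd uC.
have [M M0 YM] := bop_bounded Y.
have ReE h : complex.Re (l h) = complex.Re (inner H h (Y x)).
  have MR := ge0_real M0; set M' := complex.Re M in MR.
  have M'0 : 0 <= M' by rewrite -lecR -MR.
  pose D n := complex.Re (inner H (Y (u n)) h) - complex.Re (l h).
  (* Moving [u n] by [s h] cannot bring [J] below [m], which lies less than [d n] under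
     [J (u n)]. *)
  have vari n (s : R) : 0 <= d n + 2 * s * D n + s ^+ 2 * q h.
    have := mJ (u n + s%:C%C *: h); have := uP n; rewrite -/(d n) /J qD qZ lD lZ ReD ReZ ipZr conjRC ReZ.
    by rewrite /D => h1 h2; lra.
  have Dlim n : `|D n - (complex.Re (inner H h (Y x)) - complex.Re (l h))| <= M' * Num.sqrt (4 * d n) * nr h.
    have -> : D n - (complex.Re (inner H h (Y x)) - complex.Re (l h)) =
        complex.Re (inner H h (Y (u n)) - inner H h (Y x)).
      by rewrite /D ReB [inner H h (Y (u n))]ipC Re_conj; ring.
    rewrite -lecR (_ : inner H h _ - _ = inner H h (Y (u n - x))); last by rewrite bopB ipBr.
    rewrite (le_trans (normc_ge_Re _))// (le_trans (norm_inner _ _))//.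
    rewrite [leLHS]mulrC !rmorphM /= -nrE ler_wpM2r// (le_trans (YM _))// MR ler_wpM2l ?lecR//.
    by rewrite -normrN opprB nrE lecR xP.
  apply/eqP; rewrite -subr_eq0 -sqrf_eq0 -normr_le0 ger0_norm ?sqr_ge0//.
  set z := complex.Re (l h) - _.
  have zD n : `|D n + z| <= M' * Num.sqrt (4 * d n) * nr h.
    by rewrite (le_trans _ (Dlim n))// /z opprB.
  pose K := M' * nr h.
  have K0 : 0 <= K by rewrite mulr_ge0// nr_ge0.
  have key (s : R) : 2 * s * z <= s ^+ 2 * q h.
    rewrite -subr_le0; apply: (@le0_of_small _ _ (1 + 2 * `|s| * K)) => e e0.
    have [N1 /(_ _ (leq_maxl _ _)) NP1] := invS_small e0.
    have [N2 /(_ _ (leq_maxr _ _)) NP2] := sd _ e0.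
    have {NP1} := NP1 N2; have {NP2} := NP2 N1; move: (maxn N1 N2) => n; rewrite -/(d n) => sn dn.
    have h1 := vari n s; have h2 : `|2 * s * (D n + z)| <= 2 * `|s| * (K * e).
      rewrite normrM normrM [`|2|]ger0_norm// ler_wpM2l ?mulr_ge0//.
      rewrite (le_trans (zD n))// /K -mulrA [_ * nr h]mulrC mulrA ler_wpM2l//.
    have h3 := ler_norm (2 * s * (D n + z)).
    have h4 : 2 * s * (D n + z) = 2 * s * D n + 2 * s * z by ring.
    rewrite (_ : e * _ = e + 2 * `|s| * (K * e)); last by ring.
    lra.
  have q0 : 0 <= q h by apply: le_trans (q_ge h); exact: sqr_ge0.
  have q1 : 0 < q h + 1 by rewrite ltr_wpDl.
  (* A value of [s] close to the optimal one; adding 1 to [q h] avoids a zero denominator, and the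
     inequality still forces [z = 0]. *)
  have := key (z / (q h + 1)); rewrite expr_div_n mulrA -mulrA -[leLHS]mulrA -[leRHS]mulrA.
  have -> : 2 * (z * ((q h + 1)^-1 * z)) = z ^+ 2 * (2 * (q h + 1) / (q h + 1) ^+ 2).
    by field; rewrite gt_eqF.
  have -> : z ^+ 2 * (((q h + 1) ^+ 2)^-1 * q h) = z ^+ 2 * (q h / (q h + 1) ^+ 2).
    by rewrite [_^-1 * _]mulrC.
  rewrite -subr_le0 -mulrBr -mulrBl => h1.
  have c0 : 0 < (2 * (q h + 1) - q h) / (q h + 1) ^+ 2.
    by rewrite divr_gt0 ?exprn_gt0//; lra.
  by rewrite pmulr_lle0 in h1.
exists x => h; apply/eqP; rewrite eq_complex ReE eqxx /=.
(* Up to sign, the real parts at ['i *: h] are the imaginary parts at [h]. *)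
have := ReE ('i%C *: h); rewrite lZ ipZl.
move: (l h) (inner H h (Y x)) => [a b] [c e] /=.
by rewrite !mul0r !mul1r !add0r => /oppr_inj ->.
Qed.

End LaxMilgram.

Section Adjoints.
Variable R : realType.
Implicit Types H K L : hilbert R.

Lemma adj_ex H K (a : bop H K) : exists a', is_adjoint a a'.
Proof.
have riesz k : exists x, forall h, inner K (a h) k = inner H h x.
  apply: (@lax_milgram R H (bop_id H)) => [//|x|b x y|].
  - by rewrite /= inner_norm.
  - by rewrite bopD bopZ ipDl ipZl.
  - have [M M0 aM] := bop_bnd a; exists (M * nr k) => x.
    rewrite (le_trans (norm_inner _ _))// !nrE -!rmorphM lecR mulrAC.
    by rewrite ler_wpM2r ?nr_ge0.
have [s sP] := choice riesz.
have sb : s \in bounded_linear K H.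
  apply/asboolP; split=> [b x y|].
    by apply: inner_inj => z; rewrite -sP !ipE -!sP.
  have [M M0 aM] := bop_bnd a; exists M%:C%C => [|k]; first by rewrite lecR.
  have [->|sk0] := eqVneq (s k) 0; first by rewrite normr0 mulr_ge0// lecR.
  rewrite -(ler_pM2r (x := `|s k|)) ?normr_gt0// -expr2 -inner_norm -sP.
  have := norm_inner (a (s k)) k; rewrite ger0_norm ?sP ?ip_ge0// => /le_trans; apply.
  rewrite mulrAC ler_wpM2r// !nrE -rmorphM lecR; exact: aM.
by exists (Bop sb).
Qed.

Definition adj H K (a : bop H K) : bop K H := projT1 (cid (adj_ex a)).

Lemma adjP H K (a : bop H K) h k : inner K (a h) k = inner H h (adj a k).
Proof. exact: (projT2 (cid (adj_ex a))). Qed.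

Lemma adjP' H K (a : bop H K) h k : inner H (adj a k) h = inner K k (a h).
Proof. by rewrite ipC -adjP -ipC. Qed.

Lemma adj_uniq H K (a : bop H K) a' : is_adjoint a a' -> a' = adj a.
Proof.
by move=> aa'; apply: bopP => k; apply: inner_inj => z; rewrite -aa' adjP.
Qed.

Lemma is_adjoint_sym H K (a : bop H K) a' : is_adjoint a a' -> is_adjoint a' a.
Proof. by move=> aa' h k; rewrite ipC -aa' -ipC. Qed.

Lemma Re_norm_ge0 (z : R[i]) : 0 <= complex.Re `|z|.
Proof. by have := normr_ge0 z; rewrite (ge0_real (normr_ge0 z)) lecR. Qed.

(** The operator norm itself is never formed; all estimates pass explicit upper bounds along. *)
Definition obd H K (a : bop H K) (c : R) := forall h, nr (a h) <= c * nr h.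

Lemma obdE H K (a : bop H K) c : (forall h, `|a h| <= c%:C%C * `|h|) <-> obd a c.
Proof.
by split=> h x; have := h x; rewrite !nrE -rmorphM lecR.
Qed.

Lemma nrN (V : normedModType R[i]) (x : V) : nr (- x) = nr x.
Proof. by rewrite /nr normrN. Qed.
Lemma nrB (V : normedModType R[i]) (x y : V) : nr (x - y) <= nr x + nr y.
Proof. by rewrite -(nrN y) nrD. Qed.
Lemma nrZ (V : normedModType R[i]) (a : R[i]) (x : V) :
  nr (a *: x) = complex.Re `|a| * nr x.
Proof. by rewrite /nr normrZ (ge0_real (normr_ge0 a)) ReZ. Qed.
Lemma nr0 (V : normedModType R[i]) : nr (0 : V) = 0.
Proof. by rewrite /nr normr0. Qed.
Lemma nr_eq0 (V : normedModType R[i]) (x : V) : nr x <= 0 -> x = 0.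
Proof. by move=> h; apply/eqP; rewrite -normr_le0 nr_ler. Qed.

Lemma obdD H K (a b : bop H K) c d : obd a c -> obd b d -> obd (a + b) (c + d).
Proof. by move=> ac bd h; rewrite (le_trans (nrD _ _))// mulrDl lerD ?ac ?bd. Qed.
Lemma obdN H K (a : bop H K) c : obd a c -> obd (- a) c.
Proof. by move=> ac h; rewrite nrN ac. Qed.
Lemma obdB H K (a b : bop H K) c d : obd a c -> obd b d -> obd (a - b) (c + d).
Proof. by move=> ac bd; apply: obdD => //; exact: obdN. Qed.
Lemma obdZ H K (a : bop H K) c z : obd a c -> obd (z *: a) (complex.Re `|z| * c).
Proof.
by move=> ac h; rewrite nrZ -mulrA ler_wpM2l ?Re_norm_ge0 ?ac.
Qed.
Lemma obd0 H K : obd (0 : bop H K) 0.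
Proof. by move=> h; rewrite nr0 mul0r. Qed.
Lemma obd_comp H K L (b : bop K L) (a : bop H K) c d :
  0 <= d -> obd a c -> obd b d -> obd (bop_comp b a) (d * c).
Proof.
by move=> d0 ac bd h; rewrite (le_trans (bd _))// -mulrA ler_wpM2l ?ac.
Qed.
Lemma obdW H K (a : bop H K) c d : c <= d -> obd a c -> obd a d.
Proof. by move=> cd ac h; rewrite (le_trans (ac h))// ler_wpM2r// nr_ge0. Qed.
Lemma obd_sum H K I (r : seq I) (P : pred I) (F : I -> bop H K) (c : I -> R) :
  (forall i, P i -> obd (F i) (c i)) ->
  obd (\sum_(i <- r | P i) F i) (\sum_(i <- r | P i) c i).
Proof.
move=> Fc; apply: (big_ind2 (@obd H K)); [exact: obd0| |exact: Fc].
by move=> a b c' d; exact: obdD.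
Qed.
Lemma obd_adj H K (a : bop H K) a' c : 0 <= c -> is_adjoint a a' -> obd a c -> obd a' c.
Proof.
move=> c0 aa' /obdE ac; apply/obdE; apply: adjoint_bound aa' ac.
by rewrite lecR.
Qed.
Lemma obd_id H : obd (bop_id H) 1.
Proof. by move=> h; rewrite mul1r. Qed.
Lemma obd_ip H K (a : bop H K) c h k : obd a c ->
  complex.Re `|inner K (a h) k| <= c * nr h * nr k.
Proof.
move=> ac; rewrite -lecR -ge0_real// (le_trans (norm_inner _ _))//.
by rewrite !nrE -rmorphM lecR ler_wpM2r// nr_ge0.
Qed.
Lemma obd0P H K (a : bop H K) : (forall e, 0 < e -> obd a e) -> a = 0.
Proof.
move=> h; apply: bopP => x; apply: nr_eq0; apply: (@le0_of_small _ _ (nr x)) => e e0.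
exact: h.
Qed.

Lemma nclosureE H K (A : set (bop H K)) x :
  nclosure A x <-> forall e : R, 0 < e -> exists2 a, A a & obd (x - a) e.
Proof.
split=> h e e0.
  have [|a Aa xa] := h (e%:C%C); first by rewrite ltcR.
  by exists a => //; exact: (proj1 (obdE (x - a) e)).
have eR := ge0_real (ltW e0); have e1 : 0 < complex.Re e by rewrite -ltcR -eR.
by have [a Aa xa] := h _ e1; exists a => // k; rewrite eR; exact: (proj2 (obdE (x - a) _) xa).
Qed.

End Adjoints.

Section MatrixForm.
Variables (R : realType) (H : hilbert R).

Definition mform (I : finType) (u : I -> I -> bop H H) (h k : I -> H) : R[i] :=
  \sum_i \sum_j inner H (u i j (h j)) (k i).

Lemma mformPl (I : finType) (u : I -> I -> bop H H) a (h k l : I -> H) :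
  mform u (fun i => a *: h i + k i) l = a * mform u h l + mform u k l.
Proof.
rewrite /mform mulr_sumr -big_split; apply: eq_bigr => i _.
rewrite mulr_sumr -big_split; apply: eq_bigr => j _.
by rewrite bopD bopZ ipDl ipZl.
Qed.

Lemma mformPr (I : finType) (u : I -> I -> bop H H) a (h k l : I -> H) :
  mform u h (fun i => a *: k i + l i) = Num.conj a * mform u h k + mform u h l.
Proof.
rewrite /mform mulr_sumr -big_split; apply: eq_bigr => i _.
rewrite mulr_sumr -big_split; apply: eq_bigr => j _.
by rewrite ipDr ipZr.
Qed.

Lemma mform_delta (I : finType) (u : I -> I -> bop H H) i j h k :
  mform u (fun l => if l == j then h else 0) (fun l => if l == i then k else 0)
  = inner H (u i j h) k.
Proof.
rewrite /mform (bigD1 i)//= [X in _ + X]big1 ?addr0; last first.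
  by move=> l /negPf li; rewrite big1// => m _; rewrite li ip0r.
rewrite (bigD1 j)//= big1 ?addr0 ?eqxx// => l /negPf lj.
by rewrite lj bop0 ip0l.
Qed.

(** Positivity in [R[i]] includes being real. Expanding the form at [a y + x] and subtracting the
    real diagonal terms leaves the hypothesis of [conj_of_real]. *)
Lemma mform_herm (I : finType) (u : I -> I -> bop H H) :
  (forall h, 0 <= mform u h h) -> forall i j, is_adjoint (u i j) (u j i).
Proof.
move=> up i j h k; rewrite [RHS]ipC.
rewrite -(mform_delta u i j h k) -(mform_delta u j i k h).
set x := fun l => if l == j then h else 0; set y := fun l => if l == i then k else 0.
apply: conj_of_real => a.
have := ger0_real (up (fun i => a *: y i + x i)).
rewrite mformPl !mformPr => r.
have -> : a * mform u y x + Num.conj a * mform u x y =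
    (a * (Num.conj a * mform u y y + mform u y x)
     + (Num.conj a * mform u x y + mform u x x))
    - (a * Num.conj a) * mform u y y - mform u x x by ring.
have aa : a * Num.conj a \is Num.real by apply: ger0_real; exact: mul_conjC_ge0.
by apply: realB; [apply: realB => //; apply: realM => //|]; exact: ger0_real (up _).
Qed.

Lemma pos_sym (b : bop H H) : (forall h, 0 <= inner H (b h) h) -> is_adjoint b b.
Proof.
move=> b0; have : forall i j : 'I_1, is_adjoint b b; last by move/(_ ord0 ord0).
apply: (@mform_herm _ (fun _ _ => b)) => h.
by rewrite /mform !big_ord1 b0.
Qed.

Lemma sym_real (b : bop H H) h : is_adjoint b b ->
  inner H (b h) h = (complex.Re (inner H (b h) h))%:C%C.
Proof.
move=> bs; have : inner H (b h) h \is Num.real.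
  by apply/CrealP; rewrite -ipC bs.
by move/RRe_real => e; rewrite -{1}e.
Qed.

(** The Hermitian symmetry has to pass to the limit first: it makes the limit form real, and only
    then does an estimate of real parts decide its sign. *)
Lemma mform_lim (I : finType) (u : I -> I -> bop H H) :
  (forall e : R, 0 < e -> exists2 v, (forall h, 0 <= mform v h h)
     & forall i j, obd (u i j - v i j) e) ->
  forall h, 0 <= mform u h h.
Proof.
move=> uv h.
have us i j : is_adjoint (u i j) (u j i).
  move=> x y; apply/eqP; rewrite -subr_eq0; apply/eqP.
  set z := _ - _; suff : complex.Re `|z| <= 0.
    by rewrite -lecR -ge0_real// normr_le0 => /eqP.
  apply: (@le0_of_small _ _ (2 * (nr x * nr y))) => e e0.
  have [v vp uve] := uv _ e0; have vs := mform_herm vp i j x y.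
  have -> : z = inner H ((u i j - v i j) x) y - inner H x ((u j i - v j i) y).
    by rewrite /= ipBl ipBr vs opprB addrA subrK.
  rewrite -lecR -ge0_real// (le_trans (ler_normB _ _))//.
  rewrite [X in _ + `|X|]ipC norm_conjC.
  rewrite (ge0_real (normr_ge0 (inner H ((u i j - v i j) x) y))).
  rewrite (ge0_real (normr_ge0 (inner H ((u j i - v j i) y) x))) -rmorphD lecR.
  rewrite (le_trans (lerD (obd_ip _ _ (uve i j)) (obd_ip _ _ (uve j i))))//.
  by rewrite le_eqVlt; apply/orP; left; apply/eqP; ring.
have ur : mform u h h \is Num.real.
  apply/CrealP; rewrite /mform rmorph_sum exchange_big; apply: eq_bigr => i _.
  by rewrite rmorph_sum; apply: eq_bigr => j _; rewrite /= -ipC us.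
rewrite -(RRe_real ur) lecR -oppr_le0.
apply: (@le0_of_small _ _ (\sum_i \sum_j nr (h j) * nr (h i))) => e e0.
have [v vp uve] := uv _ e0.
have /Re_le_norm : `|mform v h h - mform u h h| <= (e * \sum_i \sum_j nr (h j) * nr (h i))%:C%C.
  rewrite -sumrB (le_trans (ler_norm_sum _ _ _))// mulr_sumr rmorph_sum.
  apply: ler_sum => i _; rewrite -sumrB (le_trans (ler_norm_sum _ _ _))//.
  rewrite mulr_sumr rmorph_sum; apply: ler_sum => j _.
  rewrite (ge0_real (normr_ge0 _)) lecR -normrN opprB -ipBl mulrA.
  exact: (@obd_ip _ _ _ (u i j - v i j)).
rewrite ReB => h1; apply: le_trans h1; rewrite lerDr.
by have := vp h; rewrite lecE => /andP[].
Qed.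

End MatrixForm.

Section Newton.
Variables (R : realType) (H : hilbert R) (e : bop H H) (r : R).
Hypothesis e_sym : is_adjoint e e.
Hypothesis e_bd : forall h, 0 <= complex.Re (inner H (e h) h) <= r * nr h ^+ 2.
Hypothesis r01 : 0 < r <= 1.

(** The first-order Taylor polynomial of the inverse square root of [1 - e]. *)
Definition newton : bop H H := bop_id H + (2^-1)%:C%C *: e.

Lemma newtonE h : newton h = h + (2^-1)%:C%C *: e h. Proof. by []. Qed.

Lemma newton_sym : is_adjoint newton newton.
Proof. by move=> h k; rewrite !newtonE !ipE e_sym conjRC. Qed.

Lemma newton_ge h : nr h <= nr (newton h).
Proof.
rewrite -(ler_pXn2r (n := 2)) ?nnegrE ?nr_ge0//.
have -> : nr (newton h) ^+ 2 =
    nr h ^+ 2 + complex.Re (inner H (e h) h) + 4^-1 * nr (e h) ^+ 2.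
  rewrite -!Re_ip newtonE !ipE conjRC !ReD !ReZ.
  by rewrite -[inner H h (e h)]e_sym; field.
have /andP[h1 _] := e_bd h; have := sqr_ge0 (nr (e h)); lra.
Qed.

(** As [e] is positive, [newton] dominates the identity, which is the coercivity that [lax_milgram]
    asks for. *)
Lemma newton_surj h : exists k, newton k = h.
Proof.
have [x xP] : exists x, forall k, inner H k h = inner H k (newton x).
  apply: (@lax_milgram R H newton) => [|x|a x y|]; first exact: newton_sym.
  - rewrite (sym_real _ newton_sym) nrE -rmorphXn lecR newtonE !ipE ReD ReZ Re_ip.
    by have /andP[] := e_bd x; lra.
  - by rewrite ipDl ipZl.
  - by exists (nr h) => x; rewrite (le_trans (norm_inner _ _))// mulrC nrE.
by exists x; apply: inner_inj => z; rewrite -xP.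
Qed.

(** The operator inequality [e ^ 2 <= r e], obtained by expanding the positivity of [e] at
    [r h - e h] and using the upper bound of [e] at [e h]. *)
Lemma pos_contr_le h : nr (e h) ^+ 2 <= r * complex.Re (inner H (e h) h).
Proof.
have /andP[r0 _] := r01.
have /andP[_ h1] := e_bd (e h).
have /andP[h2 _] := e_bd (r%:C%C *: h - e h).
have E : complex.Re (inner H (e (r%:C%C *: h - e h)) (r%:C%C *: h - e h)) =
    r ^+ 2 * complex.Re (inner H (e h) h) - 2 * r * nr (e h) ^+ 2
    + complex.Re (inner H (e (e h)) (e h)).
  rewrite bopB bopZ !ipE conjRC !(ReB, ReZ) -Re_ip.
  by rewrite [inner H (e (e h)) h]e_sym; ring.
by rewrite -subr_ge0 -(pmulr_rge0 _ r0); lra.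
Qed.

(** The operator in the middle is 1 - (3/4) e^2 - (1/4) e^3. Both powers of [e] are at most [r ^ 2],
    and the coefficients 3/4 and 1/4 add up to 1. *)
Lemma newton_bounds h :
  (1 - r ^+ 2) * nr h ^+ 2 <=
  complex.Re (inner H (newton h - e (newton h)) (newton h)) <= nr h ^+ 2.
Proof.
have h1 := pos_contr_le h; have /andP[h2 h3] := e_bd h; have /andP[h4 h5] := e_bd (e h).
have -> : complex.Re (inner H (newton h - e (newton h)) (newton h)) =
  nr h ^+ 2 - 3 / 4 * nr (e h) ^+ 2 - 4^-1 * complex.Re (inner H (e (e h)) (e h)).
  rewrite newtonE bopD bopZ !ipE conjRC !(ReD, ReN, ReZ) -!Re_ip.
  rewrite [inner H (e (e h)) h]e_sym -[inner H h (e h)]e_sym.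
  by field.
have /andP[r0 r1] := r01; have := sqr_ge0 (nr (e h)); have := sqr_ge0 (nr h).
move=> p1 p2.
have h6 : r * complex.Re (inner H (e h) h) <= r ^+ 2 * nr h ^+ 2.
  by rewrite expr2 -mulrA ler_pM2l.
have h7 : r * nr (e h) ^+ 2 <= nr (e h) ^+ 2 by rewrite ler_piMl.
by apply/andP; split; lra.
Qed.

End Newton.

(** * Matrix positivity in operator systems *)

Section MatrixPositivity.
Variable R : realType.

(* Positivity of matrices indexed by an arbitrary finite type; [mpos] only
   provides ordinals. *)
Definition fpos (V : matord R) (I : finType) (u : I -> I -> V) : Prop :=
  mpos V #|I| (\matrix_(i, j) u (enum_val i) (enum_val j)).

Definition pos (V : matord R) (x : V) : Prop := fpos (fun _ _ : unit => x).

Lemma sum_enum_val (V : nmodType) (I : finType) (F : I -> V) :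
  \sum_i F i = \sum_(i < #|I|) F (enum_val i).
Proof. by rewrite -big_enum_val. Qed.

Lemma sum_unit (V : nmodType) (F : unit -> V) : \sum_i F i = F tt.
Proof. by rewrite (big_pred1 tt)// => -[]. Qed.

Lemma fposBH (H : hilbert R) (I : finType) (u : I -> I -> bop H H) :
  @fpos (BH H) I u <-> forall h, 0 <= mform u h h.
Proof.
have E h : \sum_i \sum_j inner H ((\matrix_(i, j) u (enum_val i) (enum_val j) : 'M_(#|I|)) i j (h j)) (h i)
    = mform u (h \o enum_rank) (h \o enum_rank).
  rewrite /mform [RHS]sum_enum_val; apply: eq_bigr => i _.
  by rewrite [RHS]sum_enum_val; apply: eq_bigr => j _; rewrite mxE /= !enum_valK.
split=> up h; last by rewrite E.
have := up (h \o enum_val); rewrite E /=.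
by congr (_ <= _); rewrite /mform; apply: eq_bigr => i _; apply: eq_bigr => j _;
  rewrite /= !enum_rankK.
Qed.

Lemma fpos_map (V W : matord R) (f : V -> W) (I : finType) (u : I -> I -> V) :
  map_mx f (\matrix_(i < #|I|, j < #|I|) u (enum_val i) (enum_val j)) =
  \matrix_(i, j) f (u (enum_val i) (enum_val j)).
Proof. by apply/matrixP => i j; rewrite !mxE. Qed.

Lemma fpos_coe (V W : matord R) (f : {linear V -> W}) (I : finType) (u : I -> I -> V) :
  complete_order_embedding f -> fpos u <-> fpos (fun i j => f (u i j)).
Proof. by move=> [_ fp]; rewrite /fpos fp fpos_map. Qed.

Lemma fpos_cp (V W : matord R) (f : {linear V -> W}) (I : finType) (u : I -> I -> V) :
  cp f -> fpos u -> fpos (fun i j => f (u i j)).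
Proof. by move=> fp /fp; rewrite fpos_map. Qed.

Lemma fpos_rep (V : matord R) (H : hilbert R) (r : {linear V -> BH H})
    (I : finType) (u : I -> I -> V) : complete_order_embedding r ->
  fpos u <-> forall h, 0 <= mform (fun i j => r (u i j)) h h.
Proof. by move=> rP; rewrite (fpos_coe _ rP) fposBH. Qed.

Lemma coe_rep (S : opsys R) : complete_order_embedding (rep S).
Proof. by have [] := repP S. Qed.

Lemma rep_unit (S : opsys R) : rep S (munit S) = bop_id (rep_space S).
Proof. by have [] := repP S. Qed.

Section Opsys.
Variable S : opsys R.
Let rho := rep S.
Let K := rep_space S.

Lemma fposE (I : finType) (u : I -> I -> S) :
  fpos u <-> forall h, 0 <= mform (fun i j => rho (u i j)) h h.
Proof. exact: fpos_rep (coe_rep S). Qed.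

Lemma rep_inj : injective rho. Proof. by case: (coe_rep S). Qed.

Lemma eq_fpos (I : finType) (u v : I -> I -> S) :
  (forall i j, u i j = v i j) -> fpos u -> fpos v.
Proof. by move=> uv; rewrite (_ : u = v)//; apply/funext => i; apply/funext => j. Qed.

(** The form of the compressed matrix at [h] is the form of [u] at the vectors \sum_l al j l h_l.
    Selecting, repeating and merging indices, and rank-one matrices, are all instances. *)
Lemma fpos_cmpr (I J : finType) (u : I -> I -> S) (al : I -> J -> R[i]) :
  fpos u -> fpos (fun k l => \sum_i \sum_j (Num.conj (al i k) * al j l) *: u i j).
Proof.
move=> /fposE up; apply/fposE => h.
rewrite (_ : mform _ _ _ = mform (fun i j => rho (u i j))
  (fun j => \sum_l al j l *: h l) (fun j => \sum_l al j l *: h l))//.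
have E k l : inner K ((rho (\sum_i \sum_j (Num.conj (al i k) * al j l) *: u i j) : bop K K) (h l)) (h k)
    = \sum_i \sum_j (Num.conj (al i k) * al j l) * inner K ((rho (u i j) : bop K K) (h l)) (h k).
  have -> : rho (\sum_i \sum_j (Num.conj (al i k) * al j l) *: u i j) =
      \sum_i \sum_j (Num.conj (al i k) * al j l) *: rho (u i j).
    rewrite linear_sum; apply: eq_bigr => i _; rewrite linear_sum; apply: eq_bigr => j _.
    by rewrite linearZ.
  rewrite bop_sumE ip_suml; apply: eq_bigr => i _.
  by rewrite bop_sumE ip_suml; apply: eq_bigr => j _; rewrite ipZl.
rewrite /mform; under eq_bigr => k _ do under eq_bigr => l _ do rewrite E.
under eq_bigr => k _ do rewrite exchange_big.
rewrite exchange_big; apply: eq_bigr => i _.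
under eq_bigr => k _ do rewrite exchange_big.
rewrite exchange_big; apply: eq_bigr => j _.
rewrite bop_sum ip_suml exchange_big; apply: eq_bigr => l _.
rewrite ip_sumr; apply: eq_bigr => k _.
by rewrite bopZ ipZl ipZr; ring.
Qed.

Lemma fpos_sel (I J : finType) (u : I -> I -> S) (s : J -> I) :
  fpos u -> fpos (fun k l => u (s k) (s l)).
Proof.
move=> /(fpos_cmpr (fun i k => (s k == i)%:R)); apply: eq_fpos => k l.
rewrite (bigD1 (s k))//= [X in _ + X]big1 ?addr0; last first.
  by move=> i /negPf si; rewrite big1// => j _; rewrite eq_sym si rmorph0 mul0r scale0r.
rewrite (bigD1 (s l))//= big1 ?addr0 ?eqxx ?rmorph1 ?mul1r ?scale1r// => j /negPf sj.
by rewrite eq_sym sj mulr0 scale0r.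
Qed.

Lemma fpos_push (I J : finType) (u : I -> I -> S) (s : I -> J) :
  fpos u -> fpos (fun k l => \sum_(i | s i == k) \sum_(j | s j == l) u i j).
Proof.
move=> /(fpos_cmpr (fun i k => (s i == k)%:R)); apply: eq_fpos => k l.
rewrite [RHS]big_mkcond; apply: eq_bigr => i _.
case: eqP => _; last by rewrite big1// => j _; rewrite rmorph0 mul0r scale0r.
rewrite [RHS]big_mkcond; apply: eq_bigr => j _.
by case: eqP => _; rewrite rmorph1 ?mulr1 ?mulr0 ?scale1r ?scale0r.
Qed.

Lemma fpos_ord n (u : 'M[S]_n) : mpos S n u <-> fpos (fun i j => u i j).
Proof.
have [_ rp] := coe_rep S; rewrite rp fposE.
by split=> up h; have := up h; congr (_ <= _); apply: eq_bigr => i _;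
  apply: eq_bigr => j _; rewrite mxE.
Qed.

Lemma mform_add (H : hilbert R) (I : finType) (u v : I -> I -> bop H H) h :
  mform (fun i j => u i j + v i j) h h = mform u h h + mform v h h.
Proof.
rewrite /mform -big_split; apply: eq_bigr => i _; rewrite -big_split.
by apply: eq_bigr => j _; rewrite /= ipDl.
Qed.

Lemma mform_scale (H : hilbert R) (I : finType) (u : I -> I -> bop H H) h a :
  mform (fun i j => a *: u i j) h h = a * mform u h h.
Proof.
rewrite /mform mulr_sumr; apply: eq_bigr => i _; rewrite mulr_sumr.
by apply: eq_bigr => j _; rewrite /= ipZl.
Qed.

Lemma fposD (I : finType) (u v : I -> I -> S) :
  fpos u -> fpos v -> fpos (fun i j => u i j + v i j).
Proof.
move=> /fposE up /fposE vp; apply/fposE => h.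
have := addr_ge0 (up h) (vp h); rewrite -mform_add; congr (_ <= mform _ _ _).
by apply/funext => i; apply/funext => j; rewrite linearD.
Qed.

Lemma fposZ (I : finType) (u : I -> I -> S) a :
  0 <= a -> fpos u -> fpos (fun i j => a *: u i j).
Proof.
move=> a0 /fposE up; apply/fposE => h.
have := mulr_ge0 a0 (up h); rewrite -mform_scale; congr (_ <= mform _ _ _).
by apply/funext => i; apply/funext => j; rewrite linearZ.
Qed.

Lemma fpos0 (I : finType) : fpos (fun _ _ : I => 0 : S).
Proof.
apply/fposE => h; rewrite /mform big1// => i _; rewrite big1// => j _.
by rewrite linear0 ip0l.
Qed.

Lemma fpos_sum (I L : finType) (P : pred L) (u : L -> I -> I -> S) :
  (forall l, P l -> fpos (u l)) -> fpos (fun i j => \sum_(l | P l) u l i j).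
Proof.
move=> up; suff : forall s : seq L, fpos (fun i j => \sum_(l <- s | P l) u l i j).
  exact.
elim=> [|l s IH]; first by apply: eq_fpos (fpos0 I) => i j; rewrite big_nil.
case Pl : (P l); last by apply: eq_fpos IH => i j; rewrite big_cons Pl.
by apply: eq_fpos (fposD (up l Pl) IH) => i j; rewrite big_cons Pl.
Qed.

(** The Archimedean property with an arbitrary [v], not only the unit; in the applications [v] is
    whatever error matrix the estimate leaves behind. *)
Lemma fpos_arch (I : finType) (u v : I -> I -> S) :
  (forall e : R, 0 < e -> fpos (fun i j => u i j + e%:C%C *: v i j)) -> fpos u.
Proof.
move=> uv; apply/fposE => h; rewrite lecE /=.
set A := mform (fun i j => rho (u i j)) h h; set B := mform (fun i j => rho (v i j)) h h.
have AB e : 0 < e -> 0 <= A + e%:C%C * B.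
  move=> /uv /fposE /(_ h); rewrite -mform_scale -mform_add.
  congr (_ <= mform _ _ _); apply/funext => i; apply/funext => j.
  by rewrite linearD linearZ.
have Im0 e : 0 < e -> complex.Im A + e * complex.Im B = 0.
  move=> /AB; rewrite lecE /= => /andP[/eqP + _].
  by case: (A) (B) => a b [c d] /=; rewrite mul0r addr0.
have Re0 e : 0 < e -> 0 <= complex.Re A + e * complex.Re B.
  move=> /AB; rewrite lecE /= => /andP[_].
  by case: (A) (B) => a b [c d] /=; rewrite mul0r subr0.
(* Two values of [e] separate the imaginary part of [A] from that of [B]. *)
have := Im0 1 ltr01; have := Im0 2 (ltr0n _ 2) => i2 i1; apply/andP; split; first by apply/eqP; lra.
rewrite -oppr_le0; apply: (@le0_of_small _ _ (complex.Re B)) => e /Re0; lra.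
Qed.

Lemma posE x : pos (V := S) x <-> forall h, 0 <= inner K (rho x h) h.
Proof.
rewrite /pos fposE; split=> xp h.
  by have := xp (fun _ => h); rewrite /mform !sum_unit.
by rewrite /mform !sum_unit.
Qed.

Lemma pos_unit : pos (munit S).
Proof. by apply/posE => h; rewrite /rho rep_unit ip_ge0. Qed.

Lemma fpos_rank1 (I : finType) x (xi : I -> R[i]) :
  pos x -> fpos (fun i j => (Num.conj (xi i) * xi j) *: x : S).
Proof.
move=> /(fpos_cmpr (fun _ => xi)); apply: eq_fpos => i j.
by rewrite !sum_unit.
Qed.

Lemma pos_self x : pos (V := S) x -> is_adjoint (rho x) (rho x).
Proof. by move=> /posE; exact: pos_sym. Qed.

Lemma fpos_herm (I : finType) (u : I -> I -> S) : fpos u ->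
  forall i j, is_adjoint (rho (u i j)) (rho (u j i)).
Proof. by move=> /fposE; exact: (mform_herm (u := fun i j => rho (u i j))). Qed.

Lemma sym_add_pos (H : hilbert R) (b : bop H H) c : is_adjoint b b -> obd b c ->
  forall h, 0 <= inner H ((b + c%:C%C *: bop_id H) h) h.
Proof.
move=> bs bc h; rewrite ipDl ipZl /= inner_norm (sym_real _ bs) nrE -rmorphXn.
rewrite -rmorphM -rmorphD lecR -lerBlDr sub0r lerNl.
rewrite -ReN; have /Re_le_norm : `|- inner H (b h) h| <= (c * nr h ^+ 2)%:C%C.
  by rewrite normrN (ge0_real (normr_ge0 _)) lecR expr2 mulrA; exact: obd_ip.
by [].
Qed.

(** The selfadjoint range supplies real and imaginary parts, and a large multiple of the unit makes
    each of them positive. *)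
Lemma pos_span (x : S) : exists (L : finType) (c : L -> R[i]) (p : L -> S),
  (forall l, pos (p l)) /\ x = \sum_l c l *: p l.
Proof.
have [_ _ rsa] := repP S.
have [_ [x' _ <-] xx'] : exists2 a', range rho a' & is_adjoint (rho x) a'.
  by apply: rsa; exists x.
pose y := 2^-1 *: (x + x'); pose z := (2^-1 * - 'i) *: (x - x').
have c2 : Num.conj (2^-1 : R[i]) = 2^-1 by rewrite fmorphV rmorph_nat.
have ys : is_adjoint (rho y) (rho y).
  move=> h k; rewrite /y linearZ linearD /= !ipE c2.
  by rewrite xx' (is_adjoint_sym xx') addrC.
have zs : is_adjoint (rho z) (rho z).
  move=> h k; rewrite /z linearZ linearB /= !ipE rmorphM rmorphN /= conjCi c2.
  by rewrite xx' (is_adjoint_sym xx') opprK; ring.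
have shift w : is_adjoint (rho w) (rho w) -> exists c : R[i], pos (w + c *: munit S).
  move=> ws; have [M M0 wM] := bop_bnd (rho w); exists M%:C%C; apply/posE => h.
  have := sym_add_pos ws wM h; congr (_ <= inner _ _ _).
  by rewrite /rho linearD linearZ /= rep_unit.
have [c1 p1] := shift _ ys; have [d p2] := shift _ zs.
(* The third term takes back the two shifts by the unit. *)
exists 'I_3, (fun l : 'I_3 => nth 0 [:: 1; 'i; - (c1 + 'i * d)] l : R[i]),
  (fun l : 'I_3 => nth 0 [:: y + c1 *: munit S; z + d *: munit S; munit S] l).
split; first by case=> -[|[|[|//]]] //= _; exact: pos_unit.
rewrite !big_ord_recl big_ord0 /= addr0 scale1r scalerDr scaleNr scalerDl.
rewrite scalerA addrA [X in X - _]addrACA addrK /y /z scalerA.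
have -> : 'i * (2^-1 * - 'i) = 2^-1 :> R[i].
  by rewrite mulrCA mulrN -expr2 sqrCi opprK mulr1.
by rewrite -scalerDr addrACA subrr addr0 -mulr2n -scalerMnr scalerMnl -mulr_natr mulVf ?scale1r ?pnatr_eq0.
Qed.

End Opsys.

Lemma fpos_cpP (S W : opsys R) (f : {linear S -> W}) :
  (forall (I : finType) (u : I -> I -> S), fpos u -> fpos (fun i j => f (u i j))) ->
  cp f.
Proof.
move=> fp n u /fpos_ord /fp up; apply/fpos_ord.
by apply: eq_fpos up => i j; rewrite mxE.
Qed.

Lemma fpos_pure (t : os_tensor_product R) (S T : opsys R) (I J : finType)
    (u : I -> I -> S) (v : J -> J -> T) : fpos u -> fpos v ->
  @fpos (alg_tensor t S T) (I * J)%type (fun x y => u x.1 y.1 ⊗ v x.2 y.2).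
Proof.
move=> up vp; have := tpos_pure t up vp => /(@fpos_ord (alg_tensor t S T)).
move=> /(fpos_sel (fun x : I * J => mxtens_index (enum_rank x.1, enum_rank x.2))).
by apply: eq_fpos => x y; rewrite !mxE !mxtens_indexK /= !enum_rankK.
Qed.

Lemma fpos_schur (t : os_tensor_product R) (S T : opsys R) (I : finType)
    (u : I -> I -> S) (v : I -> I -> T) : fpos u -> fpos v ->
  @fpos (alg_tensor t S T) I (fun i j => u i j ⊗ v i j).
Proof. by move=> up vp; exact: (fpos_sel (fun i => (i, i)) (fpos_pure t up vp)). Qed.

Lemma pos_pure (t : os_tensor_product R) (S T : opsys R) (x : S) (y : T) :
  pos x -> pos y -> @pos (alg_tensor t S T) (x ⊗ y).
Proof. exact: fpos_schur. Qed.

End MatrixPositivity.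

(** * Hermitian matrices as real combinations of positive pure tensors *)

Section HermitianDecomposition.
Variables (R : realType) (S T : opsys R).

(** All signs sit in the real coefficients [z], so that a change of the positive factors [a] can be
    paid for by a positive matrix with coefficients [|z|]. *)
Definition comb (I L : finType) (z : L -> R) (xi : L -> I -> R[i])
    (a : L -> S) (b : L -> T) (i j : I) : S ⊙ T :=
  \sum_l ((z l)%:C%C * (Num.conj (xi l i) * xi l j)) *: (a l ⊗ b l).

Definition pos_comb (I : finType) (w : I -> I -> S ⊙ T) : Prop :=
  exists (L : finType) (z : L -> R) (xi : L -> I -> R[i]) (a : L -> S) (b : L -> T),
    [/\ forall l, pos (a l), forall l, pos (b l) & forall i j, w i j = comb z xi a b i j].

Section Closure.
Variable I : finType.
Implicit Types w : I -> I -> S ⊙ T.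

Lemma pos_combD w1 w2 : pos_comb w1 -> pos_comb w2 ->
  pos_comb (fun i j => w1 i j + w2 i j).
Proof.
move=> [L1 [z1 [x1 [a1 [b1 [ap1 bp1 e1]]]]]] [L2 [z2 [x2 [a2 [b2 [ap2 bp2 e2]]]]]].
exists (L1 + L2)%type, (fun l => match l with inl l => z1 l | inr l => z2 l end),
  (fun l => match l with inl l => x1 l | inr l => x2 l end),
  (fun l => match l with inl l => a1 l | inr l => a2 l end),
  (fun l => match l with inl l => b1 l | inr l => b2 l end).
by split=> [[]//|[]//|i j]; rewrite /comb big_sumType e1 e2.
Qed.

Lemma pos_comb0 : pos_comb (fun _ _ : I => 0).
Proof.
exists 'I_0, (fun=> 0), (fun _ _ => 0), (fun=> 0), (fun=> 0).
by split=> [[]//|[]//|i j]; rewrite /comb big_ord0.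
Qed.

Lemma pos_comb_sum (L : finType) (w : L -> I -> I -> S ⊙ T) :
  (forall l, pos_comb (w l)) -> pos_comb (fun i j => \sum_l w l i j).
Proof.
move=> wp; suff sp (s : seq L) : pos_comb (fun i j => \sum_(l <- s) w l i j) by exact: sp.
elim: s => [|l s IH].
  suff -> : (fun i j : I => \sum_(l <- [::]) w l i j) = fun _ _ => 0 by exact: pos_comb0.
  by apply/funext => i; apply/funext => j; rewrite big_nil.
suff -> : (fun i j : I => \sum_(l0 <- l :: s) w l0 i j) =
    fun i j => w l i j + \sum_(l0 <- s) w l0 i j by exact: pos_combD.
by apply/funext => i; apply/funext => j; rewrite big_cons.
Qed.

Lemma pos_combZ (c : R) w : pos_comb w -> pos_comb (fun i j => c%:C%C *: w i j).
Proof.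
move=> [L [z [x [a [b [ap bp e]]]]]]; exists L, (fun l => c * z l), x, a, b.
split=> // i j; rewrite e /comb scaler_sumr; apply: eq_bigr => l _.
by rewrite scalerA rmorphM /= mulrA.
Qed.

Lemma pos_comb1 (xi : I -> R[i]) a b : pos a -> pos b ->
  pos_comb (fun i j => (Num.conj (xi i) * xi j) *: (a ⊗ b)).
Proof.
move=> ap bp; exists unit, (fun=> 1), (fun=> xi), (fun=> a), (fun=> b).
by split=> // i j; rewrite /comb sum_unit rmorph1 mul1r.
Qed.

(** Polarisation with e_p + c e_q: the unwanted diagonal terms are removed with the negative
    coefficients -1 and -|c|^2. *)
Lemma pos_comb_pair (p q : I) (c : R[i]) a b : pos a -> pos b ->
  pos_comb (fun i j => (c * ((i == p)%:R * (j == q)%:R)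
    + Num.conj c * ((i == q)%:R * (j == p)%:R)) *: (a ⊗ b)).
Proof.
move=> ap bp.
have h1 := pos_comb1 (fun i => (i == p)%:R + c * (i == q)%:R) ap bp.
have h2 := pos_combZ (- 1) (pos_comb1 (fun i => (i == p)%:R) ap bp).
have h3 := pos_combZ (- (complex.Re `|c|) ^+ 2) (pos_comb1 (fun i => (i == q)%:R) ap bp).
have := pos_combD h1 (pos_combD h2 h3); congr pos_comb.
apply/funext => i; apply/funext => j; rewrite !scalerA -!scalerDl; congr (_ *: _).
have cc : ((- complex.Re `|c| ^+ 2)%:C)%C = - (c * Num.conj c).
  by rewrite -normCK [in RHS](ge0_real (normr_ge0 c)) -rmorphXn -rmorphN.
rewrite cc !rmorphD !rmorphM /= !rmorph_nat rmorphN1; ring.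
Qed.

End Closure.

Lemma tensor_span (u : S ⊙ T) : exists (L : finType) (c : L -> R[i]) (a : L -> S) (b : L -> T),
  [/\ forall l, pos (a l), forall l, pos (b l) & u = \sum_l c l *: (a l ⊗ b l)].
Proof.
have [s ->] := tensorP u; elim: s => [|[x y] s [L [c [a [b [ap bp e]]]]]].
  by exists 'I_0, (fun=> 0), (fun=> 0), (fun=> 0); split=> [[]//|[]//|]; rewrite big_nil big_ord0.
have [L1 [c1 [a1 [ap1 e1]]]] := pos_span x; have [L2 [c2 [b2 [bp2 e2]]]] := pos_span y.
exists (L1 * L2 + L)%type, (fun l => match l with inl l => c1 l.1 * c2 l.2 | inr l => c l end),
  (fun l => match l with inl l => a1 l.1 | inr l => a l end),
  (fun l => match l with inl l => b2 l.2 | inr l => b l end).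
split=> [[]//|[]//|]; rewrite big_cons big_sumType /= -e; congr (_ + _).
rewrite {1}e1 {1}e2 linear_sumlz -(pair_bigA _ (fun i j => (c1 i * c2 j) *: (a1 i ⊗ b2 j))) /=.
apply: eq_bigr => i _; rewrite linear_sumr; apply: eq_bigr => j _.
by rewrite linearZl_LR linearZr_LR /= scalerA.
Qed.

(** Positivity enters only through Hermitian symmetry. As positive pure tensors are selfadjoint,
    expanding the entry (p, q) in them also expands the entry (q, p), with conjugate
    coefficients. *)
Lemma fpos_pos_comb (t : os_tensor_product R) (I : finType) (w : I -> I -> S ⊙ T) :
  fpos (V := alg_tensor t S T) w -> pos_comb w.
Proof.
move=> wp; pose rho := rep (alg_tensor t S T).
have term p q : pos_comb (fun i j : I => ((i == p)%:R * (j == q)%:R) *: w p q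
   + ((i == q)%:R * (j == p)%:R) *: w q p).
  have [L [c [a [b [ap bp e]]]]] := tensor_span (w p q).
  have e' : w q p = \sum_l Num.conj (c l) *: (a l ⊗ b l).
    apply: (@rep_inj _ (alg_tensor t S T)); apply: bopP => k; apply: inner_inj => h.
    rewrite -(fpos_herm wp p q h k) e !linear_sum /= !bop_sumE ip_suml ip_sumr.
    apply: eq_bigr => l _; rewrite ![rho (_ *: _)]linearZ /= ipZl ipZr conjCK; congr (_ * _).
    exact: (pos_self (pos_pure t (ap l) (bp l))).
  have := pos_comb_sum (fun l => pos_comb_pair p q (c l) (ap l) (bp l)); congr pos_comb.
  apply/funext => i; apply/funext => j; rewrite e' e !scaler_sumr -big_split.
  by apply: eq_bigr => l _; rewrite /= scalerDl !scalerA ![c l * _]mulrC ![Num.conj (c l) * _]mulrC.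
(* Summing over all ordered pairs counts every entry twice. *)
have := pos_combZ 2^-1 (pos_comb_sum (fun p => pos_comb_sum (term p))); congr pos_comb.
apply/funext => i; apply/funext => j.
have s1 (v : I -> I -> S ⊙ T) : \sum_p \sum_q ((i == p)%:R * (j == q)%:R : R[i]) *: v p q = v i j.
  rewrite (bigD1 i)//= [X in _ + X]big1 ?addr0; last first.
    by move=> p /negPf pi; rewrite big1// => q _; rewrite eq_sym pi mul0r scale0r.
  rewrite (bigD1 j)//= big1 ?addr0 ?eqxx ?mul1r ?scale1r// => q /negPf qj.
  by rewrite [j == q]eq_sym qj mulr0 scale0r.
under eq_bigr => p _ do rewrite big_split.
rewrite big_split /= s1 [X in _ + X]exchange_big /= (s1 w) -mulr2n -scalerMnr scalerMnl -mulr_natr.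
by rewrite rmorphV ?unitfE ?pnatr_eq0// rmorph_nat mulVf ?scale1r// pnatr_eq0.
Qed.

Lemma comb_pos (t : os_tensor_product R) (I L : finType) (z : L -> R) (xi : L -> I -> R[i]) a b :
  (forall l, 0 <= z l) -> (forall l, pos (a l)) -> (forall l, pos (b l)) ->
  fpos (V := alg_tensor t S T) (comb z xi a b).
Proof.
move=> z0 ap bp; apply: (fpos_sum (P := predT)) => l _.
have zc : 0 <= (z l)%:C%C :> R[i] by rewrite lecR.
have := fposZ zc (fpos_rank1 (xi l) (pos_pure t (ap l) (bp l))); apply: eq_fpos => i j.
by rewrite /= scalerA.
Qed.

(** According to the sign of [z l], one of the two order bounds between [a l] and [a' l] is tensored
    with [b l] and weighted by [|z l|]; the sum of these positive terms is the claim. *)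
Lemma comb_approx (t : os_tensor_product R) (I L : finType) (z : L -> R)
    (xi : L -> I -> R[i]) (a a' : L -> S) (b : L -> T) (e : R) :
  (forall l, pos (b l)) ->
  (forall l, pos (a l - a' l + e%:C%C *: munit S)) ->
  (forall l, pos (a' l - a l + e%:C%C *: munit S)) ->
  fpos (V := alg_tensor t S T) (fun i j => comb z xi a b i j - comb z xi a' b i j
     + e%:C%C *: comb (fun l => `|z l|) xi (fun=> munit S) b i j).
Proof.
move=> bp h1 h2.
pose s l := if 0 <= z l then a l - a' l + e%:C%C *: munit S else a' l - a l + e%:C%C *: munit S.
have sp : forall l, pos (s l) by move=> l; rewrite /s; case: ifP.
have := comb_pos t xi (fun l => normr_ge0 (z l)) sp bp; apply: eq_fpos => i j.
rewrite /comb scaler_sumr -sumrB -big_split; apply: eq_bigr => l _ /=.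
set y := Num.conj _ * _; rewrite /s !scalerA; set q := (e%:C%C * _).
have qE : (`|z l|)%:C%C * y * e%:C%C = q by rewrite mulrC.
case: (lerP 0 (z l)) => zl; rewrite linearDl linearBl linearZl_LR /= scalerDr scalerBr scalerA qE.
  by rewrite ger0_norm.
have -> : (z l)%:C%C * y = - ((`|z l|)%:C%C * y).
  by rewrite ltr0_norm// rmorphN mulNr opprK.
by rewrite !scaleNr opprK [X in X + _]addrC.
Qed.

(** One multiple of [e] pays for positivity over [a'], a second one for going back from [a'] to [a];
    [fpos_arch] removes both. *)
Lemma fpos_approx (t : os_tensor_product R) (I L : finType) (z : L -> R)
    (xi : L -> I -> R[i]) (a : L -> S) (b : L -> T) :
  (forall l, pos (b l)) ->
  (forall e : R, 0 < e -> exists a' : L -> S,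
     [/\ forall l, pos (a l - a' l + e%:C%C *: munit S),
         forall l, pos (a' l - a l + e%:C%C *: munit S)
       & fpos (V := alg_tensor t S T) (fun i j => comb z xi a' b i j
           + e%:C%C *: comb (fun l => `|z l|) xi (fun=> munit S) b i j)]) ->
  fpos (V := alg_tensor t S T) (comb z xi a b).
Proof.
pose V i j := comb (fun l => `|z l|) xi (fun=> munit S) b i j.
move=> bp h; apply: (@fpos_arch _ (alg_tensor t S T) _ _ (fun i j => V i j + V i j)) => e e0.
have [a' [h1 h2 h3]] := h _ e0.
have := fposD h3 (comb_approx t z xi bp h1 h2); apply: eq_fpos => i j.
by rewrite scalerDr addrACA [X in X + _]addrC subrK.
Qed.

End HermitianDecomposition.

Lemma nrZR (R : realType) (V : normedModType R[i]) (s : R) (x : V) :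
  nr (s%:C%C *: x) = `|s| * nr x.
Proof.
have -> : nr (s%:C%C *: x) = complex.Re (`|s|%:C%C * `|x|).
  rewrite /nr normrZ; congr (complex.Re (_ * _)).
  case: (lerP 0 s) => h; first by rewrite !ger0_norm ?lecR.
  by rewrite !ltr0_norm ?ltcR// rmorphN.
by rewrite ReZ.
Qed.

Section FormBounds.
Variables (R : realType) (H : hilbert R) (I : finType).
Implicit Types u w : I -> I -> bop H H.

Lemma mform_real u h : (forall i j, is_adjoint (u i j) (u j i)) ->
  mform u h h = (complex.Re (mform u h h))%:C%C.
Proof.
move=> us; have ur : mform u h h \is Num.real.
  apply/CrealP; rewrite /mform rmorph_sum exchange_big; apply: eq_bigr => i _.
  by rewrite rmorph_sum; apply: eq_bigr => j _; rewrite /= -ipC us.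
by rewrite -[LHS](RRe_real ur).
Qed.

Lemma Re_sum (J : Type) (s : seq J) (P : pred J) (F : J -> R[i]) :
  complex.Re (\sum_(i <- s | P i) F i) = \sum_(i <- s | P i) complex.Re (F i).
Proof. by elim/big_rec2: _ => [//|i a b _ <-]; rewrite ReD. Qed.

(** The inequality 2 |h_i| |h_j| <= |h_i|^2 + |h_j|^2, summed over both indices, produces the factor
    [#|I|]. *)
Lemma mform_bound w (e : R) h : 0 <= e -> (forall i j, obd (w i j) e) ->
  - (e * #|I|%:R * \sum_i nr (h i) ^+ 2) <= complex.Re (mform w h h).
Proof.
move=> e0 we.
have E : e * #|I|%:R * (\sum_i nr (h i) ^+ 2)
    = \sum_i \sum_j e * ((nr (h i) ^+ 2 + nr (h j) ^+ 2) / 2).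
  pose A : R := \sum_i nr (h i) ^+ 2.
  have cA (x : R) : \sum_(i : I) x = #|I|%:R * x by rewrite sumr_const (_ : #|_| = #|I|) ?mulr_natl //; apply: eq_card.
  transitivity (\sum_(i : I) e / 2 * (#|I|%:R * nr (h i) ^+ 2 + A)).
    by rewrite -mulr_sumr big_split /= -mulr_sumr cA /A; field.
  apply: eq_bigr => i _; rewrite -mulr_sumr -mulr_suml big_split /= cA -/A.
  by field.
rewrite E -sumrN /mform Re_sum; apply: ler_sum => i _.
rewrite -sumrN Re_sum; apply: ler_sum => j _.
have h1 : `|- inner H (w i j (h j)) (h i)| <= (e * nr (h j) * nr (h i))%:C%C.
  by rewrite normrN (ge0_real (normr_ge0 _)) lecR; exact: obd_ip.
have := Re_le_norm h1; rewrite ReN lerNl => h2; apply: le_trans h2.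
rewrite lerN2 -mulrA ler_wpM2l//; have := sqr_ge0 (nr (h i) - nr (h j)); nra.
Qed.

End FormBounds.

Section OperatorLimit.
Variables (R : realType) (H K : hilbert R).

Lemma bop_lim (b : nat -> bop H K) (d : nat -> R) :
  (forall e, 0 < e -> exists N, forall n, (N <= n)%N -> d n <= e) ->
  (forall n m, (n <= m)%N -> obd (b m - b n) (d n)) ->
  exists l, forall n, obd (l - b n) (d n).
Proof.
move=> d0 bd.
have lim k : exists l, forall n, nr (l - b n k) <= d n * nr k.
  apply: hilbert_lim => [e e0|n m nm]; last exact: bd.
  have k0 : 0 < nr k + 1 by rewrite ltr_wpDl ?nr_ge0.
  have [N NP] := d0 _ (divr_gt0 e0 k0); exists N => n /NP dn.
  rewrite (le_trans (ler_wpM2r (nr_ge0 _) dn))// mulrAC ler_pdivrMr// ler_pM2l//.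
  by rewrite lerDl.
have [l lP] := choice lim.
have lb : l \in bounded_linear H K.
  apply/asboolP; split=> [a x y|].
    apply/eqP; rewrite -subr_eq0; apply/eqP; apply: nr_eq0.
    apply: (@le0_of_small _ _ (nr (a *: x + y) + complex.Re `|a| * nr x + nr y)) => e e0.
    have [N /(_ N (leqnn N)) dN] := d0 _ e0.
    have -> : l (a *: x + y) - (a *: l x + l y) =
       (l (a *: x + y) - b N (a *: x + y)) - (a *: (l x - b N x) + (l y - b N y)).
      by rewrite bopD bopZ scalerBr addrACA -opprD opprB addrA subrK.
    rewrite (le_trans (nrB _ _))// (le_trans (lerD (lexx _) (nrD _ _)))// nrZ.
    have hN z : nr (l z - b N z) <= e * nr z.
      by rewrite (le_trans (lP z N))// ler_wpM2r// nr_ge0.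
    by rewrite !mulrDr addrA lerD// lerD// mulrCA ler_wpM2l// Re_norm_ge0.
  have [M M0 bM] := bop_bnd (b 0%N); exists (`|d 0%N| + M)%:C%C => [|k].
    by rewrite lecR addr_ge0.
  rewrite !nrE -rmorphM lecR mulrDl -[l k](subrK (b 0%N k)) (le_trans (nrD _ _))//.
  rewrite lerD// (le_trans (lP k 0%N))// ler_wpM2r ?nr_ge0// ler_norm//.
by exists (Bop lb) => n k; exact: lP.
Qed.

End OperatorLimit.

(** * Norm closures and completions *)

Section ConcreteClosure.
Variables (R : realType) (S : matord R) (H : hilbert R) (r : {linear S -> BH H}).
Hypothesis rP : represents r.

(** For [r := rep S] this unfolds to the matrix order of [compl S], so one treatment covers
    completions and closures of other realisations. *)
Definition closM : matord R :=
  MatOrd (clos_in r (munit S))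
    (fun n => [set u : 'M[clos r]_n |
                mpos (BH H) n (map_mx (@clos_val _ _ _ r) u)]).

Let r_unit : r (munit S) = bop_id H. Proof. by case: rP. Qed.
Let r_coe : complete_order_embedding r. Proof. by case: rP. Qed.

Let r_adj x : exists x', is_adjoint (r x) (r x').
Proof. by have [_ _ /(_ (r x))[|_ [x' _ <-] xx']] := rP; [exists x|exists x']. Qed.

Lemma clos_dense (x : closM) (e : R) : 0 < e -> exists s, obd (clos_val x - r s) e.
Proof.
by move=> e0; have /asboolP/nclosureE/(_ _ e0)[_ [s _ <-] h] := valP x; exists s.
Qed.

Lemma fpos_closM (I : finType) (u : I -> I -> closM) :
  fpos u <-> forall h, 0 <= mform (fun i j => clos_val (u i j)) h h.
Proof. by rewrite -fposBH /fpos -(@fpos_map _ closM (BH H) (@clos_val _ _ _ r)). Qed.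

Lemma clos_in_coe : complete_order_embedding (clos_in r : {linear S -> closM}).
Proof.
split=> [x y xy|n u]; first by case: r_coe => ri _; apply: ri; exact: (congr1 val xy).
have [_ ->] := r_coe.
have -> : map_mx r u = map_mx (@clos_val _ _ _ r) (map_mx (clos_in r) u).
  by apply/matrixP => i j; rewrite !mxE.
by [].
Qed.

(** An abstract operator system carries no norm; boundedness is measured through a realisation
    [q]. *)
Definition bddfor (K L : hilbert R) (V : lmodType R[i]) (q : V -> bop K K) (f : V -> bop L L) (C : R) :=
  0 <= C /\ forall x c, 0 <= c -> obd (q x) c -> obd (f x) (C * c).

(** The 2-by-2 matrix with [c] on the diagonal and [x], [x'] off it is positive because [c] bounds
    [x]. The image of this matrix is positive too, which bounds [f x] by [c] times a bound of
    [f 1]. *)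
Lemma cp_bdd (K : hilbert R) (f : {linear S -> BH K}) : cp f ->
  exists C, bddfor r f C.
Proof.
move=> fp; have [D D0 dD] := bop_bnd (f (munit S) : bop K K).
exists D; split=> // x c c0 xc h.
have [x' xx'] := r_adj x.
pose u (b b' : bool) : S := if b == b' then c%:C%C *: munit S else if b then x else x'.
have up : fpos u.
  apply/(fpos_rep _ r_coe) => k; rewrite mform_real; last first.
    case=> [] [] /=; rewrite /u/= ?linearZ /= ?r_unit; try by move=> g l; rewrite /= !ipE conjRC.
      exact: xx'.
    exact: is_adjoint_sym.
  rewrite lecR /mform !big_bool /u /= !linearZ /= r_unit !ReD !ipE !ReZ !Re_ip.
  rewrite (is_adjoint_sym xx' (k true) (k false)) /=.
  rewrite [inner H (k true) _]ipC Re_conj.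
  have h1 : `|- inner H (r x (k false)) (k true)| <= (c * nr (k false) * nr (k true))%:C%C.
    by rewrite normrN (ge0_real (normr_ge0 _)) lecR; exact: obd_ip.
  have := Re_le_norm h1; rewrite ReN.
  have := mulr_ge0 c0 (sqr_ge0 (nr (k true) - nr (k false))).
  move: (complex.Re _) => X; nra.
have fup := fpos_cp fp up; have fh := (proj1 (fposBH _) fup).
have fxx' := mform_herm fh true false; rewrite /u /= in fxx'.
have [fx0|fx0] := eqVneq (nr (f x h)) 0.
  by rewrite fx0 !mulr_ge0// nr_ge0.
have fx1 : 0 < nr (f x h) by rewrite lt_neqAle eq_sym fx0 nr_ge0.
(* The test vector [g] points against [f x h] and has the norm of [h]: this makes the cross term as
   negative as possible while the diagonal terms agree. *)
pose la := nr h / nr (f x h).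
have h1 : 0 <= la by rewrite divr_ge0// nr_ge0.
have [g [nrg gE]] : exists g : K, nr g = nr h /\
    complex.Re (inner K (f x h) g) = - (nr h * nr (f x h)).
  exists ((- la)%:C%C *: f x h); split.
    by rewrite nrZR normrN ger0_norm// /la divfK.
  by rewrite ipZr conjRC ReZ Re_ip /la mulNr expr2 mulrA divfK.
have := fh (fun b => if b then g else h).
rewrite lecE /mform !big_bool /u /= !linearZ /= !ReD => /andP[_].
rewrite !ipZl !ReZ.
have dB k : complex.Re (inner K (f (munit S) k) k) <= D * nr k ^+ 2.
  apply: Re_le_norm; rewrite (ge0_real (normr_ge0 _)) lecR expr2 mulrA.
  exact: obd_ip.
have -> : complex.Re (inner K (f x' g) h) = complex.Re (inner K (f x h) g).
  by rewrite fxx' [inner K h _]ipC Re_conj.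
rewrite gE.
have := ler_wpM2l c0 (dB g); have := ler_wpM2l c0 (dB h); rewrite nrg => d1 d2 d3.
have h0 : 0 < nr h.
  rewrite lt_neqAle nr_ge0 andbT eq_sym; apply: contra_neq fx0 => h0.
  by rewrite (nr_eq0 (x := h)) ?h0// linear0 nr0.
by rewrite -(ler_pM2l h0); lra.
Qed.

Lemma ext_ex (K : hilbert R) (f : {linear S -> bop K K}) C : bddfor r f C ->
  exists F : {linear closM -> bop K K},
    (forall s, F (clos_in r s) = f s) /\ bddfor (@clos_val _ _ _ r) F C.
Proof.
move=> [C0 fC].
(* This property pins [y] down independently of an approximating sequence; linearity, extension and
   the bound are all read off from it. *)
have ex x : exists y, forall s c, 0 <= c -> obd (clos_val (x : closM) - r s) c -> obd (y - f s) (C * c).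
  have /choice[s sP] (n : nat) : exists s, obd (clos_val x - r s) n.+1%:R^-1.
    by apply: clos_dense; rewrite invr_gt0.
  pose e (n : nat) : R := n.+1%:R^-1.
  have e_small d : 0 < d -> exists N, forall n, (N <= n)%N -> C * (e n + e n) <= d.
    move=> d0; have C1 : 0 < 2 * C + 1 by rewrite ltr_wpDl// mulr_ge0.
    have [N NP] := invS_small (divr_gt0 d0 C1); exists N => n /NP.
    rewrite -/(e n) ler_pdivlMr// => h; apply: le_trans h.
    have e0 : 0 <= e n by rewrite invr_ge0.
    by nra.
  have diff s1 s2 d1 d2 : 0 <= d1 + d2 -> obd (clos_val x - r s1) d1 -> obd (clos_val x - r s2) d2 ->
      obd (f s2 - f s1) (C * (d1 + d2)).
    move=> d0 h1 h2; rewrite -linearB; apply: fC => //.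
    rewrite linearB /= (_ : _ - _ = (clos_val x - r s1) - (clos_val x - r s2)).
      exact: obdB.
    by rewrite opprB [RHS]addrC addrA subrK.
  have em n m : (n <= m)%N -> e m <= e n.
    by move=> nm; rewrite lef_pV2 ?posrE// ler_nat ltnS.
  have e0 n : 0 <= e n by rewrite invr_ge0.
  have [y yP] := bop_lim e_small (b := fun n => f (s n)) (fun n m nm =>
    obdW (ler_wpM2l C0 (lerD (lexx (e n)) (em n m nm)))
      (diff _ _ _ _ (addr_ge0 (e0 n) (e0 m)) (sP n) (sP m))).
  exists y => s' c c0 h k; apply/ler_addgt0Pr => d d0.
  have k0 : 0 < 2 * nr k + 1 by rewrite ltr_wpDl// mulr_ge0// nr_ge0.
  have [N /(_ N (leqnn N)) NP] := e_small _ (divr_gt0 d0 k0).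
  have -> : (y - f s') k = (y - f (s N)) k + (f (s N) - f s') k.
    by rewrite /= addrA subrK.
  rewrite (le_trans (nrD _ _))// (le_trans (lerD (yP N k) (diff _ _ _ _ _ h (sP N) k)))//.
    by rewrite addr_ge0.
  have h1 := ler_wpM2r (nr_ge0 k) NP.
  have h2 : C * e N * nr k <= C * (e N + e N) * nr k.
    by rewrite ler_wpM2r ?nr_ge0// ler_wpM2l// lerDl.
  have h3 : d / (2 * nr k + 1) * nr k * 2 <= d.
    rewrite -[leRHS](divfK (lt0r_neq0 k0)); have := divr_gt0 d0 k0; have := nr_ge0 k.
    by move: (d / _) => q; nra.
  have E1 : C * (c + e N) * nr k = C * c * nr k + C * e N * nr k by ring.
  have E2 : C * (e N + e N) * nr k = 2 * (C * e N * nr k) by ring.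
  have E3 : d / (2 * nr k + 1) * nr k * 2 = 2 * (d / (2 * nr k + 1) * nr k) by ring.
  have E4 : 0 <= d / (2 * nr k + 1) * nr k.
    by rewrite mulr_ge0 ?nr_ge0// ltW// divr_gt0.
  by rewrite E1; rewrite E2 in h1; rewrite E3 in h3; lra.
have [F FP] := choice ex.
have Flin : linear F.
  move=> a x y; apply/eqP; rewrite -subr_eq0; apply/eqP; apply: obd0P => d d0.
  have A0 := Re_norm_ge0 a; set A := complex.Re `|a| in A0.
  have c0 : 0 < C * (A + 1) + (A * C + C) + 1 by rewrite ltr_wpDl// !addr_ge0// mulr_ge0// addr_ge0.
  pose e := d / (C * (A + 1) + (A * C + C) + 1).
  have e0 : 0 < e by rewrite divr_gt0.
  have [s sx] := clos_dense x e0; have [s' sy] := clos_dense y e0.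
  have h1 : obd (clos_val (a *: x + y) - r (a *: s + s')) (A * e + e).
    rewrite linearP /= (_ : _ - _ = a *: (clos_val x - r s) + (clos_val y - r s')).
      by apply: obdD => //; exact: obdZ.
    by rewrite scalerBr opprD addrACA.
  have Ae0 : 0 <= A * e + e by apply: addr_ge0; [apply: mulr_ge0; [exact: A0|exact: ltW]|exact: ltW].
  have h2 := FP _ _ _ Ae0 h1; have h3 := FP _ _ _ (ltW e0) sx; have h4 := FP _ _ _ (ltW e0) sy.
  have -> : F (a *: x + y) - (a *: F x + F y) =
     (F (a *: x + y) - f (a *: s + s')) - (a *: (F x - f s) + (F y - f s')).
    by rewrite linearP scalerBr addrACA -opprD opprB addrA subrK.
  apply: obdW (obdB h2 (obdD (obdZ a h3) h4)).
  rewrite -/A -[leRHS](divfK (lt0r_neq0 c0)) -/e; nra.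
pose F' : {linear closM -> bop K K} := HB.pack_for {linear closM -> bop K K} F
  (GRing.isLinear.Build _ _ _ _ F Flin).
exists F'; split=> [s|].
  apply/eqP; rewrite -subr_eq0; apply/eqP; apply: obd0P => e e0.
  apply: obdW (FP _ s 0 _ _) => //; first by rewrite mulr0 ltW.
  by rewrite subrr; exact: obd0.
split=> // x c c0 xc; have := FP x 0 c c0.
rewrite (linear0 r : r 0 = (0 : bop H H)) (linear0 f) !subr0; exact.
Qed.

Lemma ext_uniq (K : hilbert R) (F G : {linear closM -> bop K K}) C D :
  bddfor (@clos_val _ _ _ r) F C -> bddfor (@clos_val _ _ _ r) G D ->
  (forall s, F (clos_in r s) = G (clos_in r s)) -> forall x, F x = G x.
Proof.
move=> [C0 FC] [D0 GD] FG x; apply/eqP; rewrite -subr_eq0; apply/eqP.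
apply: obd0P => e e0; have CD : 0 < C + D + 1 by rewrite ltr_wpDl// addr_ge0.
have d0 := divr_gt0 e0 CD; set d := e / _ in d0.
have [s xs] := clos_dense x d0.
have -> : F x - G x = F (x - clos_in r s) - G (x - clos_in r s).
  by rewrite (linearB F) (linearB G) FG opprB addrA subrK.
apply: obdW (obdB (FC _ _ (ltW d0) _) (GD _ _ (ltW d0) _)) => //.
by rewrite -[leRHS](divfK (lt0r_neq0 CD)) -/d; nra.
Qed.

(** Approximating entrywise loses both symmetry and positivity: the first is restored by averaging
    with adjoints, the second by a small multiple of the unit on the diagonal. *)
Lemma clos_pos_approx (I : finType) (u : I -> I -> closM) (e : R) : fpos u -> 0 < e ->
  exists2 v : I -> I -> S, fpos v & forall i j, obd (clos_val (u i j) - r (v i j)) e.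
Proof.
move=> /fpos_closM up e0; have us := mform_herm up.
have N0 : 0 < #|I|%:R + 1 :> R by rewrite ltr_wpDl.
have d0 := divr_gt0 e0 N0; set d := e / _ in d0.
have /choice[s sP] (ij : I * I) : exists s, obd (clos_val (u ij.1 ij.2) - r s) d.
  exact: clos_dense.
have /choice[s' s'P] (ij : I * I) : exists x', is_adjoint (r (s ij)) (r x') by exact: r_adj.
pose t i j : S := 2^-1 *: (s (i, j) + s' (j, i)).
have c2 : Num.conj (2^-1 : R[i]) = 2^-1 by rewrite fmorphV rmorph_nat.
have ts i j : is_adjoint (r (t i j)) (r (t j i)).
  move=> h k; rewrite /t !linearZ !linearD /= !ipE c2.
  by rewrite (s'P (i, j)) (is_adjoint_sym (s'P (j, i))) addrC.
have td i j : obd (clos_val (u i j) - r (t i j)) d.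
  have -> : clos_val (u i j) - r (t i j) =
     2^-1 *: ((clos_val (u i j) - r (s (i, j))) + (clos_val (u i j) - r (s' (j, i)))).
    rewrite /t linearZ linearD /= addrACA -opprD scalerBr; congr (_ - _).
    by rewrite -mulr2n -scalerMnr scalerMnl -mulr_natr mulVf ?scale1r ?pnatr_eq0.
  have h1 := sP (i, j); have h2 := sP (j, i).
  have h3 : obd (clos_val (u i j) - r (s' (j, i))) d.
    apply: (obd_adj (ltW d0) _ h2) => h k /=.
    by rewrite ipBl ipBr (us j i) s'P.
  apply: obdW (obdZ 2^-1 (obdD h1 h3)).
  rewrite (_ : (2^-1 : R[i]) = (2^-1)%:C%C); last first.
    by rewrite rmorphV ?unitfE ?pnatr_eq0// rmorph_nat.
  rewrite ger0_norm ?lecR ?invr_ge0//=; lra.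
(* By [mform_bound] an entrywise error [d] changes the form by at most [d * #|I|] times the squared
   norm, which this shift absorbs. Error and shift together give [d + d * #|I| = e]. *)
pose v i j := t i j + (i == j)%:R *: ((d * #|I|%:R)%:C%C *: munit S).
have vE i j : r (v i j) = r (t i j) + (i == j)%:R *: ((d * #|I|%:R)%:C%C *: bop_id H).
  by rewrite /v linearD; congr (_ + _); rewrite !linearZ /= r_unit scalerA mulrC -scalerA.
exists v => [|i j].
  apply/(fpos_rep _ r_coe) => h; rewrite mform_real; last first.
    move=> i j x y; rewrite !vE /= !ipE conjRC rmorph_nat ts eq_sym.
    by [].
  rewrite lecR.
  have E : complex.Re (mform (fun i j => r (v i j)) h h) =
     complex.Re (mform (fun i j => clos_val (u i j)) h h)
     + complex.Re (mform (fun i j => r (t i j) - clos_val (u i j)) h h)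
     + d * #|I|%:R * \sum_i nr (h i) ^+ 2.
    have -> : d * #|I|%:R * \sum_i nr (h i) ^+ 2 = complex.Re
        (mform (fun i j : I => (i == j)%:R *: ((d * #|I|%:R)%:C%C *: bop_id H)) h h).
      rewrite Re_sum mulr_sumr; apply: eq_bigr => i _.
      rewrite (bigD1 i)//= big1 ?addr0 ?eqxx; last first.
        by move=> j /negPf ji; rewrite eq_sym ji /= scale0r ip0l.
      by rewrite scale1r ipZl ReZ Re_ip.
    rewrite -!ReD -!mform_add; congr (complex.Re (mform _ _ _)).
    apply/funext => i; apply/funext => j; rewrite vE; congr (_ + _).
    by rewrite addrC subrK.
  rewrite E; have h1 := up h; rewrite lecE in h1; have /andP[_ {}h1] := h1.
  have := @mform_bound _ _ I (fun i j => r (t i j) - clos_val (u i j)) d h (ltW d0).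
  move=> h2; have := h2 (fun i j => _); rewrite /= in h1 *.
  have h3 i j : obd (r (t i j) - clos_val (u i j)) d by rewrite -opprB; exact: obdN.
  by move=> /(_ h3); lra.
have -> : clos_val (u i j) - r (v i j) = (clos_val (u i j) - r (t i j)) -
    (i == j)%:R *: ((d * #|I|%:R)%:C%C *: bop_id H) by rewrite vE opprD addrA.
apply: obdW (obdB (td i j) (_ : obd _ (d * #|I|%:R))).
  by rewrite -[leRHS](divfK (lt0r_neq0 N0)) -/d; lra.
move=> h /=; have dN : 0 <= d * #|I|%:R by rewrite mulr_ge0// ltW.
case: eqP => _; last by rewrite scale0r nr0 mulr_ge0// nr_ge0.
by rewrite scale1r nrZR ger0_norm.
Qed.

End ConcreteClosure.

Section ClosureOpsys.
Variable R : realType.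

Lemma closM_represents (S : matord R) (H : hilbert R) (r : {linear S -> BH H}) :
  represents r -> represents (@clos_val _ _ _ r : {linear closM r -> BH H}).
Proof.
move=> [r1 _ rsa]; split; [exact: r1|by split=> //; exact: val_inj|].
have rB a b : range r a -> range r b -> range r (a - b).
  by move=> [v _ <-] [w _ <-]; exists (v - w); rewrite ?linearB.
move=> _ [x _ <-]; have /asboolP xcl := valP x.
have [y ycl xy] := nclosure_selfadjoint rB rsa xcl.
have yP : y \in closed_range r by apply/asboolP.
by exists y => //; exists (Clos yP).
Qed.

Lemma closM_is_opsys (S : matord R) (H : hilbert R) (r : {linear S -> BH H}) :
  represents r -> is_opsys (closM r).
Proof. by move=> /closM_represents ?; exists H, (@clos_val _ _ _ r : {linear closM r -> BH H}). Qed.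

Definition closO (S : matord R) (H : hilbert R) (r : {linear S -> BH H}) (rP : represents r)
  : opsys R := OpSys (closM_is_opsys rP).

Lemma BH_represents (H : hilbert R) : represents (idfun : {linear BH H -> BH H}).
Proof.
split=> //.
- split=> // n u; rewrite (_ : map_mx idfun u = u)//.
  by apply/matrixP => i j; rewrite mxE.
- move=> a _; exists (adj a); first by exists (adj a).
  by move=> h k; exact: adjP.
Qed.

Definition BHo (H : hilbert R) : opsys R :=
  OpSys (ex_intro _ H (ex_intro _ _ (BH_represents H))).

Lemma cp_comp (U V W : matord R) (f : {linear U -> V}) (g : {linear V -> W}) :
  cp f -> cp g -> cp (g \o f : {linear U -> W}).
Proof.
move=> fp gp n u /fp /gp; congr (mpos W n _).
by apply/matrixP => i j; rewrite !mxE.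
Qed.

Lemma coe_cp (V W : matord R) (f : {linear V -> W}) : complete_order_embedding f -> cp f.
Proof. by move=> [_ fp] n u /fp. Qed.

Lemma ext_cp (S : matord R) (H K : hilbert R) (r : {linear S -> BH H}) (rP : represents r)
    (f : {linear S -> BH K}) : cp f ->
  exists F : {linear closM r -> BH K}, (forall s, F (clos_in r s) = f s) /\ cp F.
Proof.
move=> fp; have [C fC] := cp_bdd rP fp; have [F [Ff [C0 FC]]] := ext_ex fC.
exists F; split=> //; apply: (@fpos_cpP _ (closO rP) (BHo K)) => I u up.
apply/fposBH; have C1 : 0 < C + 1 by rewrite ltr_wpDl.
have approx e : 0 < e -> exists v : I -> I -> S,
    [/\ fpos v, forall i j, obd (clos_val (u i j) - r (v i j)) (e / (C + 1))
      & forall i j, obd (F (u i j) - f (v i j)) e].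
  move=> e0; have [v vp uv] := clos_pos_approx rP up (divr_gt0 e0 C1).
  exists v; split=> // i j.
  have := FC (u i j - clos_in r (v i j)) _ (ltW (divr_gt0 e0 C1)) (uv i j).
  rewrite (linearB F) Ff; apply: obdW.
  by rewrite -[leRHS](divfK (lt0r_neq0 C1)) mulrC ler_wpM2l ?lerDl// ltW// divr_gt0.
apply: mform_lim => e e0.
have [v [vp _ Fv]] := approx _ e0; exists (fun i j => f (v i j)) => //.
exact: (proj1 (fposBH _) (fpos_cp fp vp)).
Qed.

Lemma ext_clos (S T : matord R) (H K : hilbert R) (r : {linear S -> BH H}) (q : {linear T -> BH K})
    (rP : represents r) (qP : represents q) (f : {linear S -> T}) : cp f ->
  exists F : {linear closM r -> closM q},
    (forall s, F (clos_in r s) = clos_in q (f s)) /\ cp F.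
Proof.
move=> fp; have qcoe : complete_order_embedding q by case: qP.
have qfp := cp_comp fp (coe_cp qcoe).
have [F [Ff Fp]] := ext_cp rP qfp.
have [C [C0 FC]] := cp_bdd (closM_represents rP) Fp.
have Fcl x : F x \in closed_range q.
  apply/asboolP/nclosureE => e e0; have C1 : 0 < C + 1 by rewrite ltr_wpDl.
  have d0 := divr_gt0 e0 C1; have [s xs] := clos_dense x d0.
  exists (q (f s)); first by exists (f s).
  have := FC (x - clos_in r s) _ (ltW d0) xs.
  rewrite (linearB F) Ff; apply: obdW.
  by rewrite -[leRHS](divfK (lt0r_neq0 C1)) mulrC ler_wpM2l ?lerDl// ltW// divr_gt0.
pose G x : closM q := Clos (Fcl x).
have Glin : linear G by move=> a x y; apply: val_inj; rewrite /= linearP.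
pose G' : {linear closM r -> closM q} := HB.pack_for {linear closM r -> closM q} G
  (GRing.isLinear.Build _ _ _ _ G Glin).
exists G'; split=> [s|n u /Fp]; first by apply: val_inj; rewrite /= Ff.
rewrite /=; congr (mpos (BH K) n _).
by apply/matrixP => i j; rewrite !mxE.
Qed.

Lemma cp_uniq (S W : opsys R) (H : hilbert R) (r : {linear S -> BH H}) (rP : represents r)
    (F G : {linear closM r -> W}) : cp F -> cp G ->
  (forall s, F (clos_in r s) = G (clos_in r s)) -> forall x, F x = G x.
Proof.
move=> Fp Gp FG x; apply: (@rep_inj _ W).
have [C FC] := cp_bdd (closM_represents rP) (cp_comp Fp (coe_cp (coe_rep W))).
have [D GD] := cp_bdd (closM_represents rP) (cp_comp Gp (coe_cp (coe_rep W))).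
by apply: (ext_uniq FC GD) => s /=; rewrite FG.
Qed.

Lemma lifts_cp (S T : opsys R) (f : {linear S -> T}) : cp f -> lifts (@cp R) f.
Proof.
move=> fp; have [F [Ff Fp]] := ext_clos (repP S) (repP T) fp.
by exists F.
Qed.

Lemma compl_in_coe (S : opsys R) : complete_order_embedding (compl_in S).
Proof. exact: (clos_in_coe (repP S)). Qed.

Lemma compl_in_ucp (S : opsys R) : ucp (compl_in S).
Proof. by split=> //; exact/coe_cp/compl_in_coe. Qed.

Lemma fpos_compl (S : opsys R) (I : finType) (u : I -> I -> S) :
  fpos (V := compl S) (fun i j => compl_in S (u i j)) <-> fpos u.
Proof. by rewrite (fpos_coe u (compl_in_coe S)). Qed.

(* Nuclearity without the completions, see [nuclearP]. *)
Definition pnuc (t' t : os_tensor_product R) (S : opsys R) : Prop :=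
  forall (T : opsys R) (I : finType) (u : I -> I -> S ⊙ T),
    fpos (V := alg_tensor t' S T) u -> fpos (V := alg_tensor t S T) u.

Lemma tensor_le_fpos (t' t : os_tensor_product R) (S T : opsys R) (I : finType) (u : I -> I -> S ⊙ T) :
  tensor_le t' t -> fpos (V := alg_tensor t S T) u -> fpos (V := alg_tensor t' S T) u.
Proof.
move=> /(_ S T)[F [Fin Fp]] up; apply/(@fpos_compl (alg_tensor t' S T)).
have := fpos_cp Fp (proj2 (@fpos_compl (alg_tensor t S T) _ _) up).
by apply: eq_fpos => i j; rewrite Fin.
Qed.

Lemma functorial_fpos (t : os_tensor_product R) (S1 S2 T1 T2 : opsys R)
    (f : {linear S1 -> T1}) (g : {linear S2 -> T2}) (I : finType) (u : I -> I -> S1 ⊙ S2) :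
  functorial t -> ucp f -> ucp g ->
  fpos (V := alg_tensor t S1 S2) u ->
  fpos (V := alg_tensor t T1 T2) (fun i j => tmap f g (u i j)).
Proof.
move=> tf fu gu up; have [F [Fin [_ Fp]]] := tf _ _ _ _ _ _ fu gu.
apply/(@fpos_compl (alg_tensor t T1 T2)).
have := fpos_cp Fp (proj2 (@fpos_compl (alg_tensor t S1 S2) _ _) up).
by apply: eq_fpos => i j; rewrite Fin.
Qed.

Lemma lifts_coe_fpos (S T : opsys R) (f : {linear S -> T}) (I : finType) (u : I -> I -> S) :
  lifts (@complete_order_embedding R) f -> fpos u <-> fpos (fun i j => f (u i j)).
Proof.
move=> [F [Fin Fp]]; rewrite -(fpos_compl u) (fpos_coe _ Fp) -(fpos_compl (fun i j => f (u i j))).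
by split; apply: eq_fpos => i j; rewrite Fin.
Qed.

Lemma cp_id_uniq (S : opsys R) (F : {linear compl S -> compl S}) : cp F ->
  (forall s, F (compl_in S s) = compl_in S s) -> forall x, F x = x.
Proof.
move=> Fp Fs; apply: (cp_uniq (repP S) (F := F) (G := idfun) Fp) => //.
by move=> n u; rewrite (_ : map_mx _ u = u)//; apply/matrixP => i j; rewrite mxE.
Qed.

(** For the converse, the identity is completely positive in both directions before completion; the
    two extensions are mutually inverse because completely positive maps agreeing on a dense
    subspace agree. *)
Lemma nuclearP (t' t : os_tensor_product R) (S : opsys R) : tensor_le t' t ->
  nuclear t' t S <-> pnuc t' t S.
Proof.
move=> tt'; split=> [nS T I u|nS T].
  have [F [Fin [Fcoe _]]] := nS T.
  exact: (proj2 (@lifts_coe_fpos _ _ (alg_tensor_id t t' S T) _ _ (ex_intro _ F (conj Fin Fcoe)))).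
have idp : cp (alg_tensor_id t t' S T).
  by apply: fpos_cpP => I u; exact: tensor_le_fpos.
have idp' : cp (alg_tensor_id t' t S T).
  by apply: fpos_cpP => I u; exact: nS.
have [F [Fin Fp]] := lifts_cp idp; have [G [Gin Gp]] := lifts_cp idp'.
have GF x : G (F x) = x.
  apply: (cp_id_uniq (F := G \o F : {linear _ -> _})); first exact: cp_comp Fp Gp.
  by move=> s; rewrite /= Fin Gin.
have FG x : F (G x) = x.
  apply: (cp_id_uniq (F := F \o G : {linear _ -> _})); first exact: cp_comp Gp Fp.
  by move=> s; rewrite /= Gin Fin.
exists F; split; first exact: Fin.
split; last by move=> w; exists (G w); exact: FG.
split=> [x y /(congr1 G)|n u]; first by rewrite !GF.
split=> [/Fp//|/Gp]; congr (mpos _ n _).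
by apply/matrixP => i j; rewrite !mxE GF.
Qed.

End ClosureOpsys.

(** * Direct sums of Hilbert spaces and matrix algebras *)

Section ComplexLine.
Variable R : realType.

Definition cline : Type := R[i]^o.
HB.instance Definition _ := NormedModule.copy cline R[i]^o.

(** Real and imaginary part are 1-Lipschitz, which reduces the claim to completeness of [R]. *)
Lemma cline_complete (F : set_system cline) : ProperFilter F -> cauchy F -> cvg F.
Proof.
move=> FF /cauchyP Fc.
have part (f : R[i] -> R) (fl : forall z w, `|f z - f w|%:C%C <= `|z - w|) :
    exists l, forall e : R, 0 < e -> \forall z \near F, `|l - f z| < e.
  have : cauchy ((f : cline -> R) @ F).
    apply/cauchyP => e e0; have [|x Fx] := Fc (e%:C%C); first by rewrite ltcR.
    exists (f x); suff : F (f @^-1` ball (f x) e) by [].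
    apply: filterS Fx => z; rewrite /preimage -!ball_normE /= => xz.
    have xz' : `|(x : R[i]) - z| < e%:C%C by exact: xz.
    by have := le_lt_trans (fl x z) xz'; rewrite ltcR.
  move=> /cauchy_cvg /cvg_ex[l /cvgrPdist_lt fl']; exists l => e /fl'.
  exact.
have [a aP] : exists l, forall e : R, 0 < e -> \forall z \near F, `|l - complex.Re z| < e.
  apply: part => z w; rewrite -ReB; exact: normc_ge_Re.
have [b bP] : exists l, forall e : R, 0 < e -> \forall z \near F, `|l - complex.Im z| < e.
  apply: part => z w.
  rewrite (_ : complex.Im z - complex.Im w = complex.Re (- 'i%C * (z - w))); last first.
    by case: z w => [x y] [x' y'] /=; ring.
  rewrite (le_trans (normc_ge_Re _))// normrM normrN.
  by rewrite [`|'i%C|](_ : _ = 1) ?mul1r// normc_def /= expr0n expr1n add0r sqrtr1.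
apply/cvg_ex; exists (Complex a b : cline); apply/cvgrPdist_lt => e e0.
have eR := ge0_real (ltW e0); have e1 : 0 < complex.Re e / 2 by rewrite divr_gt0// -ltcR -eR.
apply: filterS2 (aP _ e1) (bP _ e1) => z za zb.
have -> : (Complex a b : cline) - z = (a - complex.Re z)%:C%C + 'i%C * (b - complex.Im z)%:C%C.
  by case: z {za zb} => x y; apply/eqP; rewrite eq_complex /=; apply/andP; split; apply/eqP; ring.
have nR (s : R) : `|s%:C%C : R[i]| = `|s|%:C%C.
  case: (lerP 0 s) => h; first by rewrite !ger0_norm ?lecR.
  by rewrite !ltr0_norm ?ltcR// rmorphN.
rewrite (le_lt_trans (ler_normD _ _))// normrM !nR.
rewrite [`|'i%C|](_ : _ = 1) ?mul1r; last by rewrite normc_def /= expr0n expr1n add0r sqrtr1.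
by rewrite eR -rmorphD ltcR [ltRHS]splitr ltrD.
Qed.

HB.instance Definition _ := Uniform_isComplete.Build cline cline_complete.

End ComplexLine.

Section MakeHilbert.
Variables (R : realType) (V : completeNormedModType R[i]) (ip : V -> V -> R[i]).
Hypothesis ip_lin : forall a x y z, ip (a *: x + y) z = a * ip x z + ip y z.
Hypothesis ip_herm : forall x y, ip x y = Num.conj (ip y x).
Hypothesis ip_norm : forall x, ip x x = `|x| ^+ 2.

Lemma make_bilinear : bilinear_for (GRing.Scale.Law.clone R[i] R[i] *%R _)
  (GRing.Scale.Law.clone R[i] R[i] (Num.conj \; *%R) _) ip.
Proof.
split=> [z|z] a x y; first exact: ip_lin.
by rewrite /applyr ip_herm ip_lin rmorphD rmorphM /= -!ip_herm.
Qed.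

Lemma make_herm x y : ip x y = (-1) ^+ false * Num.conj (ip y x).
Proof. by rewrite expr0 mul1r ip_herm. Qed.

Lemma make_dot x : x != 0 -> 0 < ip x x.
Proof. by move=> x0; rewrite ip_norm exprn_gt0// normr_gt0. Qed.

Definition make_hilbert : hilbert R :=
  @Hilbert R V (HB.pack_for {dot V for Num.conj} ip
    (bilinear_isBilinear.Build R[i] V V R[i] _ _ ip make_bilinear)
    (isHermitianSesquilinear.Build R[i] V false Num.conj ip make_herm)
    (isDotProduct.Build R[i] V ip make_dot)) ip_norm.

End MakeHilbert.

Section HilbertSum.
Variables (R : realType) (H : hilbert R) (k : nat).

(** A name of its own lets the function space carry the Euclidean norm needed for an inner
    product. *)
Definition hsum : Type := 'I_k -> H.
HB.instance Definition _ := GRing.Lmodule.copy hsum ('I_k -> H).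

Definition hsum_norm (x : hsum) : R[i] := (Num.sqrt (\sum_i nr (x i) ^+ 2))%:C%C.

Lemma sum_sqr_ge0 (a : 'I_k -> R) : 0 <= \sum_i a i ^+ 2.
Proof. by apply: sumr_ge0 => i _; exact: sqr_ge0. Qed.

Lemma cauchy_schwarz_sum (a b : 'I_k -> R) :
  \sum_i a i * b i <= Num.sqrt (\sum_i a i ^+ 2) * Num.sqrt (\sum_i b i ^+ 2).
Proof.
set A := Num.sqrt _; set B := Num.sqrt _.
have A2 : A ^+ 2 = \sum_i a i ^+ 2 by rewrite sqr_sqrtr// sum_sqr_ge0.
have B2 : B ^+ 2 = \sum_i b i ^+ 2 by rewrite sqr_sqrtr// sum_sqr_ge0.
have A0 : 0 <= A by exact: sqrtr_ge0.
have B0 : 0 <= B by exact: sqrtr_ge0.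
have key : 2 * (A * B) * (\sum_i a i * b i) <= 2 * (A * B) * (A * B).
  have -> : 2 * (A * B) * (\sum_i a i * b i) = \sum_i 2 * (A * b i) * (B * a i).
    by rewrite mulr_sumr; apply: eq_bigr => i _; ring.
  have -> : 2 * (A * B) * (A * B) = \sum_i (A ^+ 2 * b i ^+ 2 + B ^+ 2 * a i ^+ 2).
    by rewrite big_split /= -!mulr_sumr -A2 -B2; ring.
  by apply: ler_sum => i _; have := sqr_ge0 (A * b i - B * a i); nra.
have [AB0|AB0] := eqVneq (A * B) 0; last first.
  rewrite -(ler_pM2l (x := 2 * (A * B)))// mulr_gt0// lt_neqAle eq_sym AB0 mulr_ge0//.
rewrite AB0 big1// => i _; move/eqP: AB0; rewrite mulf_eq0 => /orP[]/eqP e0.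
- suff -> : a i = 0 by rewrite mul0r.
  apply/eqP; rewrite -sqrf_eq0; apply/eqP; move: A2; rewrite e0 expr0n /= => /esym/eqP.
  by rewrite psumr_eq0 => [/allP/(_ i (mem_index_enum _))/eqP//|j _]; exact: sqr_ge0.
- suff -> : b i = 0 by rewrite mulr0.
  apply/eqP; rewrite -sqrf_eq0; apply/eqP; move: B2; rewrite e0 expr0n /= => /esym/eqP.
  by rewrite psumr_eq0 => [/allP/(_ i (mem_index_enum _))/eqP//|j _]; exact: sqr_ge0.
Qed.

Lemma hsum_normD (x y : hsum) : hsum_norm (x + y) <= hsum_norm x + hsum_norm y.
Proof.
rewrite /hsum_norm -rmorphD lecR.
apply: sqrt_le; first by rewrite addr_ge0 ?sqrtr_ge0.
rewrite sqrrD !sqr_sqrtr ?sum_sqr_ge0//.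
apply: (@le_trans _ _ (\sum_i (nr (x i) ^+ 2 + 2 * (nr (x i) * nr (y i)) + nr (y i) ^+ 2))).
  apply: ler_sum => i _; have := nrD (x i) (y i); have := nr_ge0 (x i + y i).
  have := nr_ge0 (x i); have := nr_ge0 (y i); rewrite /=; nra.
rewrite !big_split /= lerD2r lerD2l -mulr_sumr -[leRHS]mulr_natl ler_pM2l//.
exact: cauchy_schwarz_sum.
Qed.

Lemma hsum_normZ (l : R[i]) (x : hsum) : hsum_norm (l *: x) = `|l| * hsum_norm x.
Proof.
rewrite (ge0_real (normr_ge0 l)) /hsum_norm -rmorphM; congr (_%:C%C).
under eq_bigr => i _ do rewrite (_ : (l *: x) i = l *: x i)// nrZ exprMn.
by rewrite -mulr_sumr sqrtrM ?sqr_ge0// sqrtr_sqr ger0_norm// Re_norm_ge0.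
Qed.

Lemma nr_le_hsum_norm (x : hsum) i : nr (x i) <= Num.sqrt (\sum_i nr (x i) ^+ 2).
Proof.
by apply: le_sqrt; rewrite (bigD1 i)//= lerDl sumr_ge0// => j _; exact: sqr_ge0.
Qed.

Lemma hsum_norm0 (x : hsum) : hsum_norm x = 0 -> x = 0.
Proof.
move=> /(congr1 (@complex.Re R)) /= h; apply/funext => i; apply: nr_eq0.
by rewrite -h; exact: nr_le_hsum_norm.
Qed.

HB.instance Definition _ :=
  Lmodule_isNormed.Build R[i] hsum hsum_normD hsum_normZ hsum_norm0.

Lemma hsum_complete (F : set_system hsum) : ProperFilter F -> cauchy F -> cvg F.
Proof.
move=> FF /cauchyP Fc.
have part i : exists l, forall e : R[i], 0 < e -> \forall x \near F, `|l - (x : hsum) i| < e.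
  have : cauchy ((fun x : hsum => x i) @ F).
    apply/cauchyP => e e0; have [x Fx] := Fc e e0.
    exists (x i); suff : F ((fun x : hsum => x i) @^-1` ball (x i) e) by [].
    apply: filterS Fx => y; rewrite /preimage -!ball_normE /=; apply: le_lt_trans.
    by rewrite nrE lecR; exact: (nr_le_hsum_norm (x - y)).
  by move=> /cauchy_cvg /cvg_ex[l /cvgrPdist_lt lP]; exists l => e /lP.
have [l lP] := choice part.
apply/cvg_ex; exists (l : hsum); apply/cvgrPdist_lt => e e0.
have eR := ge0_real (ltW e0); set e1 := complex.Re e in eR.
have e10 : 0 < e1 by rewrite -ltcR -eR.
have d0 : 0 < e1 / (k%:R + 1) by rewrite divr_gt0// ltr_wpDl.
have : \forall x \near F, forall i, `|l i - (x : hsum) i| < (e1 / (k%:R + 1))%:C%C.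
  by apply: filter_forall => i; apply: lP; rewrite ltcR.
apply: filterS => x xl; rewrite eR (_ : `|_| = hsum_norm ((l : hsum) - x))//.
rewrite /hsum_norm ltcR.
apply: (@le_lt_trans _ _ (e1 / (k%:R + 1) * k%:R)).
  apply: sqrt_le; first by rewrite mulr_ge0// ltW.
  apply: (@le_trans _ _ (\sum_(i < k) (e1 / (k%:R + 1)) ^+ 2)).
    apply: ler_sum => i _; rewrite ler_pXn2r ?nnegrE ?nr_ge0 ?(ltW d0)//.
    by rewrite -nr_ler ltW// xl.
  rewrite sumr_const card_ord -[leLHS]mulr_natr [leRHS]exprMn ler_wpM2l ?sqr_ge0//.
  by rewrite -natrX ler_nat; case: (k) => [//|m]; rewrite leq_pmulr.
rewrite mulrAC ltr_pdivrMr ?ltr_wpDl// ltr_pM2l// ltrDl//.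
Qed.

HB.instance Definition _ := Uniform_isComplete.Build hsum hsum_complete.

Definition hsum_ip (x y : hsum) : R[i] := \sum_i inner H (x i) (y i).

Lemma hsum_ip_lin a x y z : hsum_ip (a *: x + y) z = a * hsum_ip x z + hsum_ip y z.
Proof.
rewrite /hsum_ip mulr_sumr -big_split; apply: eq_bigr => i _ /=.
by rewrite -ipZl -ipDl.
Qed.

Lemma hsum_ip_herm x y : hsum_ip x y = Num.conj (hsum_ip y x).
Proof. by rewrite /hsum_ip rmorph_sum; apply: eq_bigr => i _; rewrite /= -ipC. Qed.

Lemma hsum_ip_norm (x : hsum) : hsum_ip x x = `|x| ^+ 2.
Proof.
rewrite (_ : `|x| = hsum_norm x)// /hsum_norm -rmorphXn sqr_sqrtr ?sum_sqr_ge0// rmorph_sum.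
by apply: eq_bigr => i _; rewrite inner_norm nrE rmorphXn.
Qed.

Definition hsumH : hilbert R := make_hilbert hsum_ip_lin hsum_ip_herm hsum_ip_norm.

Lemma hsum_ipE (x y : hsumH) : inner hsumH x y = \sum_i inner H ((x : hsum) i) ((y : hsum) i).
Proof. by []. Qed.

Lemma nr_hsum (x : hsumH) : nr x ^+ 2 = \sum_i nr ((x : hsum) i) ^+ 2.
Proof. by rewrite -Re_ip hsum_ipE Re_sum; apply: eq_bigr => i _; rewrite Re_ip. Qed.

End HilbertSum.

Section HilbertLine.
Variable R : realType.

Definition cline_ip (z w : cline R) : R[i] := (z : R[i]) * Num.conj (w : R[i]).

Lemma cline_ip_lin a x y z : cline_ip (a *: x + y) z = a * cline_ip x z + cline_ip y z.
Proof. by rewrite /cline_ip mulrDl mulrA. Qed.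
Lemma cline_ip_herm x y : cline_ip x y = Num.conj (cline_ip y x).
Proof.
have e (z w : R[i]) : z * Num.conj w = Num.conj (w * Num.conj z).
  by rewrite rmorphM /= conjCK mulrC.
exact: e.
Qed.
Lemma cline_ip_norm (x : cline R) : cline_ip x x = `|x| ^+ 2.
Proof. by rewrite /cline_ip -normCK. Qed.

Definition clineH : hilbert R := make_hilbert cline_ip_lin cline_ip_herm cline_ip_norm.

End HilbertLine.

Section OpMatrix.
Variables (R : realType) (H : hilbert R) (k : nat) (b : 'I_k -> 'I_k -> bop H H).

Definition opmx_fun (x : hsumH H k) : hsumH H k :=
  (fun i => \sum_j b i j ((x : hsum H k) j)) : hsum H k.

Lemma opmx_bounded : opmx_fun \in bounded_linear (hsumH H k) (hsumH H k).
Proof.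
apply/asboolP; split=> [a x y|].
  apply/funext => i; rewrite /opmx_fun /= -[RHS]/(a *: (\sum_j b i j ((x : hsum H k) j)) + \sum_j b i j ((y : hsum H k) j)).
  rewrite scaler_sumr -big_split; apply: eq_bigr => j _ /=.
  by rewrite -bopZ -bopD.
have /choice[M MP] (ij : 'I_k * 'I_k) : exists M, 0 <= M /\ obd (b ij.1 ij.2) M.
  by have [M M0 bM] := bop_bnd (b ij.1 ij.2); exists M.
pose B := \sum_i \sum_j M (i, j).
have B0 : 0 <= B by apply: sumr_ge0 => i _; apply: sumr_ge0 => j _; case: (MP (i, j)).
exists (B * k%:R)%:C%C => [|x]; first by rewrite lecR mulr_ge0.
rewrite !nrE -rmorphM lecR.
rewrite -(ler_pXn2r (n := 2)) ?nnegrE ?mulr_ge0 ?nr_ge0//.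
rewrite nr_hsum.
apply: (@le_trans _ _ (\sum_(i < k) (B * nr x) ^+ 2)).
  apply: ler_sum => i _; rewrite ler_pXn2r ?nnegrE ?mulr_ge0 ?nr_ge0//.
  have h1 : nr (opmx_fun x i) <= \sum_j M (i, j) * nr x.
    rewrite /opmx_fun; elim/big_rec2: _ => [|j u v _ uv]; first by rewrite nr0.
    rewrite (le_trans (nrD _ _))// lerD//; have [M0 Mb] := MP (i, j).
    rewrite (le_trans (Mb _))// ler_wpM2l//.
    exact: (nr_le_hsum_norm (x : hsum H k) j).
  rewrite (le_trans h1)// -mulr_suml ler_wpM2r ?nr_ge0// /B [leRHS](bigD1 i)//= lerDl.
  by apply: sumr_ge0 => l _; apply: sumr_ge0 => j _; case: (MP (l, j)).
rewrite sumr_const card_ord -[leLHS]mulr_natr [in leRHS]mulrAC [in leRHS]exprMn ler_wpM2l ?sqr_ge0//.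
by rewrite -natrX ler_nat; case: (k) => [//|m]; rewrite leq_pmulr.
Qed.

Definition opmx : bop (hsumH H k) (hsumH H k) := Bop opmx_bounded.

Lemma opmxE (x : hsumH H k) i : (opmx x : hsum H k) i = \sum_j b i j ((x : hsum H k) j).
Proof. by []. Qed.

Lemma opmx_ip (x y : hsumH H k) :
  inner (hsumH H k) (opmx x) y = \sum_i \sum_j inner H (b i j ((x : hsum H k) j)) ((y : hsum H k) i).
Proof. by rewrite hsum_ipE; apply: eq_bigr => i _; rewrite opmxE ip_suml. Qed.

End OpMatrix.

Section MatrixAlgebra.
Variables (R : realType) (k : nat).

Lemma mxformE (v w : 'cV[R[i]]_k) (A : 'M[R[i]]_k) :
  (map_mx Num.conj v^T *m A *m w) 0 0 = \sum_a \sum_b A a b * w b 0 * Num.conj (v a 0).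
Proof.
rewrite mxE exchange_big; apply: eq_bigr => b _; rewrite mxE mulr_suml.
by apply: eq_bigr => a _; rewrite !mxE; ring.
Qed.

Lemma fposMk (I : finType) (u : I -> I -> 'M[R[i]]_k) :
  fpos (V := Mk R k) u <-> forall v : I -> 'cV[R[i]]_k,
    0 <= \sum_i \sum_j (map_mx Num.conj (v i)^T *m u i j *m v j) 0 0.
Proof.
split=> up v.
  have := up (v \o enum_val); congr (_ <= _).
  rewrite [RHS]sum_enum_val; apply: eq_bigr => i _; rewrite [RHS]sum_enum_val.
  by apply: eq_bigr => j _; congr ((_ *m _ *m _) _ _); rewrite mxE.
have := up (fun i => v (enum_rank i)); congr (_ <= _).
rewrite sum_enum_val; apply: eq_bigr => i _; rewrite sum_enum_val.
by apply: eq_bigr => j _; rewrite !enum_valK; congr ((_ *m _ *m _) _ _); rewrite mxE.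
Qed.

Lemma sum_mul_delta (y : 'I_k -> R[i]) j :
  \sum_l y l * (if l == j then (1 : R[i]) else 0) = y j.
Proof.
rewrite (bigD1 j)//= eqxx mulr1 big1 ?addr0// => l /negPf lj.
by rewrite lj mulr0.
Qed.

Let Hk := hsumH (clineH R) k.

Definition mk_fun (A : 'M[R[i]]_k) : BH Hk :=
  opmx (fun i j => A i j *: bop_id (clineH R)).

Lemma mk_fun_linear : linear (mk_fun : Mk R k -> BH Hk).
Proof.
move=> a A B; apply: bopP => x; apply/funext => i.
have e (y : 'I_k -> R[i]) : \sum_j (a *: A + B) i j * y j
    = a * (\sum_j A i j * y j) + \sum_j B i j * y j.
  rewrite mulr_sumr -big_split; apply: eq_bigr => j _.
  by rewrite !mxE mulrDl mulrA.
exact: (e (x : 'I_k -> R[i])).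
Qed.

Definition mk_rep : {linear Mk R k -> BH Hk} :=
  HB.pack_for {linear Mk R k -> BH Hk} (mk_fun : Mk R k -> BH Hk)
    (GRing.isLinear.Build _ _ _ _ (mk_fun : Mk R k -> BH Hk) mk_fun_linear).

Lemma mk_rep_ip A (x y : Hk) : inner Hk ((mk_rep A : bop Hk Hk) x) y =
  \sum_a \sum_b A a b * ((x : hsum (clineH R) k) b : R[i]) *
     Num.conj ((y : hsum (clineH R) k) a : R[i]).
Proof.
have e (z w : 'I_k -> R[i]) : \sum_a (\sum_b A a b * z b) * Num.conj (w a)
    = \sum_a \sum_b A a b * z b * Num.conj (w a).
  by apply: eq_bigr => a _; rewrite mulr_suml.
exact: (e (x : 'I_k -> R[i]) (y : 'I_k -> R[i])).
Qed.

(** The definitions know [Mk] as a bare matrix order; as an operator system it can be a factor of a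
    tensor product. *)
Lemma Mk_is_opsys : is_opsys (Mk R k).
Proof.
exists Hk, mk_rep; split.
- apply: bopP => x; apply/funext => i.
  have e (y : 'I_k -> R[i]) : \sum_j (1%:M : 'M[R[i]]_k) i j * y j = y i.
    rewrite (bigD1 i)//= big1 ?addr0; first by rewrite mxE eqxx mul1r.
    by move=> j /negPf ji; rewrite mxE eq_sym ji mul0r.
  exact: (e (x : 'I_k -> R[i])).
- split=> [A B AB|n u].
    apply/matrixP => i j.
    pose x : Hk := (fun l : 'I_k => if l == j then (1 : R[i]) else 0) : hsum (clineH R) k.
    have d (C : 'M[R[i]]_k) : (mk_rep C : bop Hk Hk) x i = C i j.
      exact: (sum_mul_delta (C i) j).
    by rewrite -!d AB.
  split=> up h.
    have := up (fun i => \col_a ((h i : hsum (clineH R) k) a : R[i])); congr (_ <= _).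
    apply: eq_bigr => i _; apply: eq_bigr => j _; rewrite mxformE mxE mk_rep_ip.
    by apply: eq_bigr => a _; apply: eq_bigr => b _; rewrite !mxE.
  have := up (fun i => (fun a => h i a 0) : hsum (clineH R) k); congr (_ <= _).
  apply: eq_bigr => i _; apply: eq_bigr => j _.
  by rewrite mxformE mxE mk_rep_ip.
- move=> _ [A _ <-]; exists (mk_rep (map_mx Num.conj A^T)); first by exists (map_mx Num.conj A^T).
  move=> x y; rewrite [RHS]ipC !mk_rep_ip exchange_big rmorph_sum; apply: eq_bigr => b _.
  rewrite rmorph_sum; apply: eq_bigr => a _.
  by rewrite !mxE !rmorphM /= !conjCK mulrAC.
Qed.

Definition MkO : opsys R := OpSys Mk_is_opsys.

Lemma fpos_delta (I : finType) (a : I -> 'I_k) :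
  fpos (V := MkO) (fun i j => delta_mx (a i) (a j) : 'M[R[i]]_k).
Proof.
apply/fposMk => v.
rewrite (_ : \sum_i _ = (\sum_j v j (a j) 0) * Num.conj (\sum_j v j (a j) 0)) ?mul_conjC_ge0//.
rewrite rmorph_sum mulr_sumr; apply: eq_bigr => i _; rewrite mulr_suml; apply: eq_bigr => j _.
rewrite mxformE (bigD1 (a i))//= [X in _ + X]big1 ?addr0; last first.
  by move=> p /negPf pi; rewrite big1// => q _; rewrite mxE pi !mul0r.
rewrite (bigD1 (a j))//= big1 ?addr0; first by rewrite mxE !eqxx mul1r.
by move=> q /negPf qj; rewrite mxE qj andbF !mul0r.
Qed.

End MatrixAlgebra.

Section Orthonormal.
Variables (R : realType) (H : hilbert R).

Lemma orthonormal_seq (s : seq H) : exists (D : finType) (e : D -> H),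
  (forall a b, inner H (e a) (e b) = (a == b)%:R) /\
  (forall x, x \in s -> exists xi : D -> R[i], x = \sum_b xi b *: e b).
Proof.
elim: s => [|x s [D [e [eo es]]]].
  by exists void, (of_void H); split=> [[]|].
pose y := x - \sum_b inner H x (e b) *: e b.
have ye b : inner H y (e b) = 0.
  rewrite /y ipBl ip_suml (bigD1 b)//= big1 ?addr0; last first.
    by move=> c /negPf cb; rewrite ipZl eo cb mulr0.
  by rewrite ipZl eo eqxx mulr1 subrr.
have xE : x = y + \sum_b inner H x (e b) *: e b by rewrite subrK.
have [y0|y0] := eqVneq y 0.
  exists D, e; split=> // z; rewrite inE => /orP[/eqP ->|/es//].
  by exists (fun b => inner H x (e b)); rewrite {1}xE y0 add0r.
have ny : `|y| != 0 by rewrite normr_eq0.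
have nyc : Num.conj `|y|^-1 = `|y|^-1 by apply/CrealP; rewrite rpredV normr_real.
exists (option D), (fun o => if o is Some b then e b else `|y|^-1 *: y); split.
  case=> [a|] [b|]; rewrite ?ipZl ?ipZr ?ye ?mulr0 ?eo//.
    by rewrite ipC ye rmorph0 mulr0.
  by rewrite inner_norm nyc expr2 mulKf// mulVf.
have big_opt (F : option D -> H) : \sum_o F o = F None + \sum_b F (Some b).
  rewrite (bigD1 None)//=; congr (_ + _).
  rewrite (reindex_omap Some id) /=; last by case.
  by apply: eq_bigl => b; rewrite eqxx.
move=> z; rewrite inE => /orP[/eqP ->|/es [xi ->]].
  exists (fun o => if o is Some b then inner H x (e b) else `|y|).
  by rewrite big_opt scalerA mulfV// scale1r.
by exists (fun o => if o is Some b then xi b else 0); rewrite big_opt scale0r add0r.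
Qed.

(** Orthonormality makes the compression to the span of the [h i] a unital map into matrices, as
    [tpos_kron] requires. *)
Lemma orthonormal_span (I : finType) (h : I -> H) : exists (d : nat) (e : 'I_d -> H) (xi : I -> 'I_d -> R[i]),
  (forall a b, inner H (e a) (e b) = (a == b)%:R) /\
  (forall i, h i = \sum_b xi i b *: e b).
Proof.
have [D [e [eo es]]] := orthonormal_seq [seq h i | i <- enum I].
have /choice[xi xiP] i : exists xi : D -> R[i], h i = \sum_b xi b *: e b.
  by apply: es; apply/mapP; exists i; rewrite ?mem_enum.
exists #|D|, (e \o enum_val), (fun i b => xi i (enum_val b)); split=> [a b|i].
  by rewrite /= eo (inj_eq enum_val_inj).
by rewrite xiP sum_enum_val.
Qed.

End Orthonormal.

Section TensorCoefficients.
Variable R : realType.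

Lemma tensor_lin_ext (U V W : lmodType R[i]) (f g : {linear U ⊙ V -> W}) :
  (forall x y, f (x ⊗ y) = g (x ⊗ y)) -> forall u, f u = g u.
Proof.
move=> fg u; have [s ->] := tensorP u; rewrite !linear_sum; exact: eq_bigr.
Qed.

Section Coef.
Variables (k : nat) (W : lmodType R[i]).

Definition coef_bil (p q : 'I_k) (A : 'M[R[i]]_k) (w : W) : W := A p q *: w.

Lemma coef_bilinear p q : bilinear_for
  (GRing.Scale.Law.clone R[i] W *:%R _) (GRing.Scale.Law.clone R[i] W *:%R _)
  (coef_bil p q).
Proof.
split=> [w|A] a x y; rewrite /coef_bil /applyr.
- by rewrite !mxE scalerDl -scalerA.
- by rewrite /= scalerDr !scalerA mulrC.
Qed.

HB.instance Definition _ p q := bilinear_isBilinear.Build R[i] _ W W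
  _ _ (coef_bil p q) (coef_bilinear p q).

(** The slice map by the matrix-entry functional at (p, q). *)
Definition coef p q : {linear ('M[R[i]]_k : lmodType R[i]) ⊙ W -> W} := tlift (coef_bil p q).

Lemma coef_pure p q A w : coef p q (A ⊗ w) = A p q *: w.
Proof. exact: (tlift_pure (coef_bil p q) A w). Qed.

Lemma coefK (X : ('M[R[i]]_k : lmodType R[i]) ⊙ W) :
  X = \sum_p \sum_q delta_mx p q ⊗ coef p q X.
Proof.
have [s ->] := tensorP X.
under [RHS]eq_bigr => p _ do under eq_bigr => q _ do rewrite linear_sum linear_sumr.
under [RHS]eq_bigr => p _ do rewrite exchange_big.
rewrite exchange_big; apply: eq_bigr => x _ /=.
rewrite {1}(matrix_sum_delta x.1) linear_sumlz; apply: eq_bigr => p _.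
rewrite linear_sumlz; apply: eq_bigr => q _.
by rewrite coef_pure linearZl_LR linearZr_LR.
Qed.

End Coef.
End TensorCoefficients.

(** * Matricial families of completely positive maps *)

Section MatricialMaps.
Variable R : realType.

(* [phi] is completely positive as a map from [V] to the k-by-k matrices over
   [W]; equivalently, so is [x |-> \sum_p \sum_q phi p q (x p q)] on the k-by-k
   matrices over [V]. *)
Definition mcp (V W : matord R) k (phi : 'I_k -> 'I_k -> {linear V -> W}) : Prop :=
  forall (I : finType) (u : I -> I -> V) (a : I -> 'I_k),
    fpos u -> fpos (fun i j => phi (a i) (a j) (u i j)).

Lemma sum_fst (V : nmodType) (I J : finType) (F : I * J -> V) i :
  \sum_(x | x.1 == i) F x = \sum_p F (i, p).
Proof.
rewrite (eq_bigl (fun x : I * J => (x.1 == i) && xpredT x.2)); last first.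
  by move=> x; rewrite andbT.
rewrite (eq_bigr (fun x => F (x.1, x.2))); last by case.
by rewrite -(pair_big (fun x => x == i) xpredT (fun x y => F (x, y))) big_pred1_eq.
Qed.

Lemma fpos_push_fst (S : opsys R) (I J : finType) (u : I * J -> I * J -> S) :
  fpos u -> fpos (fun i j => \sum_p \sum_q u (i, p) (j, q)).
Proof.
move=> /(fpos_push (fun x => x.1)); apply: eq_fpos => i j.
by rewrite sum_fst; apply: eq_bigr => p _; rewrite sum_fst.
Qed.

(** Each index is repeated k times, so that [phi] and then [psi] act entrywise on a larger positive
    matrix; adding up its blocks is again positive. *)
Lemma mcp_comp (S T W : opsys R) k (phi : 'I_k -> 'I_k -> {linear S -> T})
    (psi : 'I_k -> 'I_k -> {linear T -> W}) (I : finType) (u : I -> I -> S) :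
  mcp phi -> mcp psi -> fpos u ->
  fpos (fun i j => \sum_p \sum_q psi p q (phi p q (u i j))).
Proof.
move=> ph ps /(fpos_sel (fun x : I * 'I_k => x.1)).
by move=> /(ph _ _ (fun x => x.2)) /(ps _ _ (fun x => x.2)) /fpos_push_fst.
Qed.

Lemma mcp_cp (S T : opsys R) (f : {linear S -> T}) : cp f ->
  mcp (fun _ _ : 'I_1 => f).
Proof. by move=> fp I u a; exact: fpos_cp. Qed.

Section Coefficients.
Variables (k : nat) (t : os_tensor_product R) (W : opsys R).

(** The axioms of a tensor product control it from above only by unital maps into matrix algebras.
    Compressing [rep W] to the span of the finitely many test vectors provides such a map, to be
    paired with the identity of M_k. *)
Lemma coef_mcp : mcp (V := alg_tensor t (MkO R k) W) (W := W) (fun p q => coef _ p q).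
Proof.
move=> I X a Xp; apply/fposE => h; set K := rep_space W in h *.
have [d [e [xi [eo hE]]]] := orthonormal_span h.
pose g (w : W) : Mk R d := \matrix_(b, c) inner K ((rep W w : bop K K) (e c)) (e b).
have glin : linear g.
  by move=> s x y; apply/matrixP => b c; rewrite !mxE linearP /= ipDl ipZl.
pose g' : {linear W -> Mk R d} := HB.pack_for {linear W -> Mk R d} g
  (GRing.isLinear.Build _ _ _ _ g glin).
have gucp : ucp g'.
  split; first by apply/matrixP => b c; rewrite !mxE rep_unit /= eo eq_sym.
  move=> n u /fpos_ord /fposE up v.
  have := up (fun i => \sum_b v i b 0 *: e b); congr (_ <= _).
  apply: eq_bigr => i _; apply: eq_bigr => j _; rewrite mxformE bop_sum ip_suml exchange_big.
  apply: eq_bigr => c _; rewrite ip_sumr; apply: eq_bigr => b _.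
  by rewrite !mxE bopZ ipZl ipZr; ring.
have iducp : ucp (idfun : {linear MkO R k -> Mk R k}).
  by split=> // n u; rewrite (_ : map_mx _ u = u)//; apply/matrixP => i j; rewrite mxE.
have [_ kp] := tpos_kron t iducp gucp.
(* In C^k ⊗ C^d this is the basis vector at [a i] tensored with the coordinates of [h i]; the scalar
   form at [v] is then the form of the coefficients at [h]. *)
pose v i : 'cV[R[i]]_(k * d) :=
  \col_x ((((mxtens_unindex x).1 == a i)%:R : R[i]) * xi i (mxtens_unindex x).2).
have vE i p b : v i (mxtens_index (p, b)) 0 = (p == a i)%:R * xi i b.
  by rewrite mxE mxtens_indexK.
have := proj1 (fposMk _) (fpos_cp kp Xp) v.
congr (_ <= _); apply: eq_bigr => i _; apply: eq_bigr => j _.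
have E p q b c u : tlift (kron (idfun : {linear MkO R k -> Mk R k}) g') u
    (mxtens_index (p, b)) (mxtens_index (q, c)) = inner K ((rep W (coef _ p q u) : bop K K) (e c)) (e b).
  have [s ->] := tensorP u; rewrite [tlift _ _]linear_sum summxE.
  rewrite [coef _ _ _ _]linear_sum [rep W _]linear_sum bop_sumE ip_suml.
  apply: eq_bigr => x _; rewrite /= (tlift_pure (kron (idfun : {linear MkO R k -> Mk R k}) g')) coef_pure [rep W _]linearZ ipZl.
  apply: (etrans (tensmxE _ _ _ _ _ _)).
  by congr (_ * _); rewrite mxE.
have sum_mx (V : nmodType) (F : 'I_(k * d) -> V) :
    \sum_x F x = \sum_p \sum_b F (mxtens_index (p, b)).
  rewrite pair_bigA (reindex (@mxtens_index k d)) /=; last first.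
    exists (@mxtens_unindex k d) => x _; [exact: mxtens_indexK|exact: mxtens_unindexK].
  by apply: eq_bigr => -[].
rewrite mxformE sum_mx (bigD1 (a i))//= [X in _ + X]big1 ?addr0; last first.
  move=> p /negPf pi; rewrite big1// => b _; rewrite big1// => y _.
  by rewrite [v i _ _]vE pi mul0r rmorph0 mulr0.
rewrite [in RHS](hE i) ip_sumr; apply: eq_bigr => b _.
rewrite sum_mx (bigD1 (a j))//= [X in _ + X]big1 ?addr0; last first.
  move=> p /negPf pi; rewrite big1// => c _.
  by rewrite [v j _ _]vE pi mul0r mulr0 mul0r.
rewrite [in RHS](hE j) bop_sum ip_suml; apply: eq_bigr => c _.
by rewrite E !vE !eqxx !mul1r bopZ ipZl ipZr; ring.
Qed.

Section Sum.
Variables (S : opsys R) (phi : 'I_k -> 'I_k -> {linear S -> W}).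

(** Packs the family into a single map with values in M_k ⊗ W, so that functoriality, which knows
    nothing of families, applies to it. *)
Definition mxmap_fun (x : S) : alg_tensor t (MkO R k) W :=
  \sum_p \sum_q (delta_mx p q : MkO R k) ⊗ phi p q x.

Lemma mxmap_linear : linear mxmap_fun.
Proof.
move=> a x y; rewrite /mxmap_fun scaler_sumr -big_split; apply: eq_bigr => p _.
rewrite scaler_sumr -big_split; apply: eq_bigr => q _.
by rewrite linearP linearPr.
Qed.

Definition mxmap : {linear S -> alg_tensor t (MkO R k) W} :=
  HB.pack_for {linear S -> alg_tensor t (MkO R k) W} mxmap_fun
    (GRing.isLinear.Build _ _ _ _ mxmap_fun mxmap_linear).

Lemma mxmapE x : mxmap x = \sum_p \sum_q (delta_mx p q : MkO R k) ⊗ phi p q x.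
Proof. by []. Qed.

Lemma coef_mxmap p q x : coef _ p q (mxmap x) = phi p q x.
Proof.
rewrite mxmapE linear_sum (bigD1 p)//= [X in _ + X]big1 ?addr0; last first.
  move=> i /negPf ip; rewrite linear_sum big1// => j _.
  by rewrite coef_pure mxE eq_sym ip scale0r.
rewrite linear_sum (bigD1 q)//= big1 ?addr0; first by rewrite coef_pure mxE !eqxx scale1r.
by move=> j /negPf jq; rewrite coef_pure mxE [q == j]eq_sym jq andbF scale0r.
Qed.

Lemma mxmap_cp : mcp phi -> cp mxmap.
Proof.
move=> ph; apply: fpos_cpP => I u /(fpos_sel (fun x : I * 'I_k => x.1)).
move=> /(ph _ _ (fun x => x.2)) up.
have := fpos_push_fst (fpos_schur t (fpos_delta (fun x : I * 'I_k => x.2)) up).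
exact: eq_fpos.
Qed.

Lemma mxmap_unital : (forall p q, phi p q (munit S) = (p == q)%:R *: munit W) -> unital mxmap.
Proof.
move=> phu; rewrite /unital mxmapE /=.
have -> : (1%:M : 'M[R[i]]_k) = \sum_p delta_mx p p.
  rewrite {1}(matrix_sum_delta 1%:M); apply: eq_bigr => p _.
  rewrite (bigD1 p)//= big1 ?addr0; first by rewrite mxE eqxx scale1r.
  by move=> q /negPf qp; rewrite mxE eq_sym qp scale0r.
rewrite linear_sumlz; apply: eq_bigr => p _; rewrite (bigD1 p)//= big1 ?addr0.
  by rewrite phu eqxx scale1r.
by move=> q /negPf qp; rewrite phu eq_sym qp scale0r linear0r.
Qed.

End Sum.

(** Every tensor product with M_k carries the order of k-by-k matrices: one direction is [coef_mcp],
    the other Schur multiplication by matrix units. *)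
Lemma fpos_coef (I : finType) (X : I -> I -> alg_tensor t (MkO R k) W) :
  fpos X <-> fpos (fun x y : I * 'I_k => coef _ x.2 y.2 (X x.1 y.1)).
Proof.
split=> [/(fpos_sel (fun x : I * 'I_k => x.1))/coef_mcp|Xp]; first exact.
have := fpos_push_fst (fpos_schur t (fpos_delta (fun x : I * 'I_k => x.2)) Xp).
by apply: eq_fpos => i j; rewrite /= -coefK.
Qed.

End Coefficients.

Section RowMap.
Variables (k : nat) (t : os_tensor_product R) (T S : opsys R).
Variable psi : 'I_k -> 'I_k -> {linear T -> S}.

Definition rowmap_fun (X : alg_tensor t (MkO R k) T) : S :=
  \sum_p \sum_q psi p q (coef _ p q X).

Lemma rowmap_linear : linear rowmap_fun.
Proof.
move=> a x y; rewrite /rowmap_fun scaler_sumr -big_split; apply: eq_bigr => p _.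
rewrite scaler_sumr -big_split; apply: eq_bigr => q _.
by rewrite !linearP.
Qed.

Definition rowmap : {linear alg_tensor t (MkO R k) T -> S} :=
  HB.pack_for {linear alg_tensor t (MkO R k) T -> S} rowmap_fun
    (GRing.isLinear.Build _ _ _ _ rowmap_fun rowmap_linear).

Lemma rowmapE X : rowmap X = \sum_p \sum_q psi p q (coef _ p q X).
Proof. by []. Qed.

Lemma rowmap_delta p q y : rowmap ((delta_mx p q : MkO R k) ⊗ y) = psi p q y.
Proof.
rewrite rowmapE (bigD1 p)//= [X in _ + X]big1 ?addr0; last first.
  move=> i /negPf ip; rewrite big1// => j _.
  by rewrite coef_pure mxE ip scale0r linear0.
rewrite (bigD1 q)//= big1 ?addr0; first by rewrite coef_pure mxE !eqxx scale1r.
by move=> j /negPf jq; rewrite coef_pure mxE jq andbF scale0r linear0.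
Qed.

Lemma rowmap_cp : mcp psi -> cp rowmap.
Proof.
move=> ps; apply: fpos_cpP => I X Xp.
exact: (mcp_comp (@coef_mcp k t T) ps Xp).
Qed.

Lemma rowmap_unital : \sum_p psi p p (munit T) = munit S -> unital rowmap.
Proof.
move=> psu; rewrite /unital rowmapE -[RHS]psu; apply: eq_bigr => p _.
rewrite (bigD1 p)//= big1 ?addr0; first by rewrite coef_pure mxE eqxx scale1r.
by move=> q /negPf qp; rewrite coef_pure mxE eq_sym qp scale0r linear0.
Qed.

End RowMap.
End MatricialMaps.

Section TensorLinearity.
Variable R : realType.

Lemma tmap_pure (S T S' T' : lmodType R[i]) (f : {linear S -> S'}) (g : {linear T -> T'}) x y :
  tmap f g (x ⊗ y) = f x ⊗ g y.
Proof. exact: (tlift_pure (tmap_bilinear f g) x y). Qed.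

Lemma tpurer_linear (U V : lmodType R[i]) (x : U) : linear (@tpure _ U V x).
Proof. by move=> a y z; rewrite linearPr. Qed.

Definition tpurer (U V : lmodType R[i]) (x : U) : {linear V -> U ⊙ V} :=
  HB.pack_for {linear V -> U ⊙ V} (@tpure _ U V x)
    (GRing.isLinear.Build _ _ _ _ (@tpure _ U V x) (tpurer_linear x)).

Lemma tmap_comp (S T S' T' S'' T'' : lmodType R[i]) (f : {linear S -> S'}) (g : {linear T -> T'})
    (f' : {linear S' -> S''}) (g' : {linear T' -> T''}) (h : {linear S -> S''}) (k : {linear T -> T''}) u :
  (forall x, f' (f x) = h x) -> (forall y, g' (g y) = k y) ->
  tmap f' g' (tmap f g u) = tmap h k u.
Proof.
move=> fh gk; apply: (tensor_lin_ext (f := (tmap f' g' \o tmap f g : {linear _ -> _}))) => x y /=.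
by rewrite !tmap_pure fh gk.
Qed.

Lemma tmap_id (S T : lmodType R[i]) (f : {linear S -> S}) (g : {linear T -> T}) u :
  (forall x, f x = x) -> (forall y, g y = y) -> tmap f g u = u.
Proof.
move=> fi gi; apply: (tensor_lin_ext (g := idfun)) => x y /=.
by rewrite tmap_pure fi gi.
Qed.

Lemma id_ucp (S : matord R) : ucp (idfun : {linear S -> S}).
Proof.
split=> // n u; rewrite (_ : map_mx _ u = u)//.
by apply/matrixP => i j; rewrite mxE.
Qed.

Lemma ucp_comp (U V W : matord R) (f : {linear U -> V}) (g : {linear V -> W}) :
  ucp f -> ucp g -> ucp (g \o f : {linear U -> W}).
Proof. by move=> [f1 fp] [g1 gp]; split; [rewrite /unital /= f1|exact: cp_comp]. Qed.

Lemma ext_compl (S T : opsys R) (f : {linear S -> T}) : ucp f ->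
  exists F : {linear compl S -> compl T},
    (forall s, F (compl_in S s) = compl_in T (f s)) /\ ucp F.
Proof.
move=> [f1 fp]; have [F [Fin Fp]] := ext_clos (repP S) (repP T) fp.
exists F; split=> //; split=> //.
by rewrite /unital [munit (compl S)]/(compl_in S (munit S)) Fin f1.
Qed.

Variable t : os_tensor_product R.

Definition amplifies : Prop :=
  forall (S T W : opsys R) k (phi : 'I_k -> 'I_k -> {linear S -> T}), mcp phi ->
    mcp (V := alg_tensor t S W) (W := alg_tensor t T W)
      (fun p q => tmap (phi p q) (idfun : {linear W -> W})).

(* [amplifies_col] asks for [phi] unital as a map into the k-by-k matrices,
   [amplifies_row] for [phi] unital as a map out of them. *)
Definition amplifies_col : Prop :=
  forall (S T W : opsys R) k (phi : 'I_k -> 'I_k -> {linear S -> T}), mcp phi ->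
    (forall p q, phi p q (munit S) = (p == q)%:R *: munit T) ->
    mcp (V := alg_tensor t S W) (W := alg_tensor t T W)
      (fun p q => tmap (phi p q) (idfun : {linear W -> W})).

Definition amplifies_row : Prop :=
  forall (S T W : opsys R) k (phi : 'I_k -> 'I_k -> {linear S -> T}), mcp phi ->
    \sum_p phi p p (munit S) = munit T ->
    mcp (V := alg_tensor t S W) (W := alg_tensor t T W)
      (fun p q => tmap (phi p q) (idfun : {linear W -> W})).

Definition compl_reflects : Prop :=
  forall (S W : opsys R) (I : finType) (u : I -> I -> S ⊙ W),
    fpos (V := alg_tensor t (compl S) W)
      (fun i j => tmap (compl_in S) (idfun : {linear W -> W}) (u i j)) ->
    fpos (V := alg_tensor t S W) u.

End TensorLinearity.

(** * Amplification for associative tensor products *)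

Section Associative.
Variables (R : realType) (t : os_tensor_product R).
Hypothesis tf : functorial t.
Hypothesis ta : associative_tensor t.

Local Notation inc S := (compl_in S).

Lemma assoc_col (S T W : opsys R) k (phi : 'I_k -> 'I_k -> {linear S -> T})
    (F : {linear compl_tensor t (compl_tensor t (MkO R k) T) W ->
                 compl_tensor t (MkO R k) (compl_tensor t T W)}) :
  (forall x y z, F (compl_pure t (compl_pure t x y) z) = compl_pure t x (compl_pure t y z)) ->
  forall u, F (inc (alg_tensor t (compl_tensor t (MkO R k) T) W)
      (tmap (inc (alg_tensor t (MkO R k) T) \o mxmap t phi : {linear S -> compl_tensor t (MkO R k) T}) idfun u))
    = inc (alg_tensor t (MkO R k) (compl_tensor t T W))
      (mxmap (S := alg_tensor t S W) t
         (fun p q => inc (alg_tensor t T W) \o tmap (phi p q) idfun : {linear alg_tensor t S W -> compl_tensor t T W}) u).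
Proof.
move=> Fa u.
pose G1 : {linear S ⊙ W -> compl_tensor t (MkO R k) (compl_tensor t T W)} :=
  F \o (inc (alg_tensor t (compl_tensor t (MkO R k) T) W)
  \o tmap (inc (alg_tensor t (MkO R k) T) \o mxmap t phi : {linear S -> compl_tensor t (MkO R k) T}) idfun).
pose G2 : {linear S ⊙ W -> compl_tensor t (MkO R k) (compl_tensor t T W)} :=
  inc (alg_tensor t (MkO R k) (compl_tensor t T W)) \o
      mxmap (S := alg_tensor t S W) t
         (fun p q => inc (alg_tensor t T W) \o tmap (phi p q) idfun : {linear alg_tensor t S W -> compl_tensor t T W}).
have e1 x y : G1 (x ⊗ y) = F (compl_pure t (inc (alg_tensor t (MkO R k) T) (mxmap t phi x)) y).
  exact: (congr1 (fun z => F (inc (alg_tensor t (compl_tensor t (MkO R k) T) W) z)) (tmap_pure _ _ x y)).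
have e2 x y : G2 (x ⊗ y) =
    \sum_p \sum_q compl_pure t (delta_mx p q : MkO R k) (compl_pure t (phi p q x) y).
  have -> : G2 (x ⊗ y) = inc (alg_tensor t (MkO R k) (compl_tensor t T W))
      (\sum_p \sum_q (delta_mx p q : MkO R k) ⊗ compl_pure t (phi p q x) y).
    congr (inc _ _); apply: eq_bigr => p _; apply: eq_bigr => q _.
    by congr (_ ⊗ inc _ _); exact: tmap_pure.
  rewrite linear_sum; apply: eq_bigr => p _; rewrite linear_sum; exact: eq_bigr.
apply: (tensor_lin_ext (f := G1) (g := G2)) => x y; rewrite e1 e2 mxmapE.
rewrite linear_sum /compl_pure linear_sumlz !linear_sum; apply: eq_bigr => p _.
rewrite linear_sum linear_sumlz !linear_sum; apply: eq_bigr => q _.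
exact: Fa.
Qed.

(** Functoriality amplifies the packed map [mxmap] to (M_k ⊗ T) ⊗ W; associativity regroups this as
    M_k ⊗ (T ⊗ W), whose entries [coef] reads off. *)
Lemma assoc_amplifies_col : amplifies_col t.
Proof.
move=> S T W k phi ph phu I u a up.
have [F [_ [Fcoe _] Fa]] := ta (MkO R k) T W.
have Phiu : ucp (inc (alg_tensor t (MkO R k) T) \o mxmap t phi : {linear S -> compl_tensor t (MkO R k) T}).
  apply: ucp_comp (compl_in_ucp _); split; [exact: mxmap_unital|exact: mxmap_cp].
have := functorial_fpos tf Phiu (id_ucp W) up.
move=> /(fpos_compl (S := alg_tensor t (compl_tensor t (MkO R k) T) W)) /(fpos_coe _ Fcoe) h.
have {}h := proj1 (fpos_compl _) (eq_fpos (fun i j => assoc_col phi Fa (u i j)) h).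
have {h} := coef_mcp a h => h.
apply/(fpos_compl (S := alg_tensor t T W)); apply: eq_fpos h => i j.
by rewrite coef_mxmap.
Qed.

(** Associativity with the trivial factor M_1 is enough: in (M_1 ⊗ S) ⊗ W the inner product is
    already completed, while in M_1 ⊗ (S ⊗ W) the completion surrounds S ⊗ W, whose order it does
    not change. *)
Lemma assoc_compl_reflects : compl_reflects t.
Proof.
move=> S W I u up.
have [F [_ [Fcoe _] Fa]] := ta (MkO R 1) S W.
pose phi (p q : 'I_1) : {linear S -> S} := idfun.
have ph : mcp phi by apply: mcp_cp; case: (id_ucp S).
have phu p q : phi p q (munit S) = (p == q)%:R *: munit S.
  by rewrite !ord1 eqxx scale1r.
have [J [Jin Ju]] := ext_compl (conj (mxmap_unital t phu) (mxmap_cp t ph)).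
have := functorial_fpos tf Ju (id_ucp W) up.
move=> /(fpos_compl (S := alg_tensor t (compl_tensor t (MkO R 1) S) W)) /(fpos_coe _ Fcoe) h.
have {}h : fpos (V := compl_tensor t (MkO R 1) (compl_tensor t S W))
   (fun i j => inc (alg_tensor t (MkO R 1) (compl_tensor t S W))
      (mxmap (S := alg_tensor t S W) t
         (fun p q => inc (alg_tensor t S W) \o tmap (phi p q) idfun : {linear alg_tensor t S W -> compl_tensor t S W}) (u i j))).
  apply: eq_fpos h => i j; rewrite -(assoc_col phi Fa); congr (F (inc _ _)).
  exact: tmap_comp.
have {h} := coef_mcp (fun=> ord0) (proj1 (fpos_compl _) h) => h.
apply/(fpos_compl (S := alg_tensor t S W)); apply: eq_fpos h => i j.
by rewrite coef_mxmap /= tmap_id.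
Qed.

(** The path of the column in reverse. [rowmap] has to be extended to the completed product M_k ⊗ T,
    so it ends in [compl S], and [assoc_compl_reflects] brings the result back to [S]. *)
Lemma assoc_amplifies_row : amplifies_row t.
Proof.
move=> T S W k psi ps psu I u a up; apply: assoc_compl_reflects.
have [F [_ [Fcoe _] Fa]] := ta (MkO R k) T W.
have [P [Pin Pu]] := ext_compl (conj (rowmap_unital t psu) (rowmap_cp (t := t) ps)).
pose E p q : {linear T -> compl_tensor t (MkO R k) T} :=
  inc (alg_tensor t (MkO R k) T) \o (tpurer T (delta_mx p q : MkO R k) : {linear T -> alg_tensor t (MkO R k) T}).
(* A Schur product with matrix units places [u] in M_k ⊗ (T ⊗ W); after regrouping, the extended row
   [P] can act on the factor M_k ⊗ T. *)
have h1 := proj2 (fpos_compl _) (fpos_schur t (fpos_delta a) (proj2 (fpos_compl (S := alg_tensor t T W) u) up)).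
have e p q v : F (inc (alg_tensor t (compl_tensor t (MkO R k) T) W) (tmap (E p q) idfun v))
   = inc (alg_tensor t (MkO R k) (compl_tensor t T W)) ((delta_mx p q : MkO R k) ⊗ inc (alg_tensor t T W) v).
  pose G1 : {linear T ⊙ W -> compl_tensor t (MkO R k) (compl_tensor t T W)} :=
    F \o (inc (alg_tensor t (compl_tensor t (MkO R k) T) W) \o tmap (E p q) idfun).
  pose G2 : {linear T ⊙ W -> compl_tensor t (MkO R k) (compl_tensor t T W)} :=
    inc (alg_tensor t (MkO R k) (compl_tensor t T W)) \o
      ((tpurer (compl_tensor t T W) (delta_mx p q : MkO R k) : {linear compl_tensor t T W -> alg_tensor t (MkO R k) (compl_tensor t T W)})
       \o inc (alg_tensor t T W)).
  apply: (tensor_lin_ext (f := G1) (g := G2)) => x y; rewrite -[RHS]Fa.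
  exact: (congr1 (fun z => F (inc (alg_tensor t (compl_tensor t (MkO R k) T) W) z)) (tmap_pure _ _ x y)).
have h2 : fpos (V := alg_tensor t (compl_tensor t (MkO R k) T) W) (fun i j => tmap (E (a i) (a j)) idfun (u i j)).
  apply/fpos_compl/(fpos_coe _ Fcoe); apply: eq_fpos h1 => i j.
  by rewrite e.
have := functorial_fpos tf Pu (id_ucp W) h2; apply: eq_fpos => i j.
rewrite (tmap_comp (h := inc S \o psi (a i) (a j)) (k := idfun))//.
  by rewrite (tmap_comp (h := inc S \o psi (a i) (a j)) (k := idfun)).
by move=> x /=; rewrite Pin rowmap_delta.
Qed.

End Associative.

(** * Amplification for the maximal tensor product *)

Section Maximal.
Variables (R : realType) (m : os_tensor_product R).
Hypothesis mmax : is_max m.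

Lemma fpos_jcp (S T W : opsys R) (b : {bilinear S -> T -> W}) :
  (forall (I J : finType) (u : I -> I -> S) (v : J -> J -> T), fpos u -> fpos v ->
     fpos (fun x y : I * J => b (u x.1 y.1) (v x.2 y.2))) ->
  jointly_cp b.
Proof.
move=> bp n l P Q /fpos_ord Pp /fpos_ord Qp; apply/fpos_ord.
apply: eq_fpos (fpos_sel (@mxtens_unindex n l) (bp _ _ _ _ Pp Qp)) => i j.
by rewrite mxE.
Qed.

Lemma max_fpos (S T W : opsys R) (b : {bilinear S -> T -> W}) (I : finType) (u : I -> I -> S ⊙ T) :
  (forall (I J : finType) (u : I -> I -> S) (v : J -> J -> T), fpos u -> fpos v ->
     fpos (fun x y : I * J => b (u x.1 y.1) (v x.2 y.2))) ->
  fpos (V := alg_tensor m S T) u -> fpos (fun i j => tlift b (u i j)).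
Proof. by move=> bp up; exact: fpos_cp (mmax (fpos_jcp bp)) up. Qed.

Section Amplification.
Variables (S T W : opsys R) (k : nat) (phi : 'I_k -> 'I_k -> {linear S -> T}).
Let A := alg_tensor m (MkO R k) (alg_tensor m T W).

(** With M_k ⊗ (T ⊗ W) as target the whole family becomes one bilinear map, to which [is_max]
    applies. *)
Definition ampl_bil (s : S) (w : W) : A :=
  \sum_p \sum_q (delta_mx p q : MkO R k) ⊗ ((phi p q s ⊗ w) : alg_tensor m T W).

Lemma ampl_bilinear : bilinear_for
  (GRing.Scale.Law.clone R[i] A *:%R _) (GRing.Scale.Law.clone R[i] A *:%R _) ampl_bil.
Proof.
split=> [w|s] a x y; rewrite /ampl_bil /applyr /= scaler_sumr -big_split; apply: eq_bigr => p _.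
  rewrite scaler_sumr -big_split; apply: eq_bigr => q _.
  by rewrite linearP linearPl linearPr.
rewrite scaler_sumr -big_split; apply: eq_bigr => q _.
by rewrite !linearPr.
Qed.

HB.instance Definition _ := bilinear_isBilinear.Build R[i] S W A _ _ ampl_bil ampl_bilinear.

Lemma ampl_lift u : tlift ampl_bil u = mxmap (S := alg_tensor m S W) m
   (fun p q => tmap (phi p q) idfun : {linear alg_tensor m S W -> alg_tensor m T W}) u.
Proof.
pose G2 : {linear S ⊙ W -> A} := mxmap (S := alg_tensor m S W) m
   (fun p q => tmap (phi p q) idfun : {linear alg_tensor m S W -> alg_tensor m T W}).
apply: (tensor_lin_ext (f := tlift ampl_bil) (g := G2)) => x y.
apply: (etrans (tlift_pure (ampl_bil : {bilinear S -> W -> A}) x y)); apply: eq_bigr => p _; apply: eq_bigr => q _.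
by congr (_ ⊗ _); rewrite tmap_pure.
Qed.

End Amplification.

Lemma max_amplifies : amplifies m.
Proof.
move=> S T W k phi ph I u a up.
have h : fpos (fun i j => tlift (ampl_bil phi : {bilinear S -> W -> _}) (u i j)).
  apply: max_fpos up => {u a}I1 J u v /(fpos_sel (fun x : I1 * 'I_k => x.1)).
  move=> /(ph _ _ (fun x => x.2)) up vp.
  (* The matrix index p belongs to the factor from [S]; it is moved last so that Schur
     multiplication and summation can act on it. *)
  have h1 := fpos_sel (fun x : (I1 * J) * 'I_k => ((x.1.1, x.2), x.1.2)) (fpos_pure m up vp).
  have := fpos_push_fst (fpos_schur m (fpos_delta (fun x : (I1 * J) * 'I_k => x.2)) h1).
  exact: eq_fpos.
have := coef_mcp a h; apply: eq_fpos => i j.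
by rewrite ampl_lift coef_mxmap.
Qed.

Lemma bddfor_sum (S : opsys R) (K : hilbert R) (L : finType) (c : L -> R[i])
    (f : L -> S -> bop K K) :
  (forall l, exists C, bddfor (rep S) (f l) C) ->
  exists C, bddfor (rep S) (fun x => \sum_l c l *: f l x) C.
Proof.
move=> /choice[C CP]; exists (\sum_l complex.Re `|c l| * C l); split.
  by apply: sumr_ge0 => l _; rewrite mulr_ge0 ?Re_norm_ge0//; case: (CP l).
move=> x d d0 xd; rewrite mulr_suml; apply: obd_sum => l _.
by rewrite -mulrA; apply: obdZ; have [_] := CP l; apply.
Qed.

Section Completion.
Variables (S W : opsys R).
Let A := alg_tensor m S W.
Let K := rep_space A.

Definition slice (w : W) (s : S) : bop K K := rep A (s ⊗ w).

Lemma slice_linear w : linear (slice w).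
Proof. by move=> a x y; rewrite /slice linearPl linearP. Qed.

Definition sliceL w : {linear S -> bop K K} :=
  HB.pack_for {linear S -> bop K K} (slice w)
    (GRing.isLinear.Build _ _ _ _ (slice w) (slice_linear w)).

(** For positive [w] the slice is completely positive, hence bounded; [pos_span] reduces to this
    case. *)
Lemma slice_bdd w : exists C, bddfor (rep S) (sliceL w) C.
Proof.
have [L [c [p [pp e]]]] := pos_span w.
have [C CP] : exists C, bddfor (rep S) (fun x => \sum_l c l *: slice (p l) x) C.
  apply: bddfor_sum => l; apply: (cp_bdd (repP S) (f := sliceL (p l) : {linear S -> BH K})).
  apply: (@fpos_cpP _ S (BHo K)) => I u up.
  have := fpos_sel (fun i : I => (i, tt)) (fpos_pure m up (pp l)).
  by move=> /(fpos_cp (coe_cp (coe_rep A))).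
exists C; suff -> : (sliceL w : S -> bop K K) = fun x => \sum_l c l *: slice (p l) x by [].
apply/funext => x; rewrite /= /slice e linear_sumr linear_sum; apply: eq_bigr => l _.
by rewrite linearZr_LR /= linearZ.
Qed.

Lemma slice_ext w : exists FC : {linear compl S -> bop K K} * R,
  (forall s, FC.1 (compl_in S s) = slice w s) /\
  bddfor (@clos_val _ _ _ (rep S)) FC.1 FC.2.
Proof.
have [C CP] := slice_bdd w; have [F [Fin FC]] := ext_ex CP.
by exists (F, C).
Qed.

Definition sext w := (projT1 (cid (slice_ext w))).1.
Definition sext_bd w : R := (projT1 (cid (slice_ext w))).2.

Lemma sext_in w s : sext w (compl_in S s) = rep A (s ⊗ w).
Proof. by have [h _] := projT2 (cid (slice_ext w)); exact: h. Qed.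
Lemma sext_bdd w : bddfor (@clos_val _ _ _ (rep S)) (sext w) (sext_bd w).
Proof. by have [_ h] := projT2 (cid (slice_ext w)). Qed.

(** Extends [s ⊗ w], realised on the space of S ⊗ W, to the completion of [S] in the first variable,
    so that [is_max] can be used on [compl S]. *)
Definition kappa (x : compl S) (w : W) : BH K := sext w x.

Lemma kappa_bilinear : bilinear_for
  (GRing.Scale.Law.clone R[i] (BH K) *:%R _) (GRing.Scale.Law.clone R[i] (BH K) *:%R _) kappa.
Proof.
split=> [w|x] a y z; rewrite /kappa /applyr /=; first by rewrite linearP.
pose G := (a \*: sext y \+ sext z)%R : {linear compl S -> bop K K}.
have GE v : G v = a *: sext y v + sext z v by [].
have Gb : bddfor (@clos_val _ _ _ (rep S)) G (complex.Re `|a| * sext_bd y + sext_bd z).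
  have [y0 yb] := sext_bdd y; have [z0 zb] := sext_bdd z; split.
    by rewrite addr_ge0 ?mulr_ge0 ?Re_norm_ge0.
  move=> v c c0 vc; rewrite GE mulrDl -mulrA; apply: obdD; last exact: zb.
  by apply: obdZ; exact: yb.
apply: (ext_uniq (sext_bdd (a *: y + z)) Gb) => s.
by rewrite GE [LHS]sext_in [sext y _]sext_in [sext z _]sext_in linearPr linearP.
Qed.

HB.instance Definition _ := bilinear_isBilinear.Build R[i] (compl S) W (BH K) _ _ kappa kappa_bilinear.

Lemma kappa_jcp (I J : finType) (u : I -> I -> compl S) (v : J -> J -> W) :
  fpos u -> fpos v ->
  fpos (V := BH K) (fun x y : I * J => kappa (u x.1 y.1) (v x.2 y.2)).
Proof.
move=> up vp; apply/fposBH; apply: mform_lim => e e0.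
(* Only [u] is approximated; one precision must suit the extended slices at all the finitely many
   entries of [v]. *)
pose B := \sum_i \sum_j sext_bd (v i j).
have b0 i j : 0 <= sext_bd (v i j) by case: (sext_bdd (v i j)).
have B0 : 0 <= B by apply: sumr_ge0 => i _; exact: sumr_ge0.
have B1 : 0 < B + 1 by rewrite ltr_wpDl.
have d0 := divr_gt0 e0 B1; set d := e / _ in d0.
have [s sp us] := clos_pos_approx (repP S) up d0.
exists (fun x y => rep A (s x.1 y.1 ⊗ v x.2 y.2)).
  exact/(proj1 (fposE (S := A) _))/fpos_pure.
move=> x y; have [_ h] := sext_bdd (v x.2 y.2).
have {}h := h (u x.1 y.1 - compl_in S (s x.1 y.1)) d (ltW d0) (us x.1 y.1).
rewrite (linearB (sext _)) sext_in in h; apply: obdW h.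
rewrite -[leRHS](divfK (lt0r_neq0 B1)) -/d [leRHS]mulrC ler_wpM2r ?(ltW d0)//.
apply: ler_wpDr => //; rewrite /B (bigD1 x.2)//= (bigD1 y.2)//= -addrA lerDl.
by rewrite addr_ge0 ?sumr_ge0// => i _; exact: sumr_ge0.
Qed.

End Completion.

Lemma max_compl_reflects : compl_reflects m.
Proof.
move=> S W I u up; set A := alg_tensor m S W; set K := rep_space A.
have h := max_fpos (W := BHo K) (b := (kappa (S := S) (W := W) : {bilinear compl S -> W -> BH K})) (@kappa_jcp S W) up.
apply/(fpos_coe _ (coe_rep A)); apply: (@eq_fpos _ (BHo K) _ _ _ _ h) => i j.
pose G1 : {linear S ⊙ W -> BH K} := tlift (kappa (S := S) (W := W) : {bilinear compl S -> W -> BH K}) \o tmap (compl_in S) idfun.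
pose G2 : {linear S ⊙ W -> BH K} := rep A.
apply: (tensor_lin_ext (f := G1) (g := G2)) => x y.
rewrite /G1 /= tmap_pure (tlift_pure (kappa (S := S) (W := W) : {bilinear compl S -> W -> BH K})).
exact: sext_in.
Qed.

End Maximal.

(** * Amplification for the essential tensor products *)

Section EssentialTensors.
Variables (R : realType).

Lemma coe_of_fpos (S T : opsys R) (f : {linear S -> T}) : injective f ->
  (forall (I : finType) (u : I -> I -> S), fpos u <-> fpos (fun i j => f (u i j))) ->
  complete_order_embedding f.
Proof.
move=> fi fp; split=> // n u; rewrite !fpos_ord fp.
by split; apply: eq_fpos => i j; rewrite mxE.
Qed.

(* Through [rowmap], [phi] is one completely positive map on the k-by-k
   matrices over [S]. *)
Lemma mcp_extend (m : os_tensor_product R) (S S' W : opsys R) (j : {linear S -> S'}) k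
    (phi : 'I_k -> 'I_k -> {linear S -> W}) :
  injective_opsys W -> unital j -> complete_order_embedding j -> mcp phi ->
  exists phi' : 'I_k -> 'I_k -> {linear S' -> W},
    mcp phi' /\ forall p q x, phi' p q (j x) = phi p q x.
Proof.
move=> Winj j1 jcoe ph.
pose J : {linear alg_tensor m (MkO R k) S -> alg_tensor m (MkO R k) S'} := tmap idfun j.
have coefJ p q X : coef _ p q (J X) = j (coef _ p q X).
  pose G1 : {linear (MkO R k : lmodType _) ⊙ S -> S'} := coef _ p q \o tmap idfun j.
  pose G2 : {linear (MkO R k : lmodType _) ⊙ S -> S'} := j \o coef _ p q.
  apply: (tensor_lin_ext (f := G1) (g := G2)) => x y.
  by rewrite /G1 /G2 /= tmap_pure !coef_pure linearZ.
have Jcoe : complete_order_embedding J.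
  apply: coe_of_fpos => [X Y XY|I X].
    rewrite (coefK X) (coefK Y); apply: eq_bigr => p _; apply: eq_bigr => q _; congr (_ ⊗ _).
    by have [ji _] := jcoe; apply: ji; rewrite -!coefJ XY.
  rewrite !fpos_coef (fpos_coe _ jcoe).
  by split; apply: eq_fpos => x y; rewrite coefJ.
have J1 : unital J by rewrite /unital [LHS]tmap_pure j1.
have [G [Gp GJ]] := Winj _ _ _ _ J1 Jcoe (rowmap_cp (t := m) ph).
exists (fun p q => G \o tpurer S' (delta_mx p q : MkO R k)); split.
  move=> I u a up.
  exact: (fpos_cp Gp (fpos_schur m (fpos_delta a) up)).
move=> p q x; rewrite -(rowmap_delta m phi) -GJ; congr (G _).
by rewrite [RHS]tmap_pure.
Qed.

Section Left.
Variable t : os_tensor_product R.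
Hypothesis tel : is_el t.

(** Injectivity of the envelope of [T] extends the family to the envelope of [S]; there the order is
    that of [max], which amplifies it. *)
Lemma el_amplifies : amplifies t.
Proof.
have [m mmax el] := tel; move=> S T W k phi ph I u a up.
have [IS [kS [[_ kS1 kScoe _] Sel]]] := el S.
have [IT [kT [[ITinj _ kTcoe _] Tel]]] := el T.
have kph : mcp (fun p q => kT \o phi p q : {linear S -> IT}).
  by move=> J v b vp; exact: fpos_cp (coe_cp kTcoe) (ph _ _ b vp).
have [phi' [ph' ph'E]] := mcp_extend m ITinj kS1 kScoe kph.
apply/(lifts_coe_fpos _ (Tel W)).
have := proj1 (lifts_coe_fpos _ (Sel W)) up.
move=> /(max_amplifies mmax ph' a); apply: (@eq_fpos _ (alg_tensor m IT W)) => i j /=.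
rewrite (tmap_comp (h := kT \o phi (a i) (a j)) (k := idfun))//.
by rewrite (tmap_comp (h := kT \o phi (a i) (a j)) (k := idfun)).
Qed.

(** The envelope of [S] is injective, so its embedding of [S] extends along [compl S] to the
    envelope of the latter; the amplification of this extension carries positivity back. *)
Lemma el_compl_reflects : compl_reflects t.
Proof.
have [m mmax el] := tel; move=> S W I u up.
have [IS [kS [[ISinj kS1 kScoe _] Sel]]] := el S.
have [IC [kC [[_ kC1 kCcoe _] Cel]]] := el (compl S).
have j1 : unital (kC \o compl_in S : {linear S -> IC}) by rewrite /unital /= [LHS]kC1.
have jcoe : complete_order_embedding (kC \o compl_in S : {linear S -> IC}).
  apply: coe_of_fpos => [|J v]; last by rewrite -(fpos_coe _ kCcoe) fpos_compl.
  by apply: inj_comp; [case: kCcoe|case: (compl_in_coe S)].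
have [F [Fp Fj]] := ISinj _ _ _ _ j1 jcoe (coe_cp kScoe).
apply/(lifts_coe_fpos _ (Sel W)).
have := proj1 (lifts_coe_fpos _ (Cel W)) up.
move=> /(max_amplifies mmax (mcp_cp Fp) (fun=> ord0)).
apply: (@eq_fpos _ (alg_tensor m IS W)) => i j /=.
rewrite (tmap_comp (h := kC \o compl_in S) (k := idfun))//.
by rewrite (tmap_comp (h := kS) (k := idfun)).
Qed.

End Left.

Section Right.
Variable t : os_tensor_product R.
Hypothesis ter : is_er t.

Lemma er_amplifies : amplifies t.
Proof.
have [m mmax er] := ter; move=> S T W k phi ph I u a up.
have [IW [kW [_ Wer]]] := er W.
apply/(lifts_coe_fpos _ (Wer T)).
have := proj1 (lifts_coe_fpos _ (Wer S)) up.
move=> /(max_amplifies mmax ph a); apply: (@eq_fpos _ (alg_tensor m T IW)) => i j /=.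
rewrite (tmap_comp (h := phi (a i) (a j)) (k := kW))//.
by rewrite (tmap_comp (h := phi (a i) (a j)) (k := kW)).
Qed.

Lemma er_compl_reflects : compl_reflects t.
Proof.
have [m mmax er] := ter; move=> S W I u up.
have [IW [kW [_ Wer]]] := er W.
apply/(lifts_coe_fpos _ (Wer S)).
apply: (max_compl_reflects mmax).
have := proj1 (lifts_coe_fpos _ (Wer (compl S))) up.
apply: (@eq_fpos _ (alg_tensor m (compl S) IW)) => i j /=.
rewrite (tmap_comp (h := compl_in S) (k := kW))//.
by rewrite (tmap_comp (h := compl_in S) (k := kW)).
Qed.

End Right.
End EssentialTensors.

(** * The commuting tensor product *)

Section ScalarPositivity.
Variable R : realType.

Definition psd (I : finType) (A : I -> I -> R[i]) : Prop :=
  forall v : I -> R[i], 0 <= \sum_i \sum_j A i j * v j * Num.conj (v i).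

(** The spectral theorem: [z] consists of the eigenvalues, [xi] of the rows of the diagonalising
    unitary. *)
Lemma psd_decomp n (A : 'M[R[i]]_n) : psd A ->
  exists (z : 'I_n -> R[i]) (xi : 'I_n -> 'I_n -> R[i]),
    (forall l, 0 <= z l) /\
    forall i j, A i j = \sum_l z l * (Num.conj (xi l i) * xi l j).
Proof.
move=> Ap; have Ah i j : A j i = Num.conj (A i j).
  have h : forall h, 0 <= mform (fun i j => A i j *: bop_id (clineH R)) h h.
    by move=> h; exact: (Ap (fun i => h i : R[i])).
  have : (A i j * 1) * Num.conj 1 = 1 * Num.conj (A j i * 1) :> R[i].
    exact: (mform_herm h i j (1 : R[i]) (1 : R[i])).
  by rewrite conjC1 !mulr1 mul1r => ->; rewrite conjCK.
have Asym : A \is hermsymmx.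
  by apply/is_hermitianmxP; rewrite expr0 scale1r; apply/matrixP => i j; rewrite !mxE -Ah.
have An := hermitian_normalmx Asym.
have /orthomx_spectralP := An; set P := spectralmx A; set sp := spectral_diag A => AE.
have PU : P \is unitarymx by exact: spectral_unitarymx.
have AE' : A = (map_mx Num.conj P^T) *m diag_mx sp *m P by rewrite {1}AE invmx_unitary.
have entry i j : A i j = \sum_l sp 0 l * (Num.conj (P l i) * P l j).
  rewrite AE' mxE; apply: eq_bigr => l _; rewrite mul_mx_diag !mxE; ring.
exists (fun l => sp 0 l), (fun l i => P l i); split=> // l.
have spE : diag_mx sp = P *m A *m (map_mx Num.conj P^T).
  have PPt : P *m map_mx Num.conj P^T = 1%:M by apply/unitarymxP.
  by rewrite AE' !mulmxA PPt mul1mx -mulmxA PPt mulmx1.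
have -> : sp 0 l = \sum_i \sum_j A i j * Num.conj (P l j) * Num.conj (Num.conj (P l i)).
  have := congr1 (fun M : 'M_n => M l l) spE; rewrite mxE eqxx mulr1n => ->.
  rewrite mxE exchange_big; apply: eq_bigr => j _; rewrite mxE mulr_suml.
  by apply: eq_bigr => i _; rewrite !mxE conjCK; ring.
exact: (Ap (fun j => Num.conj (P l j))).
Qed.

Lemma fpos_psd (S : opsys R) (I : finType) (A : I -> I -> R[i]) (x : I -> I -> S) :
  psd A -> fpos x -> fpos (fun i j => A i j *: x i j).
Proof.
move=> Ap xp.
have Bp : psd (\matrix_(i < #|I|, j < #|I|) A (enum_val i) (enum_val j)).
  move=> v; have := Ap (v \o enum_rank); congr (_ <= _).
  rewrite sum_enum_val; apply: eq_bigr => i _; rewrite sum_enum_val.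
  by apply: eq_bigr => j _; rewrite mxE /= !enum_valK.
have [z [xi [z0 zE]]] := psd_decomp Bp.
have := fpos_sum (P := predT) (fun l _ => fposZ (z0 l)
  (fpos_cmpr (fun i k => (i == k)%:R * xi l (enum_rank k)) xp)).
apply: eq_fpos => i j; have := zE (enum_rank i) (enum_rank j); rewrite mxE !enum_rankK => ->.
rewrite scaler_suml; apply: eq_bigr => l _; rewrite -scalerA; congr (_ *: _).
rewrite (bigD1 i)//= [X in _ + X]big1 ?addr0; last first.
  by move=> p /negPf pi; rewrite big1// => q _; rewrite pi mul0r rmorph0 mul0r scale0r.
rewrite (bigD1 j)//= big1 ?addr0; first by rewrite !eqxx !mul1r.
by move=> q /negPf qj; rewrite qj mul0r mulr0 scale0r.
Qed.

Definition state (S : opsys R) (om : {linear S -> R[i]^o}) : Prop :=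
  om (munit S) = 1 /\ forall (I : finType) (u : I -> I -> S), fpos u -> psd (fun i j => om (u i j)).

(** A vector state of the realisation. The zero space also carries an operator system, which has no
    state; hence the alternative. *)
Lemma state_ex (S : opsys R) : (exists om : {linear S -> R[i]^o}, state om) \/ forall x : S, x = 0.
Proof.
have [[h h0]|nh] := pselect (exists h : rep_space S, h != 0); last first.
  right=> x; apply: (@rep_inj _ S); apply: bopP => k.
  have z (y : rep_space S) : y = 0 by apply/eqP; apply: contrapT => /negP y0; apply: nh; exists y.
  by rewrite (z (_ k)) (z (_ k)).
left; pose c := (`|h| ^+ 2)^-1.
have n0 : `|h| ^+ 2 != 0 by rewrite sqrf_eq0 normr_eq0.
pose om (x : S) : R[i]^o := c * inner (rep_space S) ((rep S x : bop _ _) h) h.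
have oml : linear om.
  by move=> a x y; rewrite /om linearP /= ipDl ipZl mulrDr mulrCA.
pose om' : {linear S -> R[i]^o} := HB.pack_for {linear S -> R[i]^o} om
  (GRing.isLinear.Build _ _ _ _ om oml).
exists om'; split.
  by rewrite /= /om rep_unit /= inner_norm mulVf.
move=> I u /fposE up v; have c0 : 0 <= c by rewrite invr_ge0 exprn_ge0.
have := mulr_ge0 c0 (up (fun i => v i *: h)); congr (_ <= _).
rewrite /mform mulr_sumr; apply: eq_bigr => i _; rewrite mulr_sumr; apply: eq_bigr => j _.
by rewrite bopZ ipZl ipZr /= /om; ring.
Qed.

End ScalarPositivity.

Section CommutingPairs.
Variables (R : realType) (S W : opsys R) (H : hilbert R).

Definition commuting (F : {linear S -> BH H}) (g : {linear W -> BH H}) : Prop :=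
  forall x y, bop_comp (F x) (g y) = bop_comp (g y) (F x).

Definition prodm (F : {linear S -> BH H}) (g : {linear W -> BH H}) (u : S ⊙ W) : bop H H :=
  tlift (opprod F g) u.

Lemma prodm_pure F g x y : prodm F g (x ⊗ y) = bop_comp (F x) (g y).
Proof. exact: (tlift_pure (opprod F g) x y). Qed.

Lemma prodm_sum F g (s : seq (S * W)) :
  prodm F g (\sum_(p <- s) p.1 ⊗ p.2) = \sum_(p <- s) bop_comp (F p.1) (g p.2).
Proof.
rewrite /prodm linear_sum; apply: eq_bigr => p _; exact: prodm_pure.
Qed.

Section Add.
Variables (om : {linear S -> R[i]^o}) (D : bop H H) (F : {linear S -> BH H}).

Definition add_state_fun (x : S) : BH H := F x + om x *: D.
Lemma add_state_linear : linear add_state_fun.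
Proof.
move=> a x y; rewrite /add_state_fun !linearP /= scalerDl scalerDr addrACA.
by rewrite -scalerA.
Qed.
Definition add_state : {linear S -> BH H} := HB.pack_for {linear S -> BH H} add_state_fun
  (GRing.isLinear.Build _ _ _ _ add_state_fun add_state_linear).
Lemma add_stateE x : add_state x = F x + om x *: D. Proof. by []. Qed.

Lemma add_state_cp : state om -> (forall h, 0 <= inner H (D h) h) -> cp F -> cp add_state.
Proof.
move=> [_ omp] Dp Fp; apply: (@fpos_cpP _ S (BHo H)) => I u up.
have Dpos : pos (V := BHo H) D.
  by apply/fposBH => h; rewrite /mform !sum_unit.
have {}Dpos := fpos_sel (fun _ : I => tt) Dpos.
exact: (fposD (S := BHo H) (fpos_cp Fp up) (fpos_psd (omp _ _ up) Dpos)).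
Qed.

End Add.

Section Conjugate.
Variables (Y : bop H H) (F : {linear S -> BH H}).

Definition conj_fun (x : S) : BH H := bop_comp Y (bop_comp (F x) Y).
Lemma conj_linear : linear conj_fun.
Proof.
move=> a x y; apply: bopP => h; rewrite /conj_fun linearP /=.
by rewrite bopD bopZ.
Qed.
Definition conjm : {linear S -> BH H} := HB.pack_for {linear S -> BH H} conj_fun
  (GRing.isLinear.Build _ _ _ _ conj_fun conj_linear).
Lemma conjmE x : conjm x = bop_comp Y (bop_comp (F x) Y). Proof. by []. Qed.

Hypothesis Ysym : is_adjoint Y Y.

Lemma conjm_cp : cp F -> cp conjm.
Proof.
move=> Fp; apply: (@fpos_cpP _ S (BHo H)) => I u up; apply/fposBH => h.
have := proj1 (fposBH _) (fpos_cp Fp up) (fun i => Y (h i)); congr (_ <= _).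
by apply: eq_bigr => i _; apply: eq_bigr => j _; rewrite conjmE /= Ysym.
Qed.

End Conjugate.

Lemma scale_cp (a : R[i]) (F : {linear S -> BH H}) : 0 <= a -> cp F ->
  cp (a \*: F : {linear S -> BH H}).
Proof.
move=> a0 Fp; apply: (@fpos_cpP _ S (BHo H)) => I u up.
exact: (fposZ (S := BHo H) a0 (fpos_cp Fp up)).
Qed.

End CommutingPairs.

Section CommutingPositivity.
Variables (R : realType) (t : os_tensor_product R).
Hypothesis tc : is_commuting t.
Variables (S W : opsys R).

Lemma comm_fpos (H : hilbert R) (F : {linear S -> BH H}) (g : {linear W -> BH H})
    (I : finType) (u : I -> I -> S ⊙ W) :
  ucp F -> ucp g -> commuting F g -> fpos (V := alg_tensor t S W) u ->
  forall h, 0 <= mform (fun i j => prodm F g (u i j)) h h.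
Proof.
move=> Fu gu FG up; apply/fposBH.
have := proj1 (@tc S W #|I| _) up H F g Fu gu FG.
by rewrite (@fpos_map _ (alg_tensor t S W) (BH H) (tlift (opprod F g))).
Qed.

Lemma comm_fposP (I : finType) (u : I -> I -> S ⊙ W) :
  (forall (H : hilbert R) (F : {linear S -> BH H}) (g : {linear W -> BH H}),
     ucp F -> ucp g -> commuting F g ->
     forall h, 0 <= mform (fun i j => prodm F g (u i j)) h h) ->
  fpos (V := alg_tensor t S W) u.
Proof.
move=> h; apply: (proj2 (@tc S W #|I| _)) => H F g Fu gu FG.
rewrite (@fpos_map _ (alg_tensor t S W) (BH H) (tlift (opprod F g))).
exact: (proj2 (fposBH (fun i j => prodm F g (u i j))) (h H F g Fu gu FG)).
Qed.

Section Slice.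
Variable om : {linear S -> R[i]^o}.

Definition oslice_bil (x : S) (y : W) : W := (om x : R[i]) *: y.
Lemma oslice_bilinear : bilinear_for
  (GRing.Scale.Law.clone R[i] W *:%R _) (GRing.Scale.Law.clone R[i] W *:%R _) oslice_bil.
Proof.
split=> [w|x] a y z; rewrite /oslice_bil /applyr /=.
  by rewrite linearP scalerDl -scalerA.
by rewrite scalerDr !scalerA mulrC.
Qed.
HB.instance Definition _ := bilinear_isBilinear.Build R[i] S W W _ _ oslice_bil oslice_bilinear.

Definition oslice : {linear S ⊙ W -> W} := tlift oslice_bil.

Lemma oslice_sum (s : seq (S * W)) :
  oslice (\sum_(p <- s) p.1 ⊗ p.2) = \sum_(p <- s) (om p.1 : R[i]) *: p.2.
Proof.
rewrite linear_sum; apply: eq_bigr => p _.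
exact: (tlift_pure (oslice_bil : {bilinear S -> W -> W}) p.1 p.2).
Qed.

Lemma prodm_add_state (H : hilbert R) D (F : {linear S -> BH H}) (g : {linear W -> BH H}) u :
  prodm (add_state om D F) g u = prodm F g u + bop_comp D (g (oslice u)).
Proof.
have [s ->] := tensorP u; rewrite !prodm_sum oslice_sum [g _]linear_sum.
apply: bopP => h.
transitivity ((\sum_(p <- s) bop_comp (F p.1) (g p.2)) h +
    D ((\sum_(p <- s) (g ((om p.1 : R[i]) *: p.2) : bop H H)) h)); last by [].
rewrite !bop_sumE bop_sum -big_split; apply: eq_bigr => p _.
rewrite [add_state _ _ _ _]add_stateE /=.
by rewrite [g (_ *: _)]linearZ /= bopZ.
Qed.

(** Scalar operators commute with everything, so [x |-> om x 1] and [rep W] are a commuting pair,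
    whose product map is [rep W] composed with the slice. *)
Lemma oslice_fpos (I : finType) (u : I -> I -> S ⊙ W) : state om ->
  fpos (V := alg_tensor t S W) u -> fpos (fun i j => oslice (u i j)).
Proof.
move=> omS up; apply/fposE => h; set K := rep_space W in h *.
pose z : {linear S -> BH K} := (0 : R[i]) \*: (add_state om 0 (\0 : {linear S -> BH K})).
pose F := add_state om (bop_id K) z.
have FE x : F x = om x *: bop_id K by rewrite /F add_stateE /z /= scale0r add0r.
have zp : cp z.
  apply: scale_cp => //; apply: add_state_cp => // [k|]; first by rewrite ip0l.
  move=> n v _ k; rewrite /= big1// => i _; rewrite big1// => j _.
  by rewrite mxE ip0l.
have Fu : ucp F.
  split; first by rewrite /unital FE (proj1 omS) scale1r.
  by apply: add_state_cp => // k; exact: ip_ge0.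
have ru : ucp (rep W) by split; [exact: rep_unit|exact/coe_cp/coe_rep].
have FG : commuting F (rep W).
  by move=> x y; apply: bopP => k; rewrite FE /= bopZ.
have := comm_fpos Fu ru FG up h; congr (_ <= mform _ _ _).
apply/funext => i; apply/funext => j.
have [s ->] := tensorP (u i j); rewrite prodm_sum oslice_sum linear_sum.
by apply: eq_bigr => p _; apply: bopP => k; rewrite FE linearZ.
Qed.

End Slice.

Section Bound.
Variables (H : hilbert R) (g : {linear W -> BH H}).
Hypothesis gu : ucp g.
Variables (om : {linear S -> R[i]^o}).
Hypothesis omS : state om.
Variables (I : finType) (u : I -> I -> S ⊙ W).
Hypothesis up : fpos (V := alg_tensor t S W) u.

Let G i j : bop H H := g (oslice om (u i j)).

Let Gherm i j : is_adjoint (G i j) (G j i).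
Proof.
have := proj1 (fposBH _) (fpos_cp (proj2 gu) (oslice_fpos omS up)).
by move=> /mform_herm /(_ i j).
Qed.

Let G_bd : exists2 M : R, 0 <= M & forall i j, obd (G i j) M.
Proof.
have /choice[M MP] (x : I * I) : exists M, 0 <= M /\ obd (G x.1 x.2) M.
  by have [M M0 bM] := bop_bnd (G x.1 x.2); exists M.
have M0 x : 0 <= M x by case: (MP x).
exists (\sum_x M x) => [|i j]; first exact: sumr_ge0.
apply: obdW (proj2 (MP (i, j))); rewrite (bigD1 (i, j))//= lerDl.
exact: sumr_ge0.
Qed.

(** Positivity up to [rho] for maps whose unit has defect at most [r]. All such [F] are covered at
    once, since a Newton step passes from [F] to another map. *)
Definition almost (r rho : R) : Prop :=
  forall F : {linear S -> BH H}, cp F -> commuting F g ->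
  (forall h, (1 - r) * nr h ^+ 2 <= complex.Re (inner H (F (munit S) h) h) <= nr h ^+ 2) ->
  forall h, 0 <= mform (fun i j => prodm F g (u i j)) h h + (rho * \sum_i nr (h i) ^+ 2)%:C%C.

Let unit_pos (F : {linear S -> BH H}) : cp F ->
  forall h, 0 <= inner H (F (munit S) h) h.
Proof.
move=> Fp h; have := proj1 (fposBH _) (fpos_cp Fp (pos_unit S)) (fun=> h).
by rewrite /mform !sum_unit.
Qed.

Let e_props (F : {linear S -> BH H}) r : cp F ->
  (forall h, (1 - r) * nr h ^+ 2 <= complex.Re (inner H (F (munit S) h) h) <= nr h ^+ 2) ->
  let e := bop_id H - F (munit S) in
  is_adjoint e e /\ forall h, 0 <= complex.Re (inner H (e h) h) <= r * nr h ^+ 2.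
Proof.
move=> Fp Fb e; have ds := pos_sym (unit_pos Fp); split.
  by move=> h k; rewrite /= ipBl ipBr ds.
move=> h; rewrite /= ipBl ReB Re_ip; have /andP[h1 h2] := Fb h.
by apply/andP; split; lra.
Qed.

(* Adding the state times 1 - F(1) makes [F] unital; the error is at most 1 - F(1). *)
Lemma almost_base : exists2 M : R, 0 <= M & forall r, 0 < r <= 1 -> almost r (r * M).
Proof.
have [M M0 GM] := G_bd; exists (M * #|I|%:R) => [|r r01 F Fp FG Fb h].
  by rewrite mulr_ge0.
have [es eb] := e_props Fp Fb; set e := bop_id H - _ in es eb.
have ep k : 0 <= inner H (e k) k.
  by rewrite (sym_real _ es) lecR; have /andP[] := eb k.
have r0 : 0 <= r by case/andP: r01 => /ltW.
have e_bd : obd e r.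
  move=> k; rewrite -(ler_pXn2r (n := 2)) ?nnegrE ?mulr_ge0 ?nr_ge0//.
  rewrite (le_trans (pos_contr_le es eb r01 k))// exprMn expr2 -mulrA ler_wpM2l//.
  by have /andP[] := eb k.
have F2u : ucp (add_state om e F).
  split; last exact: add_state_cp.
  by rewrite /unital add_stateE (proj1 omS) scale1r addrC subrK.
have eG y : bop_comp e (g y) = bop_comp (g y) e.
  apply: bopP => k; rewrite /= bopB; congr (_ - _).
  exact: (congr1 (fun b : bop H H => b k) (FG (munit S) y)).
have F2g : commuting (add_state om e F) g.
  move=> x y; apply: bopP => k; rewrite add_stateE /= bopD bopZ; congr (_ + _ *: _).
    exact: (congr1 (fun b : bop H H => b k) (FG x y)).
  exact: (congr1 (fun b : bop H H => b k) (eG y)).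
have := comm_fpos F2u gu F2g up h.
have -> : mform (fun i j => prodm (add_state om e F) g (u i j)) h h =
   mform (fun i j => prodm F g (u i j)) h h + mform (fun i j => bop_comp e (G i j)) h h.
  rewrite -mform_add; congr (mform _ _ _); apply/funext => i; apply/funext => j.
  exact: prodm_add_state.
have eGh i j : is_adjoint (bop_comp e (G i j)) (bop_comp e (G j i)).
  move=> x y; rewrite [in RHS]eG /= es (Gherm i j).
  by [].
rewrite (mform_real _ eGh) => h1; apply: le_trans h1 _; rewrite lerD2l lecR.
have ebd i j : obd (- bop_comp e (G i j)) (r * M) by apply/obdN/obd_comp.
have := mform_bound (w := fun i j => - bop_comp e (G i j)) h (mulr_ge0 r0 M0) ebd.
have -> : mform (fun i j => - bop_comp e (G i j)) h h = - mform (fun i j => bop_comp e (G i j)) h h.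
  have E := mform_scale (fun i j => bop_comp e (G i j)) h (-1); rewrite mulN1r in E.
  rewrite -E; congr (mform _ _ _); apply/funext => i; apply/funext => j.
  by rewrite scaleN1r.
by rewrite ReN lerN2 !mulrA.
Qed.

(* One Newton step for the inverse square root of F(1) squares the defect. *)
Lemma almost_step r rho : 0 < r <= 1 -> 0 <= rho -> almost (r ^+ 2) rho -> almost r rho.
Proof.
move=> r01 rho0 IH F Fp FG Fb h.
have [es eb] := e_props Fp Fb; set e := bop_id H - _ in es eb.
set Y := newton e; have Ys : is_adjoint Y Y := newton_sym es.
(* With [h = Y k] the form of [F] at [h] is the form of the conjugated map at [k], and [|k| <= |h|]
   keeps the error within [rho]. *)
have /choice[k kP] i : exists x, Y x = h i by exact: newton_surj es eb _.
have YG y x : Y (g y x) = g y (Y x).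
  rewrite !newtonE bopD bopZ; congr (_ + _ *: _); rewrite /= bopB; congr (_ - _).
  exact: (congr1 (fun b : bop H H => b x) (FG (munit S) y)).
have F2g : commuting (conjm Y F) g.
  move=> x y; apply: bopP => z; transitivity (Y (F x (Y (g y z)))); first by [].
  transitivity (g y (Y (F x (Y z)))); last by [].
  rewrite YG -[RHS]YG; congr (Y _).
  exact: (congr1 (fun b : bop H H => b (Y z)) (FG x y)).
have F2b x : (1 - r ^+ 2) * nr x ^+ 2 <= complex.Re (inner H (conjm Y F (munit S) x) x) <= nr x ^+ 2.
  have -> : inner H (conjm Y F (munit S) x) x = inner H (Y x - e (Y x)) (Y x).
    transitivity (inner H (Y (F (munit S) (Y x))) x); first by [].
    by rewrite Ys; congr (inner H _ _); rewrite [e _]/(_ - F (munit S) _) opprB [RHS]addrC subrK.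
  exact: newton_bounds.
have := IH _ (conjm_cp Ys Fp) F2g F2b k.
have -> : mform (fun i j => prodm (conjm Y F) g (u i j)) k k = mform (fun i j => prodm F g (u i j)) h h.
  apply: eq_bigr => i _; apply: eq_bigr => j _; rewrite -(kP i) -(kP j) -Ys; congr (inner H _ _).
  have [s ->] := tensorP (u i j); rewrite !prodm_sum !bop_sumE bop_sum; apply: eq_bigr => p _.
  by transitivity (Y (F p.1 (Y (g p.2 (k j))))); last by rewrite YG.
move=> h1; apply: le_trans h1 _; rewrite lerD2l lecR ler_wpM2l//.
apply: ler_sum => i _; rewrite ler_pXn2r ?nnegrE ?nr_ge0// -(kP i).
exact: newton_ge eb _.
Qed.

Lemma almost_iter r n M : 0 < r <= 1 -> 0 <= M ->
  (forall r, 0 < r <= 1 -> almost r (r * M)) -> almost r (r ^+ (2 ^ n) * M).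
Proof.
move=> + M0 base; elim: n r => [|n IH] r r01; first by rewrite expr1; exact: base.
have r2 : 0 < r ^+ 2 <= 1.
  by case/andP: r01 => a b; rewrite exprn_gt0//= exprn_ile1// ltW.
apply: almost_step => //.
  by rewrite mulr_ge0// exprn_ge0//; case/andP: r01 => /ltW.
by rewrite expnS exprM; exact: IH.
Qed.

(** After n Newton steps the error is at most [r ^+ (2 ^ n) * M], which tends to 0 as [r < 1];
    [fpos_arch] finishes. *)
Lemma comm_cp_bounded (F : {linear S -> BH H}) r : 0 < r < 1 -> cp F -> commuting F g ->
  (forall h, (1 - r) * nr h ^+ 2 <= complex.Re (inner H (F (munit S) h) h) <= nr h ^+ 2) ->
  fpos (V := BHo H) (fun i j => prodm F g (u i j)).
Proof.
move=> /andP[r0 r1] Fp FG Fb; have [M M0 base] := almost_base.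
apply: (@fpos_arch _ (BHo H) _ _ (fun i j : I => (i == j)%:R *: bop_id H)) => e e0.
have M1 : 0 < M + 1 by rewrite ltr_wpDl.
have [n nP] : exists n, r ^+ n <= e / (M + 1).
  have rn : `|r| < 1 by rewrite gtr0_norm.
  have /cvgrPdist_lt rlim := cvg_expr rn.
  have [n _ nP] := rlim _ (divr_gt0 e0 M1).
  exists n; have := nP n (leqnn n); rewrite sub0r normrN => /ltW; apply: le_trans.
  by rewrite ler_norm.
have r01 : 0 < r <= 1 by rewrite r0 ltW.
apply/fposBH => h; have := almost_iter n r01 M0 base Fp FG Fb h.
rewrite mform_add => h1; apply: le_trans h1 _; rewrite lerD2l.
have -> : mform (fun i j : I => e%:C%C *: ((i == j)%:R *: bop_id H)) h h = (e * \sum_i nr (h i) ^+ 2)%:C%C.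
  rewrite mform_scale rmorphM; congr (_ * _); rewrite rmorph_sum; apply: eq_bigr => i _.
  rewrite (bigD1 i)//= big1 ?addr0; last first.
    by move=> j /negPf ji; rewrite eq_sym ji scale0r ip0l.
  by rewrite eqxx scale1r /= inner_norm nrE -rmorphXn.
rewrite lecR ler_wpM2r; first by [].
  by apply: sumr_ge0 => i _; exact: sqr_ge0.
have h2 : r ^+ (2 ^ n) <= r ^+ n.
  by apply: ler_wiXn2l; rewrite ?(ltW r0) ?(ltW r1)// ltnW// ltn_expl.
rewrite (le_trans (ler_wpM2r M0 (le_trans h2 nP)))// -[leRHS](divfK (lt0r_neq0 M1)).
by rewrite ler_wpM2l// ?lerDl// ltW// divr_gt0.
Qed.

End Bound.

(** Adding [d] times the state makes F(1) bounded below, scaling makes it at most 1, and [d] then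
    tends to 0 by the Archimedean property. *)
Lemma comm_cp (H : hilbert R) (F : {linear S -> BH H}) (g : {linear W -> BH H})
    (I : finType) (u : I -> I -> S ⊙ W) :
  cp F -> ucp g -> commuting F g -> fpos (V := alg_tensor t S W) u ->
  fpos (V := BHo H) (fun i j => prodm F g (u i j)).
Proof.
move=> Fp gu FG up; have [[om omS]|S0] := state_ex S; last first.
  apply: eq_fpos (fpos0 (BHo H) I) => i j; have [s ->] := tensorP (u i j).
  by rewrite prodm_sum big1// => p _; rewrite (S0 p.1) linear0; apply: bopP.
have [D0 D00 DF] := bop_bnd (F (munit S) : bop H H).
have D1 : 0 < D0 + 1 by rewrite ltr_wpDl.
apply: (@fpos_arch _ (BHo H) _ _ (fun i j => g (oslice om (u i j)))) => d d0.
(* As F(1) <= D0, the new unit lies between [d * c] and 1. The extra 1 gives [d * c < 1] even if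
   [D0 = 0], so that [r = 1 - d * c] is admissible. *)
pose c := (D0 + 1 + d)^-1; have c0 : 0 < c by rewrite invr_gt0 addr_gt0.
pose z : {linear S -> BH H} := add_state om (d%:C%C *: bop_id H) F.
have zp : cp z.
  apply: add_state_cp => // h; rewrite /= ipZl mulr_ge0 ?ip_ge0// lecR ltW//.
pose F' : {linear S -> BH H} := c%:C%C \*: z.
have F'p : cp F' by apply: scale_cp => //; rewrite lecR ltW.
have F'E x : F' x = c%:C%C *: (F x + om x *: (d%:C%C *: bop_id H)) by [].
have F'g : commuting F' g.
  move=> x y; apply: bopP => k.
  have e : F x (g y k) = g y (F x k) := congr1 (fun b : bop H H => b k) (FG x y).
  transitivity (c%:C%C *: (F x (g y k) + om x *: (d%:C%C *: g y k))); first by [].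
  transitivity (g y (c%:C%C *: (F x k + om x *: (d%:C%C *: k)))); last by [].
  by rewrite e !(bopZ, bopD).
have F'b h : (1 - (1 - d * c)) * nr h ^+ 2 <= complex.Re (inner H (F' (munit S) h) h) <= nr h ^+ 2.
  rewrite F'E (proj1 omS) scale1r /= ipZl ReZ ipDl ipZl ReD ReZ Re_ip.
  have fp0 : 0 <= complex.Re (inner H (F (munit S) h) h).
    have := proj1 (fposBH _) (fpos_cp Fp (pos_unit S)) (fun=> h).
    by rewrite /mform !sum_unit lecE => /andP[].
  have fp1 : complex.Re (inner H (F (munit S) h) h) <= D0 * nr h ^+ 2.
    apply: Re_le_norm; rewrite (ge0_real (normr_ge0 _)) lecR expr2 mulrA.
    exact: obd_ip.
  rewrite opprB addrCA subrr addr0; apply/andP; split.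
    by rewrite [d * c]mulrC -mulrA ler_pM2l// lerDr.
  rewrite -[leRHS](mulKf (lt0r_neq0 (addr_gt0 D1 d0))) -/c ler_pM2l//=.
  by have := sqr_ge0 (nr h); nra.
have r01 : 0 < 1 - d * c < 1.
  rewrite subr_gt0 ltrBlDr ltrDl mulr_gt0// andbT.
  by rewrite /c (ltr_pdivrMr _ _ (addr_gt0 D1 d0)) mul1r ltrDr.
have := comm_cp_bounded gu omS up r01 F'p F'g F'b => h.
have ci0 : 0 <= (c^-1)%:C%C :> R[i] by rewrite lecR invr_ge0 ltW.
have := fposZ (S := BHo H) ci0 h; apply: (@eq_fpos _ (BHo H)) => i j.
have -> : prodm F' g (u i j) = c%:C%C *: (prodm F g (u i j) + d%:C%C *: g (oslice om (u i j))).
  have -> : prodm F' g (u i j) = c%:C%C *: prodm z g (u i j).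
    have [s ->] := tensorP (u i j); rewrite !prodm_sum scaler_sumr.
    by apply: eq_bigr => p _; apply: bopP.
  rewrite prodm_add_state; congr (_ *: (_ + _)).
  by apply: bopP.
by rewrite scalerA -rmorphM mulVf ?gt_eqF// scale1r.
Qed.

End CommutingPositivity.

Section CommutingTensor.
Variables (R : realType) (t : os_tensor_product R).
Hypothesis tc : is_commuting t.

(** A commuting pair on [S] and [W] extends to [compl S] and [W]; commutation persists because the
    extension is bounded. *)
Lemma comm_compl_reflects : compl_reflects t.
Proof.
move=> S W I u up; apply: (comm_fposP tc) => H f g [f1 fp] gu fg.
have [F [Fin Fp]] := ext_cp (repP S) fp.
have Fu : ucp (F : {linear compl S -> BH H}).
  by split=> //; rewrite /unital [munit (compl S)]/(compl_in S (munit S)) Fin f1.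
have Fg : commuting (F : {linear compl S -> BH H}) g.
  move=> x y; have [C [C0 FC]] := cp_bdd (closM_represents (repP S)) Fp.
  have [M M0 gM] := bop_bnd (g y : bop H H).
  apply/eqP; rewrite -subr_eq0; apply/eqP; apply: obd0P => e e0.
  have c0 : 0 < 2 * (M * C) + 1 by rewrite ltr_wpDl// !mulr_ge0.
  have d0 := divr_gt0 e0 c0; set d := e / _ in d0.
  have [s xs] := clos_dense x d0.
  have h1 := FC (x - compl_in S s) _ (ltW d0) xs.
  rewrite (linearB F) Fin in h1.
  have -> : bop_comp (F x) (g y) - bop_comp (g y) (F x) =
     bop_comp (F x - f s : bop H H) (g y) - bop_comp (g y) (F x - f s : bop H H).
    apply: bopP => k.
    have e1 : f s (g y k) = g y (f s k) := congr1 (fun b : bop H H => b k) (fg s y).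
    transitivity (F x (g y k) - g y (F x k)); first by [].
    transitivity ((F x (g y k) - f s (g y k)) - g y (F x k - f s k)); last by [].
    by rewrite bopB e1 opprB addrA subrK.
  apply: obdW (obdB (obd_comp _ gM h1) (obd_comp M0 h1 gM)); last by rewrite mulr_ge0// ltW.
  rewrite -[leRHS](divfK (lt0r_neq0 c0)) -/d; nra.
have h := comm_fpos tc Fu gu Fg up; move=> k; have := h k; congr (_ <= mform _ _ _).
apply/funext => i; apply/funext => j.
pose G1 : {linear S ⊙ W -> BH H} := tlift (opprod (F : {linear compl S -> BH H}) g) \o tmap (compl_in S) idfun.
pose G2 : {linear S ⊙ W -> BH H} := tlift (opprod f g).
apply: (tensor_lin_ext (f := G1) (g := G2)) => x y.
transitivity (prodm (F : {linear compl S -> BH H}) g (compl_in S x ⊗ y)).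
  by congr (tlift _ _); exact: tmap_pure.
rewrite prodm_pure [RHS](prodm_pure f g) Fin.
by [].
Qed.

(** On k copies of the space, the operator matrix with entries f(phi p q) commutes with g acting
    diagonally. It need not be unital, which is why [comm_cp] is required. *)
Lemma comm_amplifies : amplifies t.
Proof.
move=> S T W k phi ph I u a up; apply: (comm_fposP tc) => H f g [f1 fp] [g1 gp] fg h.
set Hk := hsumH H k.
pose F0 (x : S) : BH Hk := opmx (fun p q => f (phi p q x)).
have F0l : linear F0.
  move=> c x y; apply: bopP => v; apply/funext => p.
  transitivity (c *: (\sum_q (f (phi p q x) : bop H H) ((v : hsum H k) q))
      + \sum_q (f (phi p q y) : bop H H) ((v : hsum H k) q)); last by [].
  transitivity (\sum_q (f (phi p q (c *: x + y)) : bop H H) ((v : hsum H k) q)); first by [].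
  by rewrite scaler_sumr -big_split; apply: eq_bigr => q _; rewrite !linearP.
pose F : {linear S -> BH Hk} := HB.pack_for {linear S -> BH Hk} F0
  (GRing.isLinear.Build _ _ _ _ F0 F0l).
pose g0 (y : W) : BH Hk := opmx (fun p q => (p == q)%:R *: (g y : bop H H)).
have g0E y (v : Hk) p : (g0 y : bop Hk Hk) v p = (g y : bop H H) ((v : hsum H k) p).
  transitivity (\sum_q ((p == q)%:R *: (g y : bop H H)) ((v : hsum H k) q)); first by [].
  rewrite (bigD1 p)//= big1 ?addr0 ?eqxx ?scale1r// => q /negPf qp.
  by rewrite eq_sym qp scale0r.
have g0l : linear g0.
  move=> c x y; apply: bopP => v; apply/funext => p; rewrite g0E linearP.
  transitivity (c *: (g0 x : bop Hk Hk) v p + (g0 y : bop Hk Hk) v p); last by [].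
  by rewrite !g0E.
pose G : {linear W -> BH Hk} := HB.pack_for {linear W -> BH Hk} g0
  (GRing.isLinear.Build _ _ _ _ g0 g0l).
have Fp : cp F.
  apply: (@fpos_cpP _ S (BHo Hk)) => J v vp; apply/fposBH => w.
  have := fpos_cp fp (ph _ _ (fun x : J * 'I_k => x.2) (fpos_sel (fun x : J * 'I_k => x.1) vp)).
  move=> /fposBH /(_ (fun x => (w x.1 : hsum H k) x.2)); congr (_ <= _).
  rewrite /mform -(pair_bigA _ (fun i p => \sum_j
     inner H ((f (phi p j.2 (v i j.1)) : bop H H) ((w j.1 : hsum H k) j.2)) ((w i : hsum H k) p))) /=.
  apply: eq_bigr => i _.
  under eq_bigr => p _ do rewrite -(pair_bigA _ (fun j q =>
     inner H ((f (phi p q (v i j)) : bop H H) ((w j : hsum H k) q)) ((w i : hsum H k) p))) /=.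
  rewrite exchange_big; apply: eq_bigr => j _; exact: esym (opmx_ip _ _ _).
have Gu : ucp G.
  split.
    by apply: bopP => v; apply/funext => p; rewrite [LHS]g0E g1.
  apply: (@fpos_cpP _ W (BHo Hk)) => J v vp; apply/fposBH => w.
  have := proj1 (fposBH _) (fpos_cp gp vp) => gv.
  have : 0 <= \sum_p mform (fun i j => g (v i j)) (fun j => (w j : hsum H k) p) (fun j => (w j : hsum H k) p).
    by apply: sumr_ge0 => p _; exact: gv.
  congr (_ <= _); rewrite /mform exchange_big; apply: eq_bigr => i _.
  rewrite exchange_big; apply: eq_bigr => j _; rewrite hsum_ipE.
  by apply: eq_bigr => p _; congr (inner H _ _); exact: esym (g0E _ _ _).
have FG : commuting F G.
  move=> x y; apply: bopP => v; apply/funext => p.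
  transitivity (\sum_q (f (phi p q x) : bop H H) ((g0 y : bop Hk Hk) v q)); first by [].
  transitivity ((g0 y : bop Hk Hk) (F0 x v) p); last by [].
  rewrite g0E.
  transitivity ((g y : bop H H) (\sum_q (f (phi p q x) : bop H H) ((v : hsum H k) q))); last by [].
  rewrite bop_sum; apply: eq_bigr => q _; rewrite g0E.
  exact: (congr1 (fun b : bop H H => b ((v : hsum H k) q)) (fg (phi p q x) y)).
(* Putting [h i] into coordinate [a i] singles out the entry (a i, a j) of the operator matrix. *)
pose hh i : Hk := (fun p => if p == a i then h i else 0) : hsum H k.
have := proj1 (fposBH _) (comm_cp tc Fp Gu FG up) hh; congr (_ <= _).
apply: eq_bigr => i _; apply: eq_bigr => j _.
have [s ->] := tensorP (u i j).
have -> : tmap (phi (a i) (a j)) (idfun : {linear W -> W}) (\sum_(p <- s) p.1 ⊗ p.2)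
   = \sum_(p <- s) phi (a i) (a j) p.1 ⊗ p.2.
  by rewrite linear_sum; apply: eq_bigr => p _; rewrite tmap_pure.
have -> : prodm f g (\sum_(p <- s) phi (a i) (a j) p.1 ⊗ p.2) =
   \sum_(p <- s) bop_comp (f (phi (a i) (a j) p.1)) (g p.2).
  by rewrite /prodm linear_sum; apply: eq_bigr => p _; exact: prodm_pure.
rewrite prodm_sum !bop_sumE !ip_suml; apply: eq_bigr => x _.
transitivity (inner Hk ((opmx (fun p q => f (phi p q x.1)) : bop Hk Hk) (g0 x.2 (hh j))) (hh i)); first by [].
rewrite opmx_ip.
transitivity (\sum_p \sum_q inner H ((f (phi p q x.1) : bop H H)
   ((g x.2 : bop H H) (if q == a j then h j else 0))) (if p == a i then h i else 0)).
  by apply: eq_bigr => p _; apply: eq_bigr => q _; rewrite g0E.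
rewrite (bigD1 (a i))//= [X in _ + X]big1 ?addr0; last first.
  by move=> p /negPf pi; rewrite big1// => q _; rewrite pi ip0r.
rewrite (bigD1 (a j))//= big1 ?addr0 ?eqxx//.
by move=> q /negPf qj; rewrite qj !bop0 ip0l.
Qed.

End CommutingTensor.

(** * Moving nuclearity along retracts and completions *)

Lemma pos_close (R : realType) (S : matord R) (H : hilbert R) (f : {linear S -> BH H})
    (fP : represents f) (x y : closO fP) (e : R) :
  pos x -> pos y -> obd (clos_val x - clos_val y) e ->
  pos (x - y + e%:C%C *: munit (closO fP)).
Proof.
move=> xp yp xy; apply/fpos_closM => h; rewrite /mform !sum_unit.
have xs := mform_herm (proj1 (fpos_closM _) xp) tt tt.
have ys := mform_herm (proj1 (fpos_closM _) yp) tt tt.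
have s : is_adjoint (clos_val x - clos_val y) (clos_val x - clos_val y).
  by move=> u v; rewrite /= ipBl ipBr xs ys.
have f1 : f (munit S) = bop_id H by case: (fP).
have := sym_add_pos s xy (h tt); congr (_ <= inner _ _ _).
by rewrite /= f1.
Qed.

Section NuclearTransfer.
Variables (R : realType) (t' t : os_tensor_product R).
Hypotheses (tf' : functorial t') (tf : functorial t).

Lemma pnuc_retract (S T : opsys R) (f : {linear S -> T}) (g : {linear T -> S}) :
  ucp f -> ucp g -> (forall x, g (f x) = x) -> pnuc t' t T -> pnuc t' t S.
Proof.
move=> fu gu gf nT W I u up.
have := functorial_fpos tf gu (id_ucp W) (nT _ _ _ (functorial_fpos tf' fu (id_ucp W) up)).
apply: (@eq_fpos _ (alg_tensor t S W)) => i j.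
rewrite (tmap_comp (h := idfun) (k := idfun))//.
exact: tmap_id.
Qed.

Lemma pnuc_of_compl (S : opsys R) : compl_reflects t -> pnuc t' t (compl S) -> pnuc t' t S.
Proof.
move=> tE nS W I u up; apply: tE; apply: nS.
exact: functorial_fpos tf' (compl_in_ucp S) (id_ucp W) up.
Qed.

Lemma comb_map (S S' T : opsys R) (I L : finType) (z : L -> R) (xi : L -> I -> R[i])
    (f : {linear S -> S'}) (a : L -> S) (b : L -> T) i j :
  tmap f (idfun : {linear T -> T}) (comb z xi a b i j) = comb z xi (fun l => f (a l)) b i j.
Proof. by rewrite linear_sum; apply: eq_bigr => l _; rewrite linearZ /= tmap_pure. Qed.

(** Entries of a matrix over the completion need not come from [S], but the positive factors of a
    [comb] can be approximated from [S]. The perturbed matrix is positive for [t'] over the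
    completion, hence over [S], where the hypothesis applies. *)
Lemma pnuc_compl (S : opsys R) : compl_reflects t' -> pnuc t' t S -> pnuc t' t (compl S).
Proof.
move=> tE nS W I u up.
have [L [z [xi [a [b [ap bp uE]]]]]] := fpos_pos_comb up.
have uE' : u = comb z xi a b by apply/funext => i; apply/funext => j.
rewrite uE' in up *; apply: fpos_approx => // e e0.
have near l : exists s : S, pos (a l - compl_in S s + e%:C%C *: munit (compl S)) /\
    pos (compl_in S s - a l + e%:C%C *: munit (compl S)).
  have [v vp av] := clos_pos_approx (repP S) (ap l) e0.
  exists (v tt tt).
  have d := av tt tt; have vp' : pos (compl_in S (v tt tt)).
    by have := fpos_cp (coe_cp (compl_in_coe S)) vp; apply: eq_fpos => [[] []].
  split; [exact: (pos_close (fP := repP S) (ap l) vp' d)|].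
  apply: (pos_close (fP := repP S) vp' (ap l)).
  by rewrite -opprB; exact: obdN.
have [s sP] := choice near; exists (fun l => compl_in S (s l)).
split=> [l|l|]; [by case: (sP l)|by case: (sP l)|].
pose w i j : S ⊙ W := comb z xi s b i j + e%:C%C *: comb (fun l => `|z l|) xi (fun=> munit S) b i j.
have wE i j : tmap (compl_in S) idfun (w i j) = comb z xi (fun l => compl_in S (s l)) b i j
   + e%:C%C *: comb (fun l => `|z l|) xi (fun=> munit (compl S)) b i j.
  by rewrite (linearD (tmap _ _)) (linearZ_LR (tmap _ _)) !comb_map.
have : fpos (V := alg_tensor t' S W) w.
  apply: tE.
  have := fposD up (comb_approx t' z xi bp (fun l => proj2 (sP l)) (fun l => proj1 (sP l))).
  apply: (@eq_fpos _ (alg_tensor t' (compl S) W)) => i j.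
  by rewrite wE addrA [X in X + _]addrC subrK.
move=> /nS /(functorial_fpos tf (compl_in_ucp S) (id_ucp W)).
by apply: (@eq_fpos _ (alg_tensor t (compl S) W)) => i j; rewrite wE.
Qed.

End NuclearTransfer.

(** * Ternary rings of operators *)

Section Representations.
Variable R : realType.

(** The range is automatically selfadjoint: positive elements span [S] and go to selfadjoint
    operators. *)
Lemma coe_represents (S : opsys R) (H : hilbert R) (f : {linear S -> BH H}) :
  unital f -> complete_order_embedding f -> represents f.
Proof.
move=> fu fe; split=> // _ [x _ <-].
have [L [c [p [pp ->]]]] := pos_span x.
exists (f (\sum_l Num.conj (c l) *: p l)); first by exists (\sum_l Num.conj (c l) *: p l).
have ps l : is_adjoint (f (p l) : bop H H) (f (p l)).
  have := proj1 (fpos_rep (fun _ _ : unit => p l) fe) (pp l).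
  by move=> /mform_herm /(_ tt tt).
move=> h k; rewrite ![f _]linear_sum !bop_sumE ip_suml ip_sumr; apply: eq_bigr => l _.
rewrite ![f (_ *: _)]linearZ.
transitivity (inner H (c l *: (f (p l) : bop H H) h) k); first by [].
transitivity (inner H h (Num.conj (c l) *: (f (p l) : bop H H) k)); last by [].
by rewrite ipZl ipZr ps conjCK.
Qed.

Lemma adjK (H K : hilbert R) (a : bop H K) : adj (adj a) = a.
Proof. by rewrite -(adj_uniq (is_adjoint_sym (@adjP _ _ _ a))). Qed.

Lemma adjsetE (H K : hilbert R) (M : set (bop H K)) x : adjset M (adj x) <-> M x.
Proof.
split=> [[a Ma /adj_uniq aE]|Mx]; last by exists x => //; exact: adjP.
by rewrite -(adjK x) aE adjK.
Qed.

Lemma adjsetK (H K : hilbert R) (M : set (bop H K)) : adjset (adjset M) = M.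
Proof.
apply/seteqP; split=> x; first by rewrite -{1}(adjK x) => /adjsetE /adjsetE.
by move=> Mx; rewrite -(adjK x); apply/adjsetE/adjsetE.
Qed.

Lemma adj_comp (H K L : hilbert R) (b : bop K L) (a : bop H K) :
  adj (bop_comp b a) = bop_comp (adj a) (adj b).
Proof. by apply/esym/adj_uniq => h k; rewrite /= !adjP. Qed.

Lemma adj_lin (H K : hilbert R) (c : R[i]) (a b : bop H K) :
  adj (c *: a + b) = Num.conj c *: adj a + adj b.
Proof.
apply/esym/adj_uniq => h k.
transitivity (inner K (c *: a h + b h) k); first by [].
transitivity (inner H h (Num.conj c *: adj a k + adj b k)); last by [].
by rewrite !ipE conjCK !adjP.
Qed.

Lemma adjset_TRO (H K : hilbert R) (M : set (bop H K)) : is_TRO M -> is_TRO (adjset M).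
Proof.
move=> [M0 Ml Mt].
have adj0 : adj (0 : bop H K) = 0 by apply/esym/adj_uniq => h k; rewrite /= ip0l ip0r.
split.
- by rewrite -adj0; apply/adjsetE.
- move=> a x y; rewrite -(adjK x) -(adjK y) => /adjsetE Mx /adjsetE My.
  have -> : a *: adj (adj x) + adj (adj y) = adj (Num.conj a *: adj x + adj y).
    by rewrite adj_lin conjCK.
  by apply/adjsetE; apply: Ml.
- rewrite adjsetK => _ [_ [x Mx [y My <-]]] [z Mz <-].
  have -> : bop_comp (bop_comp x y) z = adj (bop_comp (bop_comp (adj z) (adj y)) (adj x)).
    by rewrite !adj_comp !adjK; exact: bopP.
  apply/adjsetE; apply: Mt; exists (bop_comp (adj z) (adj y)).
    exists (adj z); first by apply/adjsetE; rewrite adjK.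
    by exists (adj y) => //; apply/adjsetE.
  by exists (adj x) => //; apply/adjsetE; rewrite adjK.
Qed.

Lemma TRO_equiv_sym (H K : hilbert R) (A : set (bop H H)) (B : set (bop K K)) :
  TRO_equiv A B -> TRO_equiv B A.
Proof.
move=> [M [Mt [n1 n2] mA mB]]; exists (adjset M).
by split; [exact: adjset_TRO|split; rewrite adjsetK|rewrite adjsetK|rewrite adjsetK].
Qed.

Lemma Delta_equiv_sym (S T : opsys R) : Delta_equiv S T -> Delta_equiv T S.
Proof.
by move=> [H [K [f [g [fe ge /TRO_equiv_sym]]]]]; exists K, H, g, f.
Qed.

End Representations.

Section Frames.
Variables (R : realType) (H K : hilbert R) (M : set (bop H K)).
Hypothesis Mt : is_TRO M.

Lemma tro_sum (L : finType) (x : L -> bop H K) : (forall l, M (x l)) -> M (\sum_l x l).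
Proof.
case: Mt => M0 Ml _ Mx; elim/big_ind: _ => // a b Ma Mb.
by rewrite -[a]scale1r; exact: Ml.
Qed.

Lemma tro_scale c x : M x -> M (c *: x).
Proof. by case: Mt => M0 Ml _ Mx; rewrite -[_ *: _]addr0; exact: Ml. Qed.

Lemma tro_triple x y z : M x -> M y -> M z -> M (bop_comp (bop_comp x (adj y)) z).
Proof.
case: Mt => _ _ h Mx My Mz; apply: h; exists (bop_comp x (adj y)); last by exists z.
by exists x => //; exists (adj y) => //; apply/adjsetE.
Qed.

Definition gram (L : finType) (m : L -> bop H K) : bop H H :=
  \sum_l bop_comp (adj (m l)) (m l).

Definition frame_bound (L : finType) (m : L -> bop H K) (r : R) : Prop :=
  forall h, (1 - r) * nr h ^+ 2 <= \sum_l nr (m l h) ^+ 2 <= nr h ^+ 2.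

Lemma gram_ip (L : finType) (m : L -> bop H K) h k :
  inner H (gram m h) k = \sum_l inner K (m l h) (m l k).
Proof. by rewrite bop_sumE ip_suml; apply: eq_bigr => l _; rewrite /= adjP'. Qed.

Lemma defect_sym (L : finType) (m : L -> bop H K) :
  is_adjoint (bop_id H - gram m) (bop_id H - gram m).
Proof.
move=> h k; rewrite /= ipBl ipBr; congr (_ - _).
rewrite gram_ip [RHS]ipC gram_ip rmorph_sum; apply: eq_bigr => l _; exact: ipC.
Qed.

Lemma Re_defect (L : finType) (m : L -> bop H K) h :
  complex.Re (inner H ((bop_id H - gram m) h) h) = nr h ^+ 2 - \sum_l nr (m l h) ^+ 2.
Proof.
rewrite /= ipBl ReB Re_ip gram_ip Re_sum; congr (_ - _); apply: eq_bigr => l _.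
exact: Re_ip.
Qed.

Lemma defect_bound (L : finType) (m : L -> bop H K) r : frame_bound m r ->
  forall h, 0 <= complex.Re (inner H ((bop_id H - gram m) h) h) <= r * nr h ^+ 2.
Proof. by move=> mr h; rewrite Re_defect; move: (mr h) => /andP[m1 m2]; apply/andP; split; lra. Qed.

(** Since e = 1 - \sum_j m_j^* m_j, composing [m l] with [newton e] involves only linear
    combinations and triple products, under which [M] is stable. *)
Lemma frame_newton (L : finType) (m : L -> bop H K) r : 0 < r <= 1 ->
  (forall l, M (m l)) -> frame_bound m r ->
  exists m' : L -> bop H K, (forall l, M (m' l)) /\ frame_bound m' (r ^+ 2).
Proof.
move=> r01 Mm mr; set e := bop_id H - gram m.
exists (fun l => bop_comp (m l) (newton e)); split=> [l|h].
  have -> : bop_comp (m l) (newton e) = m l + (2^-1)%:C%C *: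
      (m l - \sum_j bop_comp (bop_comp (m l) (adj (m j))) (m j)).
    apply: bopP => h; rewrite /= bopD bopZ bopB; congr (_ + _ *: (_ - _)).
    by rewrite !bop_sumE bop_sum.
  have Mm' : M (- \sum_j bop_comp (bop_comp (m l) (adj (m j))) (m j)).
    by rewrite -scaleN1r; apply: tro_scale; apply: tro_sum => j; exact: tro_triple.
  have [_ Ml _] := Mt; rewrite addrC; apply: (Ml) => //.
  by rewrite -[X in X - _]scale1r; exact: Ml.
have -> : \sum_l nr (bop_comp (m l) (newton e) h) ^+ 2 =
    complex.Re (inner H (newton e h - e (newton e h)) (newton e h)).
  have -> : newton e h - e (newton e h) = gram m (newton e h).
    by rewrite /e /= opprB addrC subrK.
  by rewrite gram_ip Re_sum; apply: eq_bigr => l _; rewrite Re_ip.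
exact: newton_bounds (defect_sym m) (defect_bound mr) r01 h.
Qed.

(** Non-degeneracy puts a sum of c_i b_i^* x_i within 1/2 of the identity. Estimating each cross
    term by half the sum of two squares shows that the c_i x_i and b_i together are bounded below by
    1; dividing by an upper bound [D] gives the frame. *)
Lemma frame_start : cspan (mulset (adjset M) M) (bop_id H) ->
  exists (L : finType) (p0 : L) (m : L -> bop H K) (r : R),
    [/\ 0 < r < 1, forall l, M (m l) & frame_bound m r].
Proof.
move=> /nclosureE /(_ 2^-1); rewrite invr_gt0 ltr0n => /(_ isT) [_ [n [c [a [aM ->]]]]] ob.
have /choice[xy xyP] i : exists xy : bop H K * bop H K,
    [/\ M xy.1, M xy.2 & a i = bop_comp (adj xy.2) xy.1].
  have [b' [b Mb bb'] [x Mx <-]] := aM i.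
  by exists (x, b); split=> //; rewrite -(adj_uniq bb').
(* The zero operator at [None] changes no sum and guarantees an index [p0], even if n = 0. *)
pose m0 (l : option (bool * 'I_n)) : bop H K := match l with
  | None => 0
  | Some (true, i) => c i *: (xy i).1
  | Some (false, i) => (xy i).2 end.
have Mm0 l : M (m0 l).
  have [M0 _ _] := Mt; case: l => [[[] i]|] //=; first by apply: tro_scale; case: (xyP i).
  by case: (xyP i).
have /choice[C CP] l : exists C : R, 0 <= C /\ obd (m0 l) C.
  by have [C C0 Ch] := bop_bnd (m0 l); exists C.
pose D := 1 + \sum_l C l ^+ 2.
have D1 : 1 <= D by rewrite lerDl sumr_ge0// => l _; rewrite sqr_ge0.
have D0 : 0 < D by lra.
have up h : \sum_l nr (m0 l h) ^+ 2 <= D * nr h ^+ 2.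
  apply: (@le_trans _ _ ((\sum_l C l ^+ 2) * nr h ^+ 2)).
    rewrite mulr_suml; apply: ler_sum => l _; rewrite -exprMn ler_sqr ?nnegrE ?nr_ge0//.
      by have [_ ] := CP l; apply.
    by rewrite mulr_ge0 ?nr_ge0//; case: (CP l).
  by rewrite ler_wpM2r ?sqr_ge0// lerDr.
have low h : nr h ^+ 2 <= \sum_l nr (m0 l h) ^+ 2.
  have e1 : complex.Re (inner H ((bop_id H - \sum_i c i *: a i) h) h) =
      nr h ^+ 2 - \sum_i complex.Re (inner K (c i *: (xy i).1 h) ((xy i).2 h)).
    rewrite /= ipBl ReB Re_ip bop_sumE ip_suml Re_sum; congr (_ - _).
    apply: eq_bigr => i _; have [_ _ ->] := xyP i.
    transitivity (complex.Re (inner H (c i *: adj (xy i).2 ((xy i).1 h)) h)); first by [].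
    by rewrite ipZl adjP' -ipZl.
  have e2 : complex.Re (inner H ((bop_id H - \sum_i c i *: a i) h) h) <= 2^-1 * nr h * nr h.
    by apply: Re_le_norm; rewrite [leLHS](ge0_real _)// lecR; exact: obd_ip.
  have e3 : \sum_i complex.Re (inner K (c i *: (xy i).1 h) ((xy i).2 h)) <=
      \sum_i (nr (m0 (Some (true, i)) h) ^+ 2 + nr (m0 (Some (false, i)) h) ^+ 2) / 2.
    apply: ler_sum => i _.
    have p1 := sqr_ge0 (nr (m0 (Some (true, i)) h - m0 (Some (false, i)) h)).
    rewrite -Re_ip ipBl !ipBr !ReB !Re_ip in p1.
    have p2 : complex.Re (inner K (m0 (Some (false, i)) h) (m0 (Some (true, i)) h)) =
        complex.Re (inner K (m0 (Some (true, i)) h) (m0 (Some (false, i)) h)).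
      by rewrite [inner K (m0 (Some (false, i)) h) _]ipC Re_conj.
    rewrite p2 in p1; rewrite ler_pdivlMr//.
    have p3 : inner K (c i *: (xy i).1 h) ((xy i).2 h) =
       inner K (m0 (Some (true, i)) h) (m0 (Some (false, i)) h) by [].
    by rewrite p3; lra.
  have e4 : \sum_l nr (m0 l h) ^+ 2 =
      \sum_i (nr (m0 (Some (true, i)) h) ^+ 2 + nr (m0 (Some (false, i)) h) ^+ 2).
    rewrite (bigD1 None)//= nr0 expr0n add0r.
    rewrite (reindex_omap (op := +%R) Some id) /=; last by case.
    rewrite (eq_bigl (fun=> true)); last by move=> [b i]; rewrite eqxx.
    rewrite (eq_bigr (fun p => nr (m0 (Some (p.1, p.2)) h) ^+ 2)); last by case.
    rewrite -(pair_bigA _ (fun b i => nr (m0 (Some (b, i)) h) ^+ 2)) /= big_bool.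
    by rewrite -big_split.
  rewrite e4; rewrite -mulr_suml in e3; move: e3.
  set Y := \sum_i complex.Re _ in e1 *; set Z := \sum_(i < n) (_ + _).
  by rewrite e1 -mulrA -expr2 in e2; lra.
pose s := Num.sqrt D^-1.
have s2 : s ^+ 2 = D^-1 by rewrite sqr_sqrtr// invr_ge0 ltW.
(* The lower bound after scaling is 1/D, so 1 - 1/D would do as defect; the maximum with 1/2 keeps
   [r] positive when D = 1. *)
exists (option (bool * 'I_n)), None, (fun l => s%:C%C *: m0 l), (Num.max 2^-1 (1 - D^-1)).
split=> [|l|h].
- rewrite lt_max invr_gt0 ltr0n/= gt_max; apply/andP; split; first by lra.
  by rewrite ltrBlDr ltrDl invr_gt0.
- exact: tro_scale.
- have -> : \sum_l nr ((s%:C%C *: m0 l) h) ^+ 2 = D^-1 * \sum_l nr (m0 l h) ^+ 2.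
    rewrite mulr_sumr; apply: eq_bigr => l _.
    transitivity (nr (s%:C%C *: m0 l h) ^+ 2); first by [].
    by rewrite nrZR exprMn real_normK ?s2// num_real.
  rewrite ler_pdivrMl// up andbT.
  apply: (@le_trans _ _ (D^-1 * nr h ^+ 2)); last by rewrite ler_wpM2l// invr_ge0 ltW.
  rewrite ler_wpM2r ?sqr_ge0//.
  have : 1 - D^-1 <= Num.max 2^-1 (1 - D^-1) by rewrite le_max lexx orbT.
  by lra.
Qed.

(** The index [p0] records that the family is not empty; [approx_factor] stores the defect of the
    row there. *)
Lemma frame_ex (eta : R) : cspan (mulset (adjset M) M) (bop_id H) -> 0 < eta ->
  exists k (p0 : 'I_k) (m : 'I_k -> bop H K), (forall l, M (m l)) /\ frame_bound m eta.
Proof.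
move=> nd e0; have [L [p0 [m [r [/andP[r0 r1] Mm mr]]]]] := frame_start nd.
have iter n : exists m' : L -> bop H K, (forall l, M (m' l)) /\ frame_bound m' (r ^+ n.+1).
  elim: n => [|n [m' [Mm' m'r]]]; first by exists m; rewrite expr1.
  have rn : 0 < r ^+ n.+1 <= 1 by rewrite exprn_gt0//= exprn_ile1// ltW.
  have [m2 [Mm2 m2r]] := frame_newton rn Mm' m'r.
  exists m2; split=> // h; have /andP[h1 ->] := m2r h; rewrite andbT.
  (* The defect is squared, but one more power of [r] per step is enough for the limit. *)
  apply: le_trans h1; rewrite ler_wpM2r ?sqr_ge0// lerD2l lerN2 -exprM.
  by rewrite ler_wiXn2l ?ltW// muln2 -addnn addSn ltnS addnS ltnS leq_addl.
have [n rn] : exists n, r ^+ n.+1 <= eta.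
  have /cvgrPdist_le /(_ eta e0) [n _ nP] : r ^+ n @[n --> \oo] --> (0 : R).
    by apply: cvg_expr; rewrite ger0_norm// ltW.
  exists n; have := nP n.+1 (leqnSn n); rewrite /= sub0r normrN ger0_norm//.
  by rewrite exprn_ge0// ltW.

have [m' [Mm' m'r]] := iter n.
exists #|{: L}|, (enum_rank p0); exists (fun i => m' (enum_val i)).
split=> [l|h]; first exact: Mm'.
have := m'r h; rewrite sum_enum_val /= => /andP[h1 ->]; rewrite andbT.
apply: le_trans h1; rewrite ler_wpM2r ?sqr_ge0//; lra.
Qed.

End Frames.

Section Compression.
Variables (R : realType) (S T : matord R) (H K : hilbert R).
Variables (f : {linear S -> BH H}) (g : {linear T -> BH K}).
Hypotheses (fP : represents f) (gP : represents g).
Local Notation A := (closO fP).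
Local Notation B := (closO gP).
Local Notation av := (@clos_val R S H f).
Local Notation bv := (@clos_val R T K g).

Lemma nclosure_conj (a b : bop H K) (x : A) :
  (forall s, nclosure (range g) (bop_comp (bop_comp b (f s)) (adj a))) ->
  nclosure (range g) (bop_comp (bop_comp b (av x)) (adj a)).
Proof.
move=> h; apply/nclosureE => e e0.
have [C C0 Cb] := bop_bnd (adj a); have [D D0 Db] := bop_bnd b.
have d0 : 0 < D * C + 1 by rewrite ltr_wpDl ?mulr_ge0.
have e2 : 0 < e / 2 by rewrite divr_gt0.
have [s sx] := clos_dense x (divr_gt0 e2 d0).
have /nclosureE /(_ _ e2) [y yr ys] := h s.
exists y => //.
rewrite (_ : _ - y = bop_comp (bop_comp b (av x - f s)) (adj a)
    + (bop_comp (bop_comp b (f s)) (adj a) - y)); last first.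
  apply: bopP => k; transitivity (b (av x (adj a k) - (f s : bop H H) (adj a k))
    + (b ((f s : bop H H) (adj a k)) - y k)); last by [].
  by rewrite bopB addrA subrK.
have m1 := obd_comp D0 sx Db.
have q0 : 0 <= e / 2 / (D * C + 1) by rewrite divr_ge0// ltW.
have m2 := obd_comp (mulr_ge0 D0 q0) Cb m1.
apply: obdW (obdD m2 ys); rewrite [leRHS]splitr lerD2r.
have -> : D * (e / 2 / (D * C + 1)) * C = e / 2 * (D * C) / (D * C + 1) by ring.
by rewrite ler_pdivrMr// ler_wpM2l ?lerDl// ltW.
Qed.

Section Family.
Variables (k : nat) (a : 'I_k -> bop H K) (D : 'I_k -> 'I_k -> bop K K).
Variable om : {linear A -> R[i]^o}.
Hypothesis am : forall p q s,
  nclosure (range g) (bop_comp (bop_comp (a p) (f s)) (adj (a q))).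
Hypothesis Dm : forall p q, nclosure (range g) (D p q).

(** One formula serves both directions: the column uses the [m p] and the row their adjoints, each
    with its own defect [D] and state. *)
Definition compress_op (p q : 'I_k) (x : A) : bop K K :=
  bop_comp (bop_comp (a p) (av x)) (adj (a q)) + (om x : R[i]) *: D p q.

Lemma compress_in p q x : compress_op p q x \in closed_range g.
Proof.
rewrite rpredD ?rpredZ//; apply/asboolP; last exact: Dm.
by apply: nclosure_conj => s; exact: am.
Qed.

Definition compress_fun p q (x : A) : B := Clos (compress_in p q x).

Lemma compress_linear p q : linear (compress_fun p q).
Proof.
move=> c x y; apply/val_inj/bopP => h.
transitivity (a p (c *: av x (adj (a q) h) + av y (adj (a q) h))
   + (om (c *: x + y) : R[i]) *: D p q h); first by [].
transitivity (c *: (a p (av x (adj (a q) h)) + (om x : R[i]) *: D p q h) +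
   (a p (av y (adj (a q) h)) + (om y : R[i]) *: D p q h)); last by [].
rewrite bopD bopZ (linearP om) /= scalerDl scalerDr scalerA.
by rewrite addrACA.
Qed.

Definition compress p q : {linear A -> B} := HB.pack_for {linear A -> B} (compress_fun p q)
  (GRing.isLinear.Build _ _ _ _ (compress_fun p q) (compress_linear p q)).

Lemma compressE p q x : bv (compress p q x) = compress_op p q x.
Proof. by []. Qed.

Lemma compress_mcp : state om -> (forall h, 0 <= mform D h h) -> mcp compress.
Proof.
move=> [_ oms] Dp I u s up; apply/fpos_closM => h.
have -> : mform (fun i j => bv (compress (s i) (s j) (u i j))) h h =
  mform (fun i j => av (u i j)) (fun i => adj (a (s i)) (h i)) (fun i => adj (a (s i)) (h i))
  + mform (fun i j => (om (u i j) : R[i]) *: D (s i) (s j)) h h.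
  rewrite /mform -big_split; apply: eq_bigr => i _.
  rewrite -big_split; apply: eq_bigr => j _.
  rewrite compressE.
  transitivity (inner K (a (s i) (av (u i j) (adj (a (s j)) (h j)))
     + (om (u i j) : R[i]) *: D (s i) (s j) (h j)) (h i)); first by [].
  by rewrite ipDl adjP.
apply: addr_ge0; first exact: (proj1 (fpos_closM _) up).
have Dp' : fpos (V := BHo K) (fun i j => D (s i) (s j)).
  by apply: (fpos_sel (S := BHo K) (u := D) s); apply/fposBH.
exact: (proj1 (fposBH _) (fpos_psd (S := BHo K) (oms _ _ up) Dp')).
Qed.

End Family.
End Compression.

(** * Approximate factorisation through matrices over the linked system *)

Section States.
Variable R : realType.

Lemma state_pos (S : opsys R) (om : {linear S -> R[i]^o}) x :
  state om -> pos x -> 0 <= (om x : R[i]).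
Proof.
move=> [_ /(_ unit (fun _ _ => x)) h] /h /(_ (fun=> 1)).
by rewrite !sum_unit rmorph1 !mulr1.
Qed.

(** Evaluate [lam] at the positive element X 1 - x. *)
Lemma pos_functional_bound (S : matord R) (H : hilbert R) (f : {linear S -> BH H})
    (fP : represents f) (lam : {linear closO fP -> R[i]^o})
    (x : closO fP) (X : R) :
  (lam (munit (closO fP)) = 1 :> R[i]) -> (forall y, pos y -> 0 <= (lam y : R[i])) ->
  pos x -> obd (clos_val x) X -> complex.Re `|lam x : R[i]| <= X.
Proof.
move=> l1 lp xp xX.
have lx := lp _ xp; rewrite ger0_norm// -lecR -ge0_real// -subr_ge0.
have -> : X%:C%C - (lam x : R[i]) = lam (- x + X%:C%C *: munit (closO fP)).
  transitivity (- (lam x : R[i]) + X%:C%C * lam (munit (closO fP))).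
    by rewrite l1 mulr1 addrC.
  by rewrite (linearD lam) (linearN lam) (linearZ_LR lam).
apply: lp; apply/fpos_closM => h; rewrite /mform !sum_unit.
have xs : is_adjoint (- clos_val x : bop H H) (- clos_val x : bop H H).
  have := mform_herm (proj1 (fpos_closM _) xp) tt tt => /= xs.
  by move=> u v; rewrite /= ipNl ipNr xs.
have f1 : f (munit S) = bop_id H by case: (fP).
have := sym_add_pos xs (obdN xX) (h tt); congr (_ <= inner _ _ _).
by rewrite /= f1.
Qed.

End States.

Section Factorization.
Variables (R : realType) (S T : matord R) (H K : hilbert R).
Variables (f : {linear S -> BH H}) (g : {linear T -> BH K}).
Hypotheses (fP : represents f) (gP : represents g).
Variable M : set (bop H K).
Hypothesis Mt : is_TRO M.
Hypothesis nd : cspan (mulset (adjset M) M) (bop_id H).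
Hypothesis mA : mulset (mulset (adjset M) (range g)) M `<=` nclosure (range f).
Hypothesis mB : mulset (mulset M (range f)) (adjset M) `<=` nclosure (range g).
Local Notation A := (closO fP).
Local Notation B := (closO gP).
Local Notation av := (@clos_val R S H f).
Local Notation bv := (@clos_val R T K g).

Let f1 : f (munit S) = bop_id H. Proof. by case: fP. Qed.
Let g1 : g (munit T) = bop_id K. Proof. by case: gP. Qed.

Let mAE x y s : M x -> M y -> nclosure (range f) (bop_comp (bop_comp (adj x) (g s)) (adj (adj y))).
Proof.
move=> Mx My; rewrite adjK; apply: mA; exists (bop_comp (adj x) (g s)); last by exists y.
by exists (adj x); [exact/adjsetE|exists (g s) => //; exists s].
Qed.

Let mBE x y s : M x -> M y -> nclosure (range g) (bop_comp (bop_comp x (f s)) (adj y)).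
Proof.
move=> Mx My; apply: mB; exists (bop_comp x (f s)); last by exists (adj y) => //; exact/adjsetE.
by exists x => //; exists (f s) => //; exists s.
Qed.

Let A_in1 : nclosure (range f) (bop_id H).
Proof. by rewrite -f1; apply/asboolP; exact: clos_in_subproof. Qed.

Let B_in1 : nclosure (range g) (bop_id K).
Proof. by rewrite -g1; apply/asboolP; exact: clos_in_subproof. Qed.

(** With c = \sum_p m_p^* m_p = 1 - e, the composite sends x to c x c + om(x) (c - c^2) + w e, where
    w is a scalar of modulus at most X; each term differs from its value at e = 0 by a multiple of
    eta X. *)
Lemma approx_factor (om : {linear A -> R[i]^o}) (chi : {linear B -> R[i]^o}) (eta : R) :
  state om -> state chi -> 0 < eta <= 1 ->
  exists k (phi : 'I_k -> 'I_k -> {linear A -> B}) (psi : 'I_k -> 'I_k -> {linear B -> A}),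
  [/\ mcp phi, forall p q, phi p q (munit A) = (p == q)%:R *: munit B,
      mcp psi, \sum_p psi p p (munit B) = munit A
    & forall (x : A) (X : R), pos x -> obd (av x) X ->
        obd (av (\sum_p \sum_q psi p q (phi p q x)) - av x) (6 * eta * X)].
Proof.
move=> oms chis /andP[e0 e1].
have [k [p0 [m [Mm mr]]]] := frame_ex Mt nd e0.
pose e := bop_id H - gram m.
(* The defect 1 - m m^* of the column; it is positive but in general not small. *)
pose D (p q : 'I_k) : bop K K := (p == q)%:R *: bop_id K - bop_comp (m p) (adj (m q)).
(* Unitality of the row only fixes the sum of the diagonal defects, so all of [e] may sit in one
   entry. *)
pose E (p q : 'I_k) : bop H H := ((p == p0) && (q == p0))%:R *: e.
have Din p q : nclosure (range g) (D p q).
  suff : D p q \in closed_range g by move/asboolP.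
  rewrite rpredB ?rpredZ//; apply/asboolP => //.
  have -> : bop_comp (m p) (adj (m q)) = bop_comp (bop_comp (m p) (f (munit S))) (adj (m q)).
    by rewrite f1; exact: bopP.
  exact: mBE.
have Ein p q : nclosure (range f) (E p q).
  suff : E p q \in closed_range f by move/asboolP.
  rewrite rpredZ// rpredB ?rpred_sum//; first by apply/asboolP.
  move=> l _; apply/asboolP.
  have -> : bop_comp (adj (m l)) (m l) =
      bop_comp (bop_comp (adj (m l)) (g (munit T))) (adj (adj (m l))).
    by rewrite g1 adjK; exact: bopP.
  exact: mAE.
pose phi := compress gP om (fun p q s => mBE s (Mm p) (Mm q)) Din.
pose psi := compress fP chi (fun p q s => mAE s (Mm p) (Mm q)) Ein.
have oms1 : om (munit A) = 1 :> R[i] by case: oms.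
have chis1 : chi (munit B) = 1 :> R[i] by case: chis.
have eb := defect_bound mr; have es := defect_sym m.
have ipn (L : hilbert R) (z : L) : inner L z z = (nr z ^+ 2)%:C%C.
  by rewrite [LHS](ge0_real (ip_ge0 _)) Re_ip.
(* A column bounded by 1 has an adjoint bounded by 1: for x = \sum_p m_p^* h_p the squared norm of x
   is the real part of the sum of the <m_p x, h_p>, hence at most half of |h|^2 + |x|^2. *)
have Dp h : 0 <= mform D h h.
  pose x := \sum_p adj (m p) (h p).
  have -> : mform D h h = (\sum_p nr (h p) ^+ 2 - nr x ^+ 2)%:C%C.
    rewrite rmorphB rmorph_sum /= -ipn {2}/x ip_sumr -sumrB; apply: eq_bigr => p _.
    rewrite -ipn /x ip_suml.
    transitivity (\sum_q ((p == q)%:R * inner K (h q) (h p)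
        - inner H (adj (m q) (h q)) (adj (m p) (h p)))).
      apply: eq_bigr => q _.
      transitivity (inner K ((p == q)%:R *: h q - m p (adj (m q) (h q))) (h p)); first by [].
      by rewrite !ipE adjP.
    rewrite sumrB; congr (_ - _); rewrite (bigD1 p)//= eqxx mul1r big1 ?addr0// => q.
    by rewrite eq_sym => /negPf ->; rewrite mul0r.
  rewrite lecR subr_ge0.
  have le1 p : 2 * complex.Re (inner K (m p x) (h p)) <= nr (h p) ^+ 2 + nr (m p x) ^+ 2.
    have := sqr_ge0 (nr (h p - m p x)).
    rewrite -[nr (_ - _) ^+ 2]Re_ip ipBl !ipBr !ReB !Re_ip [inner K (m p x) (h p)]ipC Re_conj; lra.
  have : \sum_p 2 * complex.Re (inner K (m p x) (h p)) <=
      \sum_p (nr (h p) ^+ 2 + nr (m p x) ^+ 2) by apply: ler_sum => p _; exact: le1.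
  rewrite big_split /= -mulr_sumr.
  have -> : \sum_p complex.Re (inner K (m p x) (h p)) = nr x ^+ 2.
    rewrite -Re_ip {3}/x ip_sumr Re_sum; apply: eq_bigr => p _; by rewrite adjP.
  by move: (mr x) => /andP[_ u]; lra.
have Ep h : 0 <= mform E h h.
  rewrite /mform (bigD1 p0)//= (bigD1 p0)//= big1 => [|q /negPf qp]; last first.
    transitivity (inner H (((p0 == p0) && (q == p0))%:R *: e (h q)) (h p0)); first by [].
    by rewrite qp andbF scale0r ip0l.
  rewrite big1 => [|p /negPf pp]; last first.
    rewrite big1// => q _.
    transitivity (inner H (((p == p0) && (q == p0))%:R *: e (h q)) (h p)); first by [].
    by rewrite pp scale0r ip0l.
  rewrite !addr0.
  have -> : inner H (E p0 p0 (h p0)) (h p0) = inner H (e (h p0)) (h p0).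
    transitivity (inner H (((p0 == p0) && (p0 == p0))%:R *: e (h p0)) (h p0)); first by [].
    by rewrite eqxx scale1r.
  by rewrite sym_real// lecR; have /andP[] := eb (h p0).
have phiM : mcp phi := compress_mcp gP _ Din oms Dp.
have psiM : mcp psi := compress_mcp fP _ Ein chis Ep.
have phi1 p q : phi p q (munit A) = (p == q)%:R *: munit B.
  apply/val_inj/bopP => h.
  transitivity (m p ((f (munit S) : bop H H) (adj (m q) h)) +
    (om (munit A) : R[i]) *: ((p == q)%:R *: h - m p (adj (m q) h))); first by [].
  transitivity ((p == q)%:R *: (g (munit T) : bop K K) h); last by [].
  by rewrite oms1 scale1r f1 g1 addrC subrK.
exists k, phi, psi; split=> //.
  apply/val_inj/bopP => h.
  transitivity ((f (munit S) : bop H H) h); last by [].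
  rewrite [val _](linear_sum av) bop_sumE.
  transitivity (\sum_p (adj (m p) ((g (munit T) : bop K K) (adj (adj (m p)) h)) +
    (chi (munit B) : R[i]) *: (((p == p0) && (p == p0))%:R *: e h))); first by [].
  rewrite big_split /= chis1 g1 f1.
  rewrite [X in _ + X](bigD1 p0)//= eqxx !scale1r [X in _ + (_ + X)]big1 => [|p /negPf ->]; last first.
    by rewrite scale0r scaler0.
  rewrite addr0; transitivity (gram m h + (h - gram m h)); last by rewrite addrC subrK.
  congr (_ + _); rewrite bop_sumE; apply: eq_bigr => p _.
  by rewrite adjK.
move=> x X xp xX.
have cx : complex.Re `|om x : R[i]| <= X.
  exact: (pos_functional_bound oms1 (fun y => state_pos oms) xp xX).
(* Because [E] is supported at [p0], this is the only value of [chi] that survives in the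
   composite. *)
pose w : R[i] := chi (phi p0 p0 x).
have cw : complex.Re `|w| <= X.
  pose lam : {linear A -> R[i]^o} := chi \o phi p0 p0.
  apply: (pos_functional_bound (lam := lam) _ _ xp xX) => [|y yp].
    transitivity (chi (phi p0 p0 (munit A)) : R[i]); first by [].
    by rewrite phi1 eqxx scale1r.
  apply: (state_pos (x := phi p0 p0 y) chis).
  exact: (phiM unit (fun _ _ => y) (fun=> p0) yp).
have X0 : 0 <= X by apply: le_trans cx; exact: Re_norm_ge0.
have ob : obd e eta.
  move=> h; rewrite -ler_sqr ?nnegrE ?nr_ge0//; last by rewrite mulr_ge0 ?nr_ge0// ltW.
  have r01 : 0 < eta <= 1 by rewrite e0.
  apply: le_trans (pos_contr_le es eb r01 h) _.
  rewrite exprMn [eta ^+ 2]expr2 -mulrA ler_wpM2l; [by []|exact: ltW|].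
  by have /andP[] := eb h.
have oc : obd (gram m) 2.
  have -> : gram m = bop_id H - e by rewrite /e opprB addrC subrK.
  by apply: obdW (obdB (@obd_id _ H) ob); lra.
(* Substitute c = 1 - e: c x c - x gives the first three terms, and the row turns the column defect
   into c - c^2 = e c, which is small. *)
have -> : av (\sum_p \sum_q psi p q (phi p q x)) - av x =
  bop_comp (bop_comp e (av x)) e - bop_comp e (av x) - bop_comp (av x) e
  + (om x : R[i]) *: bop_comp e (gram m) + w *: e.
  set c := gram m.
  have cE z : c z = \sum_p adj (m p) (m p z) by rewrite bop_sumE.
  have eE z : e z = z - c z by [].
  apply: bopP => h.
  have sE : av (\sum_p \sum_q psi p q (phi p q x)) h = \sum_p \sum_q
      (adj (m p) (m p (av x (adj (m q) (m q h)))) + (om x : R[i]) *: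
       ((p == q)%:R *: adj (m p) (m q h) - adj (m p) (m p (adj (m q) (m q h))))
       + (chi (phi p q x) : R[i]) *: (((p == p0) && (q == p0))%:R *: e h)).
    rewrite (linear_sum av) bop_sumE; apply: eq_bigr => p _.
    rewrite (linear_sum av) bop_sumE; apply: eq_bigr => q _.
    transitivity (adj (m p) (m p (av x (adj (m q) (adj (adj (m q)) h))) + (om x : R[i]) *:
       ((p == q)%:R *: adj (adj (m q)) h - m p (adj (m q) (adj (adj (m q)) h))))
       + (chi (phi p q x) : R[i]) *: (((p == p0) && (q == p0))%:R *: e h)); first by [].
    by rewrite adjK bopD bopZ bopB bopZ.
  have s1 : \sum_p \sum_q adj (m p) (m p (av x (adj (m q) (m q h)))) = c (av x (c h)).
    rewrite [RHS]cE; apply: eq_bigr => p _; rewrite (cE h) !bop_sum.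
    by [].
  have s2 : \sum_p \sum_q ((p == q)%:R *: adj (m p) (m q h)
      - adj (m p) (m p (adj (m q) (m q h)))) = c h - c (c h).
    rewrite (cE h) (cE (\sum_p _)) -sumrB; apply: eq_bigr => p _; rewrite sumrB !bop_sum; congr (_ - _).
    rewrite (bigD1 p)//= eqxx scale1r big1 ?addr0// => q.
    by rewrite eq_sym => /negPf ->; rewrite scale0r.
  have s3 : \sum_p \sum_q (chi (phi p q x) : R[i]) *: (((p == p0) && (q == p0))%:R *: e h)
      = w *: e h.
    rewrite (bigD1 p0)//= (bigD1 p0)//= [X in _ + X + _]big1 => [|q /negPf ->]; last first.
      by rewrite andbF scale0r scaler0.
    rewrite [X in _ + X]big1 => [|p /negPf ->]; last first.
      by rewrite big1// => q _; rewrite scale0r scaler0.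
    by rewrite eqxx scale1r !addr0.
  transitivity (c (av x (c h)) + (om x : R[i]) *: (c h - c (c h)) + w *: e h - av x h).
    transitivity (av (\sum_p \sum_q psi p q (phi p q x)) h - av x h); first by [].
    rewrite sE -s1 -s2 -s3 scaler_sumr -!big_split /=; congr (_ - _).
    apply: eq_bigr => p _; rewrite scaler_sumr -!big_split /=.
    by [].
  transitivity (e (av x (e h)) - e (av x h) - av x (e h) + (om x : R[i]) *: e (c h) + w *: e h);
    last by [].
  rewrite 4!eE !bopB -/c.
  set P := av x h; set Q := av x (c h).
  rewrite -[LHS]addrA -[LHS]addrA [X in c Q + X]addrA [X in c Q + X]addrC !addrA.
  congr (_ + _ + _); rewrite !opprB.
  rewrite -[P - Q + _ + _]addrA [c Q - c P + _]addrA subrK.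
  by rewrite [RHS]addrAC [P - Q + (Q - P)]addrA subrK subrr add0r.
have x1 := obd_comp (ltW e0) xX ob.
have x2 := obd_comp X0 ob xX.
have x3 := obd_comp (mulr_ge0 (ltW e0) X0) ob x1.
have x4 := obdZ (om x : R[i]) (obd_comp (ltW e0) oc ob).
have x5 := obdZ w ob.
(* In multiples of eta X the five terms cost 1, 1, 1, 2 and 1; this is the constant 6. The first
   uses [eta <= 1], the fourth the bound 2 on [gram m]. *)
apply: obdW (obdD (obdD (obdB (obdB x3 x1) x2) x4) x5).
have : complex.Re `|om x : R[i]| * (eta * 2) <= X * (eta * 2) by rewrite ler_wpM2r// mulr_ge0// ltW.
have : complex.Re `|w| * eta <= X * eta by rewrite ler_wpM2r// ltW.
have : eta * X * eta <= eta * X by rewrite ler_piMr// mulr_ge0// ltW.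
lra.
Qed.
End Factorization.

(** * Transfer of nuclearity across the TRO *)

Section Transfer.
Variables (R : realType) (S T : matord R) (H K : hilbert R).
Variables (f : {linear S -> BH H}) (g : {linear T -> BH K}).
Hypotheses (fP : represents f) (gP : represents g).
Variable M : set (bop H K).
Hypothesis Mt : is_TRO M.
Hypothesis nd : cspan (mulset (adjset M) M) (bop_id H).
Hypothesis mA : mulset (mulset (adjset M) (range g)) M `<=` nclosure (range f).
Hypothesis mB : mulset (mulset M (range f)) (adjset M) `<=` nclosure (range g).
Local Notation A := (closO fP).
Local Notation B := (closO gP).
Local Notation av := (@clos_val R S H f).
Local Notation bv := (@clos_val R T K g).

(** If [B] is zero, its unit is, so [K] is the zero space; the lower frame bound then leaves no
    nonzero vector in [H]. This settles the case where [B] has no state. *)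
Lemma link_trivial : (forall y : B, y = 0) -> forall x : A, x = 0.
Proof.
move=> B0 x; apply/val_inj/bopP => h.
have K0 (k : K) : k = 0.
  have g1 : g (munit T) = bop_id K by case: gP.
  transitivity ((g (munit T) : bop K K) k); first by rewrite g1.
  by transitivity (bv (munit B) k); [by []|rewrite (B0 (munit B))].
have e0 : (0 : R) < 2^-1 by rewrite invr_gt0 ltr0n.
have [k [p0 [m [_ /(_ (av x h)) /andP[mr _]]]]] := frame_ex Mt nd e0.
have s0 : \sum_l nr (m l (av x h)) ^+ 2 = 0.
  by rewrite big1// => l _; rewrite (K0 (m l _)) nr0 expr0n.
by apply: nr_eq0; rewrite leNgt; apply/negP => /(exprn_gt0 2); move: mr; rewrite s0; lra.
Qed.

(** Factoring through [B] replaces each positive factor [a l] by a nearby [theta (a l)], and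
    [fpos_approx] accepts such a replacement for every error [e]. *)
Lemma pnuc_link (t' t : os_tensor_product R) :
  amplifies_col t' -> amplifies_row t -> pnuc t' t B -> pnuc t' t A.
Proof.
move=> ac ar nB W I u up.
have [L [z [xi [a [b [ap bp uE]]]]]] := fpos_pos_comb up.
have uE' : u = comb z xi a b by apply/funext => i; apply/funext => j.
have A0 : (forall x : A, x = 0) -> fpos (V := alg_tensor t A W) u.
  move=> A0; apply: (@eq_fpos _ (alg_tensor t A W) _ _ _ _ (@fpos0 _ (alg_tensor t A W) I)) => i j.
  rewrite uE /comb big1// => l _; rewrite (A0 (a l)).
  by rewrite linear0l scaler0.
case: (state_ex A) => [[om oms]|//].
case: (state_ex B) => [[chi chis]|B0]; last exact: A0 (link_trivial B0).
rewrite uE'; apply: fpos_approx => // e e0.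
have /choice[C CP] l : exists C : R, 0 <= C /\ obd (av (a l)) C.
  by have [C C0 Ch] := bop_bnd (av (a l)); exists C.
pose X := 1 + \sum_l C l.
have CX l : obd (av (a l)) X.
  have [C0 Cl] := CP l; apply: obdW Cl; rewrite /X (bigD1 l)//=.
  have : 0 <= \sum_(i | i != l) C i by apply: sumr_ge0 => i _; case: (CP i).
  by lra.
have X1 : 1 <= X by rewrite lerDl sumr_ge0// => l _; case: (CP l).
have X0 : 0 < 6 * X by lra.
(* Chosen so that the error 6 eta X of [approx_factor] stays below [e], with [X] a common bound of
   all the [a l]. *)
pose eta := Num.min 1 (e / (6 * X)).
have eta01 : 0 < eta <= 1 by rewrite lt_min ltr01 divr_gt0//= ge_min lexx.
have etaX : 6 * eta * X <= e.
  have : eta <= e / (6 * X) by rewrite ge_min lexx orbT.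
  rewrite ler_pdivlMr//; lra.
have [k [phi [psi [phiM phi1 psiM psi1 th]]]] :=
  approx_factor Mt nd mA mB oms chis eta01.
pose theta (x : A) : A := \sum_p \sum_q psi p q (phi p q x).
have thp l : pos (theta (a l)) by apply: mcp_comp (ap l).
have thb l : obd (av (theta (a l)) - av (a l)) e := obdW etaX (th _ _ (ap l) (CX l)).
exists (fun l => theta (a l)); split=> [l|l|].
- by apply: pos_close => //; rewrite -opprB; exact: obdN.
- exact: pos_close.
(* The column keeps positivity for [t'], nuclearity of [B] changes [t'] to [t], and the row keeps
   positivity for [t]. *)
have c1 : fpos (V := alg_tensor t A W) (fun i j => comb z xi (fun l => theta (a l)) b i j).
  have u1 : fpos (V := alg_tensor t' A W) (fun x y : I * 'I_k => u x.1 y.1) :=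
    @fpos_sel _ (alg_tensor t' A W) _ _ _ fst up.
  have u2 := nB _ _ _ (ac _ _ W _ _ phiM phi1 _ _ snd u1).
  have u3 := fpos_push_fst (ar _ _ W _ _ psiM psi1 _ _ snd u2).
  apply: (@eq_fpos _ (alg_tensor t A W)) u3 => i j.
  transitivity (\sum_p \sum_q tmap (psi p q) (idfun : {linear W -> W})
    (tmap (phi p q) (idfun : {linear W -> W}) (u i j))); first by [].
  rewrite uE'; under eq_bigr => p _ do under eq_bigr => q _ do rewrite !comb_map.
  rewrite /comb; under eq_bigr => p _ do rewrite exchange_big /=.
  rewrite exchange_big /=; apply: eq_bigr => l _.
  under eq_bigr => p _ do rewrite -scaler_sumr.
  rewrite -scaler_sumr; congr (_ *: _).
  rewrite /theta linear_sumlz; apply: eq_bigr => p _; rewrite linear_sumlz.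
  by [].
have c2 : fpos (V := alg_tensor t A W) (comb (fun l => `|z l|) xi (fun=> munit A) b).
  by apply: comb_pos => // l; exact: pos_unit.
have e0' : 0 <= e%:C%C :> R[i] by rewrite lecR ltW.
exact: (@fposD _ (alg_tensor t A W) _ _ _ c1 (@fposZ _ (alg_tensor t A W) _ _ _ e0' c2)).
Qed.

End Transfer.

Section Invariance.
Variables (R : realType) (t' t : os_tensor_product R).
Hypotheses (tf' : functorial t') (tf : functorial t).

(** The identity of [S] extends to both closures, and uniqueness of extensions makes the two maps
    inverse to each other. *)
Lemma realization_iso (S : opsys R) (H : hilbert R) (f : {linear S -> BH H})
    (fP : represents f) :
  exists (F : {linear closO fP -> compl S}) (G : {linear compl S -> closO fP}),
    [/\ ucp F, ucp G, forall x, G (F x) = x & forall x, F (G x) = x].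
Proof.
have idcp : cp (idfun : {linear S -> S}) := proj2 (id_ucp S).
have [F [Fin Fcp]] := ext_clos fP (repP S) idcp.
have [G [Gin Gcp]] := ext_clos (repP S) fP idcp.
exists F, G; split.
- by split=> //; exact: (Fin (munit S)).
- by split=> //; exact: (Gin (munit S)).
- apply: (cp_uniq (W := closO fP) fP (F := G \o F) (G := idfun)) => [||s].
  + exact: cp_comp.
  + exact: (proj2 (id_ucp (closO fP))).
  + by rewrite /= Fin Gin.
- apply: (cp_uniq (W := compl S) (repP S) (F := F \o G) (G := idfun)) => [||s].
  + exact: cp_comp.
  + exact: (proj2 (id_ucp (compl S))).
  + by rewrite /= Gin Fin.
Qed.

(** The chain leads from [T] to its completion, the closure of its image, across the TRO, to the
    completion of [S] and to [S]; the script runs it backwards. *)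
Lemma pnuc_Delta (S T : opsys R) :
  amplifies_col t' -> compl_reflects t' -> amplifies_row t -> compl_reflects t ->
  Delta_equiv S T -> pnuc t' t T -> pnuc t' t S.
Proof.
move=> ac cr' ar cr [H [K [f [g [[fu fe] [gu ge] [M [Mt [nd _] mA mB]]]]]]] nT.
have fP := coe_represents fu fe; have gP := coe_represents gu ge.
have [F [G [Fu Gu GF FG]]] := realization_iso fP.
have [F' [G' [Fu' Gu' GF' FG']]] := realization_iso gP.
apply: (pnuc_of_compl tf' cr); apply: (pnuc_retract tf' tf Gu Fu FG).
apply: (pnuc_link Mt nd mA mB ac ar); apply: (pnuc_retract tf' tf Fu' Gu' GF').
exact: pnuc_compl.
Qed.

End Invariance.

Theorem theorem5p5 (R : realType) (S T : opsys R) (t' t : os_tensor_product R) :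
  Delta_equiv S T -> functorial t' -> functorial t -> tensor_le t' t ->
  (associative_tensor t' /\ associative_tensor t)
  \/ (associative_tensor t' /\ is_el t)
  \/ (associative_tensor t' /\ is_er t)
  \/ (is_el t' /\ associative_tensor t)
  \/ (is_er t' /\ associative_tensor t)
  \/ (is_el t' /\ is_commuting t) ->
  (nuclear t' t S <-> nuclear t' t T).
Proof.
move=> ST tf' tf le cases.
suff [ac cr' ar cr] : [/\ amplifies_col t', compl_reflects t', amplifies_row t & compl_reflects t].
  have TS := Delta_equiv_sym ST; split=> /(nuclearP _ le) h; apply/(nuclearP _ le).
    exact: (pnuc_Delta tf' tf ac cr' ar cr TS).
  exact: (pnuc_Delta tf' tf ac cr' ar cr ST).
(* For el, er and c amplification holds for arbitrary families, which covers the unital ones. *)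
have colA (s : os_tensor_product R) : amplifies s -> amplifies_col s.
  by move=> sa S' T' W k phi phiM _; exact: sa.
have rowA (s : os_tensor_product R) : amplifies s -> amplifies_row s.
  by move=> sa S' T' W k phi phiM _; exact: sa.
case: cases => [[a' a]|[[a' a]|[[a' a]|[[a' a]|[[a' a]|[a' a]]]]]].
- by split; [exact: assoc_amplifies_col|exact: assoc_compl_reflects
    |exact: assoc_amplifies_row|exact: assoc_compl_reflects].
- by split; [exact: assoc_amplifies_col|exact: assoc_compl_reflects
    |exact: rowA (el_amplifies a)|exact: el_compl_reflects].
- by split; [exact: assoc_amplifies_col|exact: assoc_compl_reflects
    |exact: rowA (er_amplifies a)|exact: er_compl_reflects].
- by split; [exact: colA (el_amplifies a')|exact: el_compl_reflects
    |exact: assoc_amplifies_row|exact: assoc_compl_reflects].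
- by split; [exact: colA (er_amplifies a')|exact: er_compl_reflects
    |exact: assoc_amplifies_row|exact: assoc_compl_reflects].
- by split; [exact: colA (el_amplifies a')|exact: el_compl_reflects
    |exact: rowA (comm_amplifies a)|exact: comm_compl_reflects].
Qed.
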